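(* Let $1\le n<m$ and let $A=(a_{ij})_{m\times m}$ be a Cartier-Foata matrix ($a_{ik}a_{jl}=a_{jl}a_{ik}$ for all $i\ne j$ and all $k,l$). Let $C=(c_{ij})_{n+1\le i,j\le m}$ with $$c_{ij}=-\det{}^{-1}(I-A_0)\cdot\det\begin{pmatrix} I-A_0 & -a_{*j}\\ -a_{i*} & -a_{ij}\end{pmatrix}.$$ Then for every $\beta\in\mathbb C$, $$\Big(\frac1{\det(I-C)}\Big)^{\beta}=\sum_\mu e_\mu(\beta)\,a_{\lambda,\mu},$$ where $\mu$ runs over all words in the alphabet $\{1,\dots,m\}$, $\lambda$ is the non-decreasing rearrangement of $\mu$, and $e_\mu(\beta)$ is computed as follows. Let $u_1u_2\cdots u_k$ be the disjoint cycle decomposition of $a_{\lambda,\mu}$, let $\mathcal J$ be the set of $i\in\{1,\dots,k\}$ such that $u_i$ contains a height $>n$, and $l=|\mathcal J|$. Then $$e_\mu(\beta)=\sum_\pi\binom{\beta+l-1-d(\pi)}{l},$$ where $d(\pi)$ is the number of descents of the subword of $\pi(1)\pi(2)\cdots\pi(k)$ consisting of the letters $\pi(i)\in\mathcal J$, and the sum is over all $\pi\in S_k$ such that: (1) if $i<j$ and $\pi(i)>\pi(j)$, then $u_{\pi(i)}$ and $u_{\pi(j)}$ are disjoint; (2) for each $i=1,\dots,k$ there exists $j\ge i$ with $\pi(j)\in\mathcal J$; (3) if $j\ge i$ is minimal with $\pi(j)\in\mathcal J$ and $j>i$, then there exists $k'$ with $i<k'\le j$ such that $u_{\pi(i)}$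 and $u_{\pi(k')}$ are not disjoint; (4) if $\pi(i)>\pi(i+1)$ then $\pi(i)\in\mathcal J$.
   Context: $\mathcal A$ is the $\mathbb C$-algebra of formal power series in non-commuting variables $a_{ij}$, $1\le i,j\le m$; identities hold in the quotient by the closed two-sided ideal generated by the Cartier-Foata relations. $A_0=(a_{ij})_{1\le i,j\le n}$, $a_{i*}=(a_{i1},\dots,a_{in})$, $a_{*j}=(a_{1j},\dots,a_{nj})^T$; $\det B=\sum_{\sigma\in S_N}(-1)^{\operatorname{inv}\sigma}b_{\sigma(1)1}\cdots b_{\sigma(N)N}$, and $\det(I-C)$ is computed by this formula with the $c_{ij}$ as entries; $\det^{-1}$ denotes the inverse of an element with constant term $1$. Writing $\det(I-C)=1-\Sigma$ with $\Sigma$ without constant term, $(1/\det(I-C))^\beta:=\sum_{r\ge0}\binom{\beta+r-1}{r}\Sigma^r$. Words: $a_{\lambda,\mu}=a_{\lambda_1\mu_1}\cdots a_{\lambda_\ell\mu_\ell}$; the letter $a_{ij}$ is viewed as a step from height $i$ to height $j$, and a word as a sequence of steps. An ordered sequence (o-sequence) is a word $a_{\lambda,\mu}$ with $\lambda$ non-decreasing and $\mu$ a rearrangement of $\lambda$. The map $\varphi$: given an o-sequence $\alpha$, for $h=1,\dots,m$ in turn build a walk $W_h$ starting at height $h$ by repeatedly appending, from the current height $c$, the first not-yet-used step of $\alpha$ (in the order of $\alpha$) that starts at $c$, until no unused step starts at the current height; $\varphi(\alpha)=W_1W_2\cdots W_m$. Disjoint cycle decomposition: set $\gamma=\varphi(a_{\lambda,\mu})$;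 while $\gamma$ is nonempty, let $v_0,v_1,v_2,\dots$ be the starting height of its first step followed by the ending heights of its successive steps, let $t$ be the least index with $v_t=v_s$ for some $s<t$; the steps $s+1,\dots,t$ form a cycle $v_s\to v_{s+1}\to\dots\to v_t=v_s$ with distinct starting heights; record it as the next $u_i$ and delete these steps from $\gamma$. The result is the list $u_1,\dots,u_k$. Two cycles are disjoint if their sets of starting heights are disjoint. A descent of a word $x_1\cdots x_r$ is an index $s$ with $x_s>x_{s+1}$. *)

(* Defs.v *)
From HB Require Import structures.
From mathcomp Require Import all_boot all_order all_algebra.
From mathcomp Require Import fingroup perm complex.
From mathcomp Require Import boolp classical_sets functions cardinality fsbigop.
From mathcomp Require Import reals.

Set Implicit Arguments.
Unset Strict Implicit.
Unset Printing Implicit Defensive.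

Import Order.TTheory GRing.Theory Num.Theory.

Local Open Scope ring_scope.

(** * Formal power series in non-commuting variables *)

(* A series over the alphabet X is its coefficient function on words. *)
Definition ncseries (K : fieldType) (X : finType) : Type := seq X -> K.

HB.instance Definition _ (K : fieldType) (X : finType) :=
  GRing.Zmodule.copy (ncseries K X) (seq X -> K).

Section NCSeriesRing.
Variables (K : fieldType) (X : finType).
Implicit Types f g h : ncseries K X.

Lemma nc_addE f g w : (f + g) w = f w + g w. Proof. by []. Qed.
Lemma nc_oppE f w : (- f) w = - f w. Proof. by []. Qed.
Lemma nc_zeroE w : (0 : ncseries K X) w = 0. Proof. by []. Qed.

Definition nc_one : ncseries K X := fun w => (w == [::])%:R.

Definition nc_mul f g : ncseries K X :=
  fun w => \sum_(k < (size w).+1) f (take k w) * g (drop k w).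

Definition nc_deriv (x : X) f : ncseries K X := fun w => f (x :: w).

Lemma nc_mul_nil f g : nc_mul f g [::] = f [::] * g [::].
Proof. by rewrite /nc_mul big_ord1. Qed.

Lemma nc_mul_cons f g x w :
  nc_mul f g (x :: w) = f [::] * g (x :: w) + nc_mul (nc_deriv x f) g w.
Proof. by rewrite /nc_mul big_ord_recl. Qed.

Lemma nc_mulDl : left_distributive nc_mul +%R.
Proof.
move=> f g h; apply/funext => w; rewrite nc_addE /nc_mul -big_split /=.
by apply: eq_bigr => k _; rewrite -mulrDl.
Qed.

Lemma nc_mulDr : right_distributive nc_mul +%R.
Proof.
move=> f g h; apply/funext => w; rewrite nc_addE /nc_mul -big_split /=.
by apply: eq_bigr => k _; rewrite -mulrDr.
Qed.

Lemma nc_mul1l : left_id nc_one nc_mul.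
Proof.
move=> f; apply/funext => w; rewrite /nc_mul big_ord_recl /= take0 drop0 mul1r.
rewrite big1 ?addr0 // => k _; rewrite /nc_one -size_eq0 size_take.
by case: w k => [|x w] k; [case: k | case: ifP => _; rewrite mul0r].
Qed.

Lemma nc_mul1r : right_id nc_one nc_mul.
Proof.
move=> f; apply/funext => w; rewrite /nc_mul big_ord_recr /= take_size drop_size.
rewrite /nc_one eqxx mulr1 big1 ?add0r // => k _.
by rewrite -size_eq0 size_drop subn_eq0 leqNgt ltn_ord mulr0.
Qed.

Lemma nc_mulA : associative nc_mul.
Proof.
move=> f g h; apply/funext => w; elim: w f g h => [|x w IH] f g h.
  by rewrite !nc_mul_nil mulrA.
rewrite !nc_mul_cons nc_mul_nil mulrDr mulrA -addrA; congr (_ + _).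
have -> : nc_deriv x (nc_mul f g) =
    ((fun v => f [::] * nc_deriv x g v) : ncseries K X)
      + nc_mul (nc_deriv x f) g.
  by apply/funext => v; rewrite nc_addE /nc_deriv nc_mul_cons.
rewrite nc_mulDl nc_addE -IH; congr (_ + _).
by rewrite /nc_mul mulr_sumr; apply: eq_bigr => k _; rewrite mulrA.
Qed.

Lemma nc_one_neq0 : nc_one != 0.
Proof. by apply/eqP => /(congr1 (@^~ [::])) /eqP; rewrite oner_eq0. Qed.

HB.instance Definition _ := GRing.Zmodule_isNzRing.Build (ncseries K X)
  nc_mulA nc_mul1l nc_mul1r nc_mulDl nc_mulDr nc_one_neq0.

Lemma nc_oneE w : (1 : ncseries K X) w = (w == [::])%:R. Proof. by []. Qed.

Lemma nc_mulE f g w :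
  (f * g) w = \sum_(k < (size w).+1) f (take k w) * g (drop k w).
Proof. by []. Qed.

Lemma nc_mul_consE f g x w :
  (f * g) (x :: w) = f [::] * g (x :: w) + (nc_deriv x f * g) w.
Proof. exact: nc_mul_cons. Qed.

Lemma nc_const1 : (1 : ncseries K X) [::] = 1. Proof. by []. Qed.

Lemma nc_constM f g : (f * g) [::] = f [::] * g [::].
Proof. exact: nc_mul_nil. Qed.

Lemma nc_sumE (I : Type) (r : seq I) (P : pred I) (F : I -> ncseries K X) w :
  (\sum_(i <- r | P i) F i) w = \sum_(i <- r | P i) F i w.
Proof. by elim/big_rec2: _ => // i a b _ <-. Qed.

Definition nc_scale (a : K) f : ncseries K X := fun w => a * f w.

Lemma nc_scaleA a b f : nc_scale a (nc_scale b f) = nc_scale (a * b) f.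
Proof. by apply/funext => w; rewrite /nc_scale mulrA. Qed.
Lemma nc_scale1 : left_id 1 nc_scale.
Proof. by move=> f; apply/funext => w; rewrite /nc_scale mul1r. Qed.
Lemma nc_scaleDr : right_distributive nc_scale +%R.
Proof. by move=> a f g; apply/funext => w; rewrite /nc_scale nc_addE mulrDr. Qed.
Lemma nc_scaleDl f : {morph nc_scale^~ f : a b / a + b}.
Proof. by move=> a b; apply/funext => w; rewrite /nc_scale nc_addE mulrDl. Qed.

HB.instance Definition _ := GRing.Zmodule_isLmodule.Build K (ncseries K X)
  nc_scaleA nc_scale1 nc_scaleDr nc_scaleDl.

Lemma nc_scaleE (a : K) f w : (a *: f) w = a * f w. Proof. by []. Qed.

Lemma nc_scaleAl (a : K) f g : a *: (f * g) = (a *: f) * g.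
Proof.
apply/funext => w; rewrite nc_scaleE !nc_mulE mulr_sumr.
by apply: eq_bigr => k _; rewrite nc_scaleE mulrA.
Qed.

HB.instance Definition _ :=
  GRing.Lmodule_isLalgebra.Build K (ncseries K X) nc_scaleAl.

Lemma nc_scaleAr (a : K) f g : a *: (f * g) = f * (a *: g).
Proof.
apply/funext => w; rewrite nc_scaleE !nc_mulE mulr_sumr.
by apply: eq_bigr => k _; rewrite nc_scaleE mulrCA.
Qed.

HB.instance Definition _ :=
  GRing.Lalgebra_isAlgebra.Build K (ncseries K X) nc_scaleAr.

Lemma nc_exp_small f r w : f [::] = 0 -> (size w < r)%N -> (f ^+ r) w = 0.
Proof.
move=> f0; elim: r w => [//|r IH] w; rewrite ltnS => ltwr.
rewrite exprS nc_mulE big_ord_recl /= take0 f0 mul0r add0r big1 // => k _.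
rewrite IH ?mulr0 // size_drop /bump /= add1n.
by case: w k ltwr => [|x w] [k ltk] //= ltwr; rewrite subSS (leq_ltn_trans (leq_subr _ _)).
Qed.

(* Geometric series: terms with r > size w do not contribute at w. *)
Definition nc_geom f : ncseries K X :=
  fun w => \sum_(r < (size w).+1) (f ^+ r) w.

Lemma nc_geomE f N w : f [::] = 0 -> (size w <= N)%N ->
  nc_geom f w = (\sum_(r < N.+1) f ^+ r) w.
Proof.
move=> f0 lewN; rewrite nc_sumE /nc_geom (big_ord_widen N.+1 (fun r => (f ^+ r) w)) //.
rewrite big_mkcond /=; apply: eq_bigr => r _; case: ifPn => //.
by rewrite -leqNgt => ltwr; rewrite nc_exp_small.
Qed.

Lemma nc_geomVr f : f [::] = 0 -> (1 - f) * nc_geom f = 1.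
Proof.
move=> f0; apply/funext => w; rewrite nc_mulE.
transitivity (((1 - f) * (\sum_(r < (size w).+1) f ^+ r)) w).
  rewrite nc_mulE; apply: eq_bigr => k _; congr (_ * _).
  by apply: nc_geomE => //; rewrite size_drop leq_subr.
set S := \sum_(r < _) _; have -> : (1 - f) * S = 1 - f ^+ (size w).+1.
  by rewrite -[1 - f]opprB mulNr -subrX1 opprB.
by rewrite nc_addE nc_oppE nc_exp_small // oppr0 addr0.
Qed.

Lemma nc_geomVl f : f [::] = 0 -> nc_geom f * (1 - f) = 1.
Proof.
move=> f0; apply/funext => w; rewrite nc_mulE.
transitivity (((\sum_(r < (size w).+1) f ^+ r) * (1 - f)) w).
  rewrite nc_mulE; apply: eq_bigr => k _; congr (_ * _).
  by apply: nc_geomE => //; rewrite size_take_min geq_minr.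
set S := \sum_(r < _) _; have -> : S * (1 - f) = 1 - f ^+ (size w).+1.
  have cSf : GRing.comm S (1 - f).
    apply: commrB; first exact: commr1.
    apply/commr_sym/commr_sum => i _; exact/commrX/commr_refl.
  by rewrite cSf -[1 - f]opprB mulNr -subrX1 opprB.
by rewrite nc_addE nc_oppE nc_exp_small // oppr0 addr0.
Qed.

Definition nc_unit : pred (ncseries K X) := fun f => f [::] != 0.

Definition nc_inv f : ncseries K X :=
  if nc_unit f then (f [::])^-1 *: nc_geom (1 - (f [::])^-1 *: f) else f.

Lemma nc_inv_aux f : nc_unit f -> (1 - (f [::])^-1 *: f) [::] = 0.
Proof.
by move=> uf; rewrite nc_addE nc_oppE nc_scaleE mulVf // nc_const1 subrr.
Qed.

Lemma nc_mulVr : {in nc_unit, left_inverse 1 nc_inv *%R}.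
Proof.
move=> f ufin; have uf : nc_unit f := ufin; have := nc_geomVl (nc_inv_aux uf); rewrite /nc_inv uf.
by rewrite subKr -scalerAr -scalerAl.
Qed.

Lemma nc_divrr : {in nc_unit, right_inverse 1 nc_inv *%R}.
Proof.
move=> f ufin; have uf : nc_unit f := ufin; have := nc_geomVr (nc_inv_aux uf); rewrite /nc_inv uf.
by rewrite subKr -scalerAr -scalerAl.
Qed.

Lemma nc_unitrP f g : g * f = 1 /\ f * g = 1 -> nc_unit f.
Proof.
case=> /(congr1 (@^~ [::])); rewrite nc_constM nc_const1 => gf1 _.
by apply/eqP => f0; move/eqP: gf1; rewrite f0 mulr0 eq_sym oner_eq0.
Qed.

Lemma nc_invr_out : {in [predC nc_unit], nc_inv =1 id}.
Proof. by move=> f nuf; have /negPf nuf' : ~~ nc_unit f := nuf; rewrite /nc_inv nuf'. Qed.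

HB.instance Definition _ := GRing.NzRing_hasMulInverse.Build (ncseries K X)
  nc_mulVr nc_divrr nc_unitrP nc_invr_out.

Definition ncvar (x : X) : ncseries K X := fun w => (w == [:: x])%:R.

Lemma nc_prodE (u w : seq X) : (\prod_(x <- u) ncvar x) w = (w == u)%:R.
Proof.
elim: u w => [|x u IH] w; first by rewrite big_nil.
rewrite big_cons; case: w => [|y w]; first by rewrite nc_constM mul0r.
rewrite nc_mul_consE mul0r add0r.
have -> : nc_deriv y (ncvar x) = (y == x)%:R *: 1.
  apply/funext => v; rewrite /nc_deriv /ncvar nc_scaleE nc_oneE eqseq_cons.
  by case: eqP; rewrite ?mul1r ?mul0r.
rewrite -scalerAl mul1r nc_scaleE IH eqseq_cons.
by case: eqP; rewrite ?mul1r ?mul0r.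
Qed.

(* Sum of a family of which only finitely many members contribute to each
   coefficient (junk value 0 at the other coefficients). *)
Definition nc_sum (I : choiceType) (F : I -> ncseries K X) : ncseries K X :=
  fun w => \sum_(i \in [set: I]) F i w.

Definition gbinom (x : K) (r : nat) : K :=
  (\prod_(i < r) (x - i%:R)) / r`!%:R.

(* (1 / f)^beta for f = 1 - Sigma with constant term 1. *)
Definition inv_pow f (beta : K) : ncseries K X :=
  nc_sum (fun r : nat => gbinom (beta + r%:R - 1) r *: (1 - f) ^+ r).

Lemma inv_pow_finite f beta w : f [::] = 1 ->
  finite_set [set r : nat |
    (gbinom (beta + r%:R - 1) r *: (1 - f) ^+ r) w != 0].
Proof.
move=> f1; apply: (sub_finite_set _ (finite_II (size w).+1)) => r /=.
apply: contraNT; rewrite -leqNgt => ltwr.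
by rewrite nc_scaleE nc_exp_small ?mulr0 // nc_addE nc_oppE f1 subrr.
Qed.

End NCSeriesRing.

(** * The Cartier-Foata quotient *)

Section CartierFoata.
Variables (K : fieldType) (m : nat).
Local Notation series := (ncseries K ('I_m * 'I_m)%type).
Local Open Scope classical_set_scope.

Definition cf_relator (i j k l : 'I_m) : series :=
  ncvar K (i, k) * ncvar K (j, l) - ncvar K (j, l) * ncvar K (i, k).

Definition cf_relators : set series :=
  [set f | exists i j k l, i != j /\ f = cf_relator i j k l].

(* Closed for the usual topology of formal power series, in which the series
   vanishing on all words of length at most N form a basis of neighbourhoods
   of 0. *)
Record closed_ideal (I : set series) : Prop := ClosedIdeal {
  closed_ideal0 : I 0;
  closed_idealB : forall f g, I f -> I g -> I (f - g);
  closed_idealMl : forall h f, I f -> I (h * f);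
  closed_idealMr : forall h f, I f -> I (f * h);
  closed_ideal_closed : forall f,
    (forall N, exists2 g, I g & forall w, (size w <= N)%N -> g w = f w) -> I f }.

Definition cf_ideal : set series :=
  \bigcap_(I in [set I | closed_ideal I /\ cf_relators `<=` I]) I.

Definition cf_eq (f g : series) : Prop := cf_ideal (f - g).

Definition gen_mx : 'M[series]_m := \matrix_(i, j) ncvar K (i, j).

End CartierFoata.

(** * Determinants over a non-commutative ring *)

Definition inversions (N : nat) (s : 'S_N) : nat :=
  #|[set ij : 'I_N * 'I_N | (ij.1 < ij.2)%N && (s ij.2 < s ij.1)%N]|.

(* The factors are multiplied in the order of the columns; mathcomp's \det
   uses the order of the rows. *)
Definition cdet (S : nzRingType) (N : nat) (B : 'M[S]_N) : S :=
  \sum_(s : 'S_N) (-1) ^+ inversions s * \prod_(j < N) B (s j) j.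

(* The entry of index (i, j) stands for c_(n+i, n+j), with i, j < p = m - n. *)
Definition sylvester_mx (S : unitRingType) (n p : nat) (A : 'M[S]_(n + p)) :
    'M[S]_p :=
  \matrix_(i, j)
    - ((cdet (1%:M - ulsubmx A))^-1 *
       cdet (block_mx (1%:M - ulsubmx A)        (- col j (ursubmx A))
                      (- row i (dlsubmx A)) (- (drsubmx A i j)%:M : 'M_1))).

(** * O-sequences and their disjoint cycle decomposition *)

Section Words.
Variable m : nat.
Local Notation height := 'I_m.
Local Notation step := ('I_m * 'I_m)%type.
Implicit Types (alpha gamma : seq step) (mu : seq height).

Definition nondec_rearrangement mu : seq height :=
  sort (fun i j : height => (i <= j)%N) mu.

Definition oseq mu : seq step := zip (nondec_rearrangement mu) mu.

(* The walk from height c and the list of unused steps; every step appended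
   uses one of alpha, so that fuel = size alpha is enough. *)
Fixpoint walk (fuel : nat) (c : height) alpha : seq step * seq step :=
  if fuel is fuel'.+1 then
    let k := find (fun s : step => s.1 == c) alpha in
    if drop k alpha is s :: alpha2 then
      let: (W, rest) := walk fuel' s.2 (take k alpha ++ alpha2) in
      (s :: W, rest)
    else ([::], alpha)
  else ([::], alpha).

Definition phi alpha : seq step :=
  (foldl (fun '(W, rest) (h : height) =>
            let: (Wh, rest') := walk (size rest) h rest in (W ++ Wh, rest'))
         ([::], alpha) (enum 'I_m)).1.

(* Each recorded cycle is nonempty, so that fuel = size gamma is enough.  If
   the height sequence v had no repetition, which does not happen for
   gamma = phi (oseq mu), all of gamma would be recorded. *)
Fixpoint cycle_decomp_rec (fuel : nat) gamma : seq (seq step) :=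
  match fuel, gamma with
  | fuel'.+1, s0 :: _ =>
    let v := s0.1 :: unzip2 gamma in
    let t := find (fun t => nth s0.1 v t \in take t v) (iota 0 (size v)) in
    let s := index (nth s0.1 v t) v in
    take (t - s) (drop s gamma)
      :: cycle_decomp_rec fuel' (take s gamma ++ drop t gamma)
  | _, _ => [::]
  end.

Definition cycle_decomp mu : seq (seq step) :=
  let gamma := phi (oseq mu) in cycle_decomp_rec (size gamma) gamma.

Definition heights (u : seq step) : {set height} := [set h in unzip1 u].

Definition disjoint_cycles (u u' : seq step) : bool :=
  [disjoint heights u & heights u'].

Definition ndescents (x : seq nat) : nat :=
  count (fun s => nth 0 x s.+1 < nth 0 x s)%N (iota 0 (size x).-1).

Section Coefficient.
(* Heights 1, ..., m are numbered from 0, so "height > n" reads n <= h. *)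
Variables (n : nat) (us : seq (seq step)).
Local Notation k := (size us).
Local Notation u i := (nth [::] us i).

Definition big_cycles : {set 'I_k} :=
  [set i : 'I_k | [exists h in heights (u i), (n <= h)%N]].

Definition adm1 (pi : 'S_k) : bool :=
  [forall i : 'I_k, forall j : 'I_k, (i < j)%N && (pi j < pi i)%N ==>
    disjoint_cycles (u (pi i)) (u (pi j))].

Definition adm2 (pi : 'S_k) : bool :=
  [forall i : 'I_k, exists j : 'I_k, (i <= j)%N && (pi j \in big_cycles)].

Definition first_big_from (pi : 'S_k) (i j : 'I_k) : bool :=
  [&& (i <= j)%N, pi j \in big_cycles &
    [forall j' : 'I_k, (i <= j')%N && (pi j' \in big_cycles) ==> (j <= j')%N]].

Definition adm3 (pi : 'S_k) : bool :=
  [forall i : 'I_k, forall j : 'I_k, first_big_from pi i j && (i < j)%N ==>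
    [exists k' : 'I_k, (i < k' <= j)%N &&
       ~~ disjoint_cycles (u (pi i)) (u (pi k'))]].

Definition adm4 (pi : 'S_k) : bool :=
  [forall i : 'I_k, forall j : 'I_k, (j == i.+1 :> nat) && (pi j < pi i)%N ==>
    (pi i \in big_cycles)].

Definition admissible (pi : 'S_k) : bool :=
  [&& adm1 pi, adm2 pi, adm3 pi & adm4 pi].

Definition descents_big (pi : 'S_k) : nat :=
  ndescents [seq val x | x <- [seq pi i | i : 'I_k] & x \in big_cycles].

End Coefficient.

Definition e_coef (K : fieldType) (n : nat) (beta : K) mu : K :=
  let us := cycle_decomp mu in
  let l := #|big_cycles n us| in
  \sum_(pi : 'S_(size us) | admissible n pi)
    gbinom (beta + l%:R - 1 - (descents_big n pi)%:R) l.

Definition oseq_monomial (K : fieldType) mu : ncseries K step :=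
  \prod_(s <- oseq mu) ncvar K s.

Lemma e_series_finite (K : fieldType) (F : seq height -> K) (w : seq step) :
  finite_set [set mu : seq height | (F mu *: oseq_monomial K mu) w != 0].
Proof.
apply: (sub_finite_set _ (finite_set1 (unzip2 w))) => mu /=.
apply: contra_neqP => neq; rewrite nc_scaleE /oseq_monomial nc_prodE.
case: eqP => [w_eq|]; last by rewrite mulr0.
case: neq; rewrite w_eq unzip2_zip //.
by rewrite /nondec_rearrangement size_sort.
Qed.

End Words.

(* Main.v *)
(* In the quotient, the class of a word is determined by its subwords of steps
   starting at each height, so each side of the identity is determined by its
   sums of coefficients over the classes ([class_coef]).  The Schur complement
   formula for matrices whose entries in distinct rows commute gives
   det(I - C) = D0^-1 D with D = det(I - A) and D0 = det(I - A_0), so that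
   F_N = det(I - C)^-N satisfies D F_(N+1) = D0 F_N.
   Since D is the signed sum over sets of disjoint cycles and left
   multiplication by such a set is cancelled by removing minimal cycles, this
   relation determines recursively the coefficient of F_N at a product
   u_1 ... u_k of cycles.  A sign-reversing involution shows that the number of
   maps from the cycles to {1, ..., N} that weakly increase along
   non-disjointness, and take at each small cycle the same value as at some
   later cycle meeting it, obeys the same recursion.  As in the theory of
   P-partitions, sorting the cycles by level partitions these maps according to
   the admissible permutations pi, and a given pi arises from
   binom(N + l - 1 - d(pi), l) maps.  This is the theorem for positive integers
   beta = N; coefficients being polynomial in beta, Lagrange interpolation
   modulo the closed ideal gives all beta. *)

(* [D] and [D0] do not commute; the relation [D F_(N+1) = D0 F_N] lets both act from the left, where
   words can be cancelled class by class. The level maps come from heaps of cycles: the inverse of a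
   signed sum over sets of disjoint cycles is the sum over all heaps, and multiplying [D^-1] by [D0]
   on the right keeps the heaps whose maximal pieces are big, so [F_N] counts factorizations into
   [N] such heaps. Products of cycles suffice: every word of [D] and [D0] enters each height as
   often as it leaves it, and each class of such words contains a product of cycles, given by the
   decomposition of its o-sequence. Each small cycle is attached to the least big cycle that it
   reaches through later meeting cycles of its own level; sorted by level, then by this big cycle,
   then by label, the cycles form blocks that end at a big cycle, which is what conditions (2) to
   (4) describe. Interpolation works because on words of length at most [L] both sides are
   polynomials in beta of degree at most [L]. *)
From HB Require Import structures.
Require Import Defs.
From mathcomp Require Import boolp classical_sets fsbigop.
From mathcomp Require Import all_boot all_order all_algebra.
From mathcomp Require Import fingroup perm complex zify ring generic_quotient.
From mathcomp Require Import qpoly reals.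

Set Implicit Arguments.
Unset Strict Implicit.
Unset Printing Implicit Defensive.

Import Order.TTheory GRing.Theory Num.Theory.

Local Open Scope ring_scope.

(** * Column determinants *)

Section ColumnDeterminant.

(** Permuting the columns of a Vandermonde determinant with nodes 0, ..., N - 1 multiplies it by the
    sign of [s], while in the product formula each inversion makes one factor negative. *)
Lemma sign_inversions (N : nat) (s : 'S_N) :
  (-1) ^+ inversions s = (-1) ^+ s :> int.
Proof.
pose a (t : 'S_N) : 'rV[int]_N := \row_j (t j)%:Z.
have colV : col_perm s (Vandermonde N (a 1%g)) = Vandermonde N (a s).
  by apply/matrixP => i j; rewrite !mxE perm1.
have := congr1 (@determinant _ _) colV.
rewrite col_permE det_mulmx det_perm odd_permV !det_Vandermonde.
move=> /(congr1 Num.sg); rewrite sgrM sgrX sgrN1.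
have sgV t : Num.sg (\prod_(i < N) \prod_(j < N | (i < j)%N) (a t 0 j - a t 0 i)) =
    (-1) ^+ inversions t.
  transitivity (\prod_(i < N) \prod_(j < N | (i < j)%N)
      (if (t j < t i)%N then -1 else 1 : int)).
    rewrite (big_morph _ (@sgrM _) (@sgr1 _)); apply: eq_bigr => i _.
    rewrite (big_morph _ (@sgrM _) (@sgr1 _)); apply: eq_bigr => j ltij.
    rewrite !mxE; case: ltnP => [lt_t|le_t].
      by apply: ltr0_sg; rewrite subr_lt0 ltz_nat.
    apply: gtr0_sg; rewrite subr_gt0 ltz_nat ltn_neqAle le_t andbT.
    by rewrite val_eqE (inj_eq perm_inj) -val_eqE neq_ltn ltij.
  rewrite pair_big_dep /= -big_mkcondr /= prodr_const /inversions.
  by congr (_ ^+ _); apply: eq_card => -[i j]; rewrite !inE.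
rewrite !sgV.
have -> : inversions (1%g : 'S_N) = 0%N.
  apply/eqP; rewrite cards_eq0; apply/eqP/setP => -[i j]; rewrite !inE !perm1 /=.
  by case: ltnP => //= ltij; apply: negbTE; rewrite -leqNgt ltnW.
by rewrite expr0 mul1r => <-.
Qed.

Lemma sign_inversionsR (S : nzRingType) (N : nat) (s : 'S_N) :
  (-1) ^+ inversions s = (-1) ^+ s :> S.
Proof.
have /(congr1 (intr : int -> S)) := sign_inversions s.
by rewrite !rmorphXn /= !rmorphN !rmorph1.
Qed.

(** The sign, extended by 0 to maps that are not injective: sums over all maps can be glued
    blockwise and reindexed by transpositions. *)
Definition levi (N : nat) (s : 'I_N -> 'I_N) : int :=
  \det (\matrix_(i, j) ((s i == j)%:R : int)).

Lemma levi_perm (N : nat) (s : 'S_N) : levi s = (-1) ^+ s.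
Proof.
by rewrite -det_perm; congr (\det _); apply/matrixP => i j; rewrite !mxE.
Qed.

Lemma levi_repeat (N : nat) (s : 'I_N -> 'I_N) (i j : 'I_N) :
  i != j -> s i = s j -> levi s = 0.
Proof.
move=> neq_ij eqs; apply: (determinant_alternate neq_ij) => k.
by rewrite !mxE eqs.
Qed.

Lemma levi_swap (N : nat) (s : 'I_N -> 'I_N) (i j : 'I_N) :
  i != j -> levi (s \o tperm i j) = - levi s.
Proof.
move=> neq_ij; rewrite /levi.
set M1 := \matrix_(_, _) _; set M2 := \matrix_(_, _) _.
have -> : M1 = xrow i j M2 by apply/matrixP => a b; rewrite !mxE.
by rewrite xrowE det_mulmx det_perm odd_tperm neq_ij expr1 mulN1r.
Qed.

Lemma eq_levi (N : nat) (s t : 'I_N -> 'I_N) : s =1 t -> levi s = levi t.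
Proof.
by move=> eqst; congr (\det _); apply/matrixP => i j; rewrite !mxE eqst.
Qed.

Lemma cdet_levi (S : nzRingType) (N : nat) (B : 'M[S]_N) :
  cdet B = \sum_(s : {ffun 'I_N -> 'I_N}) (\prod_j B (s j) j) *~ levi s.
Proof.
rewrite (bigID (fun s : {ffun _} => injectiveb s)) /= [X in _ + X]big1 ?addr0.
  rewrite (reindex (@pval _)) /=; last first.
    pose in_Sn := insubd (1%g : 'S_N).
    by exists in_Sn => /= s Us; first apply: val_inj; apply: insubdK.
  apply: eq_big => /= [s|s _]; first by rewrite (valP s).
  rewrite sign_inversionsR -[levi _]/(levi (pval s)).
  have -> : levi (pval s) = (-1) ^+ s.
    by rewrite -levi_perm; apply: eq_levi => i; rewrite pvalE.
  rewrite -mulrzl; congr (_ * _); first by rewrite !rmorphXn /= !rmorphN !rmorph1.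
  by apply: eq_bigr => j _; rewrite pvalE.
move=> s /injectivePn [i [j neq_ij eqs]].
by rewrite (levi_repeat neq_ij eqs) mulr0z.
Qed.

Lemma prod_ord_split (S : nzRingType) (N : nat) (q : 'I_N) (f : 'I_N -> S) :
  \prod_j f j =
    (\prod_(j < N | (j < q)%N) f j) * f q * \prod_(j < N | (q < j)%N) f j.
Proof.
elim: N q f => [[]//|N IH] q f.
rewrite big_ord_recl; case: (unliftP ord0 q) => [q' ->|->].
  rewrite (IH q' (fun j => f (lift ord0 j))) [in RHS]big_mkcond big_ord_recl /=.
  rewrite -[in RHS]big_mkcond /= !mulrA; congr (_ * _ * _ * _).
  by rewrite [RHS]big_mkcond big_ord_recl /= mul1r [LHS]big_mkcond.
rewrite [X in _ = X * _ * _]big1 ?mul1r //; congr (_ * _).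
by rewrite [RHS]big_mkcond big_ord_recl /= mul1r.
Qed.

Lemma prod_comm_bigD1 (S : nzRingType) (I : finType) (k : I) (P : pred I) (g : I -> S) :
  P k -> (forall j, P j -> GRing.comm (g k) (g j)) ->
  \prod_(j | P j) g j = g k * \prod_(j | P j && (j != k)) g j.
Proof.
move=> Pk gk; rewrite -big_filter -[in RHS]big_filter.
set r := index_enum I; have : uniq r := index_enum_uniq I.
have : k \in r by rewrite mem_index_enum.
elim: r => [//|x r IH] /=; rewrite inE => /predU1P[kx|kr] /andP[xr ur].
  subst x; rewrite eqxx Pk andbF big_cons; congr (_ * _); congr (bigop _ _ _).
  apply: eq_in_filter => y yr.
  by case: eqP => [yx|]; rewrite ?andbT //; rewrite -yx yr in xr.
have -> : x != k by apply: contraNneq xr => ->.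
rewrite andbT; case: ifP => Px; last exact: IH.
by rewrite !big_cons IH // !mulrA (gk _ Px).
Qed.

Lemma lblock_levi (n p : nat) (s1 : 'I_n -> 'I_n) (s2 : 'I_p -> 'I_p) :
  levi (fun j => match split j with
                 | inl i => lshift p (s1 i) | inr i => rshift n (s2 i) end)
  = levi s1 * levi s2.
Proof.
rewrite /levi -(@det_lblock _ _ _ _ 0); congr (\det _); apply/matrixP => i j.
rewrite !mxE; case: splitP => i' ei; rewrite !mxE; case: splitP => j' ej; rewrite !mxE.
- by rewrite -!val_eqE /= ej.
- by rewrite -val_eqE /= ej; case: eqP => // e; have := ltn_ord (s1 i'); rewrite e; lia.
- by rewrite -val_eqE /= ej; case: eqP => // e; have := ltn_ord j'; rewrite -e; lia.
by rewrite -!val_eqE /= ej eqn_add2l.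
Qed.

(** The column order of [cdet] puts the factors from [A] before those from [D], so the two
    determinants appear in this order over any ring. *)
Lemma cdet_lblock (S : nzRingType) (n p : nat) (A : 'M[S]_n) (C : 'M[S]_(p, n))
    (D : 'M[S]_p) :
  cdet (block_mx A 0 C D) = cdet A * cdet D.
Proof.
rewrite !cdet_levi big_distrlr /= pair_big /=.
pose Pl (s : {ffun 'I_(n + p) -> 'I_(n + p)}) := [forall j, (s (lshift p j) < n)%N].
pose Pr (s : {ffun 'I_(n + p) -> 'I_(n + p)}) := [forall j, (n <= s (rshift n j))%N].
rewrite (bigID (fun s => Pl s && Pr s)) /= [X in _ + X]big1 ?addr0; last first.
  move=> s /nandP[]; last first.
    move=> /forallPn[j]; rewrite -ltnNge => ltsj.
    rewrite (prod_ord_split (rshift n j)) block_mxEh.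
    have -> : row_mx (col_mx A C) (col_mx 0 D) (s (rshift n j)) (rshift n j) = 0.
      by rewrite row_mxEr (_ : s _ = lshift p (Ordinal ltsj)) ?col_mxEu ?mxE //; apply: val_inj.
    by rewrite mulr0 mul0r mul0rz.
  move=> nPl; case PrE: (Pr s); last first.
    move/negbT/forallPn: PrE => [j]; rewrite -ltnNge => ltsj.
    rewrite (prod_ord_split (rshift n j)) block_mxEh.
    have -> : row_mx (col_mx A C) (col_mx 0 D) (s (rshift n j)) (rshift n j) = 0.
      by rewrite row_mxEr (_ : s _ = lshift p (Ordinal ltsj)) ?col_mxEu ?mxE //; apply: val_inj.
    by rewrite mulr0 mul0r mul0rz.
  have [s_inj|] := boolP (injectiveb s); last first.
    by move=> /injectivePn [i [j neq_ij eqs]]; rewrite (levi_repeat neq_ij eqs) mulr0z.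
  move/forallPn: nPl => [j]; rewrite -leqNgt => lesj.
  have /forallP PrE' := PrE.
  (* Pigeonhole: the last [p] columns and column [j] would be sent injectively to the last [p]
     rows. *)
  have : (#|[set s x | x in [set j0 : 'I_(n + p) | (n <= j0)%N || (j0 == lshift p j)]]|
     <= #|[set x : 'I_(n + p) | (n <= x)%N]|)%N.
    apply: subset_leq_card; apply/subsetP => y /imsetP[x]; rewrite !inE.
    move=> /orP[len|/eqP->] -> //.
    have ltx : (x - n < p)%N by rewrite ltn_subLR.
    by have := PrE' (Ordinal ltx); congr (_ <= s _)%N; apply: val_inj; rewrite /= subnKC.
  rewrite card_imset; last exact/injectiveP.
  rewrite leqNgt => /negP[]; apply: proper_card; apply/properP; split.
    by apply/subsetP => x; rewrite !inE => ->.
  by exists (lshift p j); rewrite !inE ?eqxx ?orbT //= -ltnNge.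
pose h (s : {ffun 'I_n -> 'I_n} * {ffun 'I_p -> 'I_p}) : {ffun 'I_(n + p) -> 'I_(n + p)} :=
  [ffun j => match split j with
             | inl i => lshift p (s.1 i) | inr i => rshift n (s.2 i) end].
pose g (s : {ffun 'I_(n + p) -> 'I_(n + p)}) :=
  ([ffun j => if split (s (lshift p j)) is inl i then i else j],
   [ffun j => if split (s (rshift n j)) is inr i then i else j]).
rewrite (reindex_onto h g) /=; last first.
  move=> s /andP[/forallP Pls /forallP Prs]; apply/ffunP => j.
  rewrite ffunE; case: (split_ordP j) => i ->; rewrite ffunE.
    by case: split_ordP => // i' e; have := Pls i; rewrite e /= ltnNge leq_addr.
  by case: split_ordP => // i' e; have := Prs i; rewrite e /= leqNgt ltn_ord.
apply: eq_big => [[s1 s2]|[s1 s2] _].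
  apply/andP; split; last first.
    rewrite /g /h; apply/eqP; congr (_, _); apply/ffunP => j; rewrite !ffunE.
      by rewrite (unsplitK (inl j)) (unsplitK (inl (s1 j))).
    by rewrite (unsplitK (inr j)) (unsplitK (inr (s2 j))).
  apply/andP; split; apply/forallP => j; rewrite ffunE.
    by rewrite (unsplitK (inl j)) /=.
  by rewrite (unsplitK (inr j)) /= leq_addr.
rewrite big_split_ord /=.
have -> : levi (h (s1, s2)) = levi s1 * levi s2.
  by rewrite -lblock_levi; apply: eq_levi => j; rewrite ffunE.
rewrite mulrzAr mulrzAl -mulrzA mulrC; congr (_ * _ *~ _); apply: eq_bigr => j _.
  by rewrite ffunE (unsplitK (inl j)) block_mxEul.
by rewrite ffunE (unsplitK (inr j)) block_mxEdr.
Qed.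

End ColumnDeterminant.

(** * Column operations and the Schur complement *)

Section Schur.
Variable S : nzRingType.

Definition rows_commute (m n : nat) (M : 'M[S]_(m, n)) :=
  forall i k j l, i != k -> GRing.comm (M i j) (M k l).

(** A determinant whose column [q] repeats the earlier column [k]: exchanging the values of [s] at
    [k] and [q] cancels the terms in pairs. Both entries stand to the left of [X], so commutation is
    applied only among the factors before [X], and [X] may be any function of the later columns. *)
Lemma sum_repeated_column (N : nat) (M : 'M[S]_N) (k q : 'I_N)
    (X : ('I_N -> 'I_N) -> S) :
  rows_commute M -> (k < q)%N ->
  (forall s t : 'I_N -> 'I_N, (forall j : 'I_N, (q < j)%N -> s j = t j) -> X s = X t) ->
  \sum_(s : {ffun 'I_N -> 'I_N})
     ((\prod_(j < N | (j < q)%N) M (s j) j) * (M (s q) k * X s)) *~ levi s = 0.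
Proof.
move=> cM ltkq congX.
have neq_kq : k != q by rewrite -val_eqE ltn_eqF.
pose swap (s : {ffun 'I_N -> 'I_N}) : {ffun 'I_N -> 'I_N} := [ffun j => s (tperm k q j)].
have swapK : involutive swap by move=> s; apply/ffunP => j; rewrite !ffunE tpermK.
pose F (s : {ffun 'I_N -> 'I_N}) :=
  ((\prod_(j < N | (j < q)%N) M (s j) j) * (M (s q) k * X s)) *~ levi s.
rewrite -[LHS]/(\sum_s F s).
have F_eq0 (s : {ffun 'I_N -> 'I_N}) : s k = s q -> F s = 0.
  by move=> eqs; rewrite /F (levi_repeat neq_kq eqs) mulr0z.
have F_swap s : F (swap s) = - F s.
  have [/injectiveP s_inj|] := boolP (injectiveb s); last first.
    move=> /injectivePn [i [j neq_ij eqs]].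
    rewrite /F (levi_repeat neq_ij eqs) mulr0z oppr0.
    rewrite (@levi_repeat _ (swap s) (tperm k q i) (tperm k q j)) ?mulr0z //.
      by rewrite (inj_eq perm_inj).
    by rewrite !ffunE !tpermK.
  rewrite /F (congX (swap s) s); last first.
    move=> j ltqj; rewrite ffunE tpermD //; apply/eqP => e; move: ltqj ltkq.
      by rewrite -e; lia.
    by rewrite -e ltnn.
  have -> : levi (swap s) = - levi s.
    by rewrite -(levi_swap s neq_kq); apply: eq_levi => j; rewrite ffunE.
  rewrite mulrNz !mulrA ffunE tpermR; congr (- (_ * _ *~ _)).
  have commM i j l l' : i != j -> GRing.comm (M (s i) l) (M (s j) l').
    by move=> neq_ij; apply: cM; rewrite (inj_eq s_inj).
  (* Common form of both products: the row [s q] entry in front, the row [s k] entry behind. *)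
  rewrite [LHS](_ : _ = M (s q) k * (\prod_(j < N | (j < q)%N && (j != k)) M (s j) j) * M (s k) k).
    rewrite [X in _ = X * _](_ : _ = M (s k) k * (\prod_(j < N | (j < q)%N && (j != k)) M (s j) j)).
      have cq : GRing.comm (M (s q) k) (\prod_(j < N | (j < q)%N && (j != k)) M (s j) j).
        by apply: commr_prod => j /andP[ltjq _]; apply: commM; rewrite -val_eqE /= gtn_eqF.
      have ck : GRing.comm (M (s k) k) (\prod_(j < N | (j < q)%N && (j != k)) M (s j) j).
        by apply: commr_prod => j /andP[_ neq_jk]; apply: commM; rewrite eq_sym.
      rewrite -mulrA -ck mulrA -[RHS]mulrA -cq mulrA; congr (_ * _).
      by apply: commM; rewrite eq_sym.
    rewrite (prod_comm_bigD1 ltkq) // => j ltjq.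
    by have [->//|neq_jk] := eqVneq j k; apply: commM; rewrite eq_sym.
  congr (_ * _); rewrite (prod_comm_bigD1 (P := fun j : 'I_N => (j < q)%N) (k := k)) //.
    rewrite ffunE tpermL; congr (_ * _); apply: eq_bigr => j /andP[ltjq neq_jk].
    by rewrite ffunE tpermD // eq_sym // -val_eqE ltn_eqF.
  move=> j ltjq; rewrite !ffunE tpermL.
  have [->|neq_jk] := eqVneq j k; first by rewrite tpermL.
  have neq_qj : q != j by rewrite -val_eqE gtn_eqF.
  by rewrite tpermD // 1?eq_sym //; apply: commM.
(* The swap exchanges the cases [s k < s q] and [s q < s k]; ties contribute 0. *)
rewrite (bigID (fun s : {ffun 'I_N -> 'I_N} => (s k < s q)%N)) /=.
rewrite [X in _ + X](reindex_inj (inv_inj swapK)) /= [X in _ + X](bigID (fun s : {ffun 'I_N -> 'I_N} => s k == s q)) /=.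
rewrite [X in _ + (X + _)]big1 ?add0r => [|s /andP[_ /eqP e]]; last by rewrite F_swap F_eq0 ?oppr0.
rewrite (eq_bigr _ (fun s _ => F_swap s)) sumrN; apply/eqP; rewrite subr_eq0; apply/eqP.
apply: eq_bigl => s; rewrite !ffunE tpermL tpermR -leqNgt ltn_neqAle val_eqE.
by rewrite andbC.
Qed.

Lemma cdet_column_ops (n p : nat) (M : 'M[S]_(n + p)) (Y : 'M[S]_(n, p)) :
  rows_commute M ->
  cdet (row_mx (lsubmx M) (rsubmx M + lsubmx M *m Y)) = cdet M.
Proof.
move=> cM; set E := row_mx _ _.
(* [T 0] is [E] and [T (n + p)] is [M]. Restoring columns from left to right keeps the columns
   before [q] equal to those of [M], whose rows commute, and leaves the altered ones in the
   arbitrary factor [X] of [sum_repeated_column]. *)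
pose T q : 'M[S]_(n + p) := \matrix_(i, j) if (j < q)%N then M i j else E i j.
have ET q i j : T q i j = if (j < q)%N then M i j else E i j by rewrite mxE.
have EL i j : E i (lshift p j) = M i (lshift p j) by rewrite row_mxEl mxE.
have ER i j : E i (rshift n j) =
    M i (rshift n j) + \sum_k M i (lshift p k) * Y k j.
  by rewrite row_mxEr !mxE; congr (_ + _); apply: eq_bigr => k _; rewrite mxE.
have step q : (q < n + p)%N -> cdet (T q) = cdet (T q.+1).
  move=> ltq; pose qo := Ordinal ltq; rewrite !cdet_levi.
  apply/eqP; rewrite -subr_eq0 -sumrB; apply/eqP.
  case: (split_ordP qo) => q' eq'.
    apply: big1 => s _; rewrite -mulrzBl (_ : _ - _ = 0) ?mul0rz //.
    apply/eqP; rewrite subr_eq0; apply/eqP; apply: eq_bigr => j _.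
    rewrite !ET [(j < q.+1)%N]ltnS [(j <= q)%N]leq_eqVlt orbC.
    case: (ltnP j q) => //= _; case: (val j =P q) => // ej.
    have -> : j = qo by apply: val_inj.
    by rewrite eq' EL.
  pose X (k : 'I_n) (s : 'I_(n + p) -> 'I_(n + p)) :=
    Y k q' * \prod_(j < n + p | (qo < j)%N) E (s j) j.
  transitivity (\sum_(s : {ffun 'I_(n + p) -> 'I_(n + p)}) \sum_(k < n)
     ((\prod_(j < n + p | (j < qo)%N) M (s j) j) * (M (s qo) (lshift p k) * X k s)) *~ levi s).
    apply: eq_bigr => s _; rewrite -mulrzBl -mulrz_suml; congr (_ *~ _).
    rewrite !(prod_ord_split qo) /=.
    have tail r : (r <= qo.+1)%N -> \prod_(j < n + p | (qo < j)%N) T r (s j) j =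
        \prod_(j < n + p | (qo < j)%N) E (s j) j.
      move=> ler; apply: eq_bigr => j ltj; rewrite ET ifF //.
      by apply/negbTE; rewrite -leqNgt (leq_trans ler).
    have init r : (qo <= r)%N -> \prod_(j < n + p | (j < qo)%N) T r (s j) j =
        \prod_(j < n + p | (j < qo)%N) M (s j) j.
      by move=> ler; apply: eq_bigr => j ltj; rewrite ET (leq_trans ltj).
    rewrite !tail // !init // -mulrBl -mulrBr -[T q _ _ - _](_ : \sum_k M (s qo) (lshift p k) * Y k q' = _).
      rewrite -mulrA mulr_suml mulr_sumr; apply: eq_bigr => k _.
      by rewrite /X !mulrA.
    by rewrite !ET ltnn ltnSn eq' ER addrAC subrr add0r.
  rewrite exchange_big big1 // => k _; apply: sum_repeated_column => //.
    have := congr1 val eq'; rewrite /= => ->.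
    by rewrite (leq_trans (ltn_ord k)) // leq_addr.
  by move=> s t eqst; rewrite /X; congr (_ * _); apply: eq_bigr => j ltj; rewrite eqst.
have TE q : (q <= n + p)%N -> cdet (T 0%N) = cdet (T q).
  by elim: q => [//|q IH] ltq; rewrite (IH (ltnW ltq)) (step _ ltq).
rewrite [E](_ : _ = T 0%N); last by apply/matrixP => i j; rewrite [RHS]mxE.
by rewrite (TE _ (leqnn _)); congr cdet; apply/matrixP => i j; rewrite mxE ltn_ord.
Qed.

(* Schur complement: adding to the last p columns right multiples of the first
   n ones does not change the column determinant of a matrix whose entries in
   distinct rows commute, whatever the multipliers. *)
Theorem cdet_Schur (n p : nat) (M : 'M[S]_(n + p)) (Z : 'M[S]_n) :
  rows_commute M -> ulsubmx M *m Z = 1%:M ->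
  cdet M = cdet (ulsubmx M) *
           cdet (drsubmx M - dlsubmx M *m (Z *m ursubmx M)).
Proof.
move=> cM MZ; set Y := Z *m _; rewrite -(cdet_column_ops (- Y) cM) -(cdet_lblock _ (dlsubmx M)).
congr cdet; rewrite -[in LHS](submxK M) block_mxEh row_mxKl row_mxKr.
rewrite mul_col_mx add_col_mx -block_mxEh !mulmxN.
by rewrite [ulsubmx M *m Y]mulmxA MZ mul1mx subrr.
Qed.

End Schur.

(** * The Cartier-Foata quotient *)

Local Open Scope quotient_scope.

Section CartierFoataQuotient.
Variables (K : fieldType) (m : nat).
Local Notation step := ('I_m * 'I_m)%type.
Local Notation series := (ncseries K step).

Lemma closed_ideal_cf : closed_ideal (@cf_ideal K m).
Proof.
split=> [I [cI _]|f g If Ig I cI|h f If I cI|h f If I cI|f If I cI].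
- exact: closed_ideal0.
- by apply: (closed_idealB cI.1); [apply: If|apply: Ig].
- by apply: (closed_idealMl cI.1); apply: If.
- by apply: (closed_idealMr cI.1); apply: If.
apply: (closed_ideal_closed cI.1) => N.
by have [g Ig eqg] := If N; exists g => //; apply: Ig.
Qed.

Let idealD (f g : series) : cf_ideal f -> cf_ideal g -> cf_ideal (f + g).
Proof.
move=> If Ig; rewrite -[g]opprK -[- g]add0r.
apply: (closed_idealB closed_ideal_cf) => //.
by apply: (closed_idealB closed_ideal_cf) => //; apply: closed_ideal0 closed_ideal_cf.
Qed.

Let idealN (f : series) : cf_ideal f -> cf_ideal (- f).
Proof.
move=> If; rewrite -[- f]add0r; apply: (closed_idealB closed_ideal_cf) => //.
exact: closed_ideal0 closed_ideal_cf.
Qed.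

Definition cf_eqb (f g : series) : bool := `[< cf_eq f g >].

Lemma cf_eqb_equiv : equiv_class_of cf_eqb.
Proof.
split=> [f|f g|g f h].
- by apply/asboolP; rewrite /cf_eq subrr; apply: closed_ideal0 closed_ideal_cf.
- by apply/asboolP/asboolP => /idealN; rewrite /cf_eq opprB.
move=> /asboolP fg /asboolP gh; apply/asboolP.
by have := idealD fg gh; rewrite addrA subrK.
Qed.

Canonical cf_eqb_rel := EquivRelPack cf_eqb_equiv.

Definition cf_quot := {eq_quot cf_eqb}.

HB.instance Definition _ := Choice.on cf_quot.
HB.instance Definition _ := EqQuotient.on cf_quot.

Lemma cf_quotP (f g : series) : reflect (cf_eq f g) (f == g %[mod cf_quot]).
Proof. by rewrite eqmodE; apply: asboolP. Qed.

Lemma cf_quotE (f g : series) : cf_eq f g <-> \pi_cf_quot f = \pi_cf_quot g.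
Proof. by split=> [/cf_quotP/eqP|/eqP/cf_quotP]. Qed.

Definition cf_zero : cf_quot := lift_cst cf_quot 0.
Definition cf_one : cf_quot := lift_cst cf_quot 1.
Definition cf_opp := lift_op1 cf_quot (fun f => - f).
Definition cf_add := lift_op2 cf_quot +%R.
Definition cf_mul := lift_op2 cf_quot *%R.

Canonical pi_cf_zero_morph := PiConst cf_zero.
Canonical pi_cf_one_morph := PiConst cf_one.

Lemma pi_cf_opp : {morph \pi_cf_quot : f / - f >-> cf_opp f}.
Proof.
move=> f; unlock cf_opp; apply/eqP/cf_quotP.
have : cf_eq f (repr (\pi_cf_quot f)) by apply/cf_quotE; rewrite reprK.
by move/idealN; rewrite /cf_eq opprD.
Qed.
Canonical pi_cf_opp_morph := PiMorph1 pi_cf_opp.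

Lemma pi_cf_add : {morph \pi_cf_quot : f g / f + g >-> cf_add f g}.
Proof.
move=> f g; unlock cf_add; apply/eqP/cf_quotP.
have rf : cf_eq f (repr (\pi_cf_quot f)) by apply/cf_quotE; rewrite reprK.
have rg : cf_eq g (repr (\pi_cf_quot g)) by apply/cf_quotE; rewrite reprK.
by have := idealD rf rg; rewrite /cf_eq opprD addrACA.
Qed.
Canonical pi_cf_add_morph := PiMorph2 pi_cf_add.

Lemma pi_cf_mul : {morph \pi_cf_quot : f g / f * g >-> cf_mul f g}.
Proof.
move=> f g; unlock cf_mul; apply/eqP/cf_quotP.
have rf : cf_eq f (repr (\pi_cf_quot f)) by apply/cf_quotE; rewrite reprK.
have rg : cf_eq g (repr (\pi_cf_quot g)) by apply/cf_quotE; rewrite reprK.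
have := idealD (closed_idealMr closed_ideal_cf g rf)
               (closed_idealMl closed_ideal_cf (repr (\pi_cf_quot f)) rg).
by rewrite /cf_eq mulrBl mulrBr addrA subrK.
Qed.
Canonical pi_cf_mul_morph := PiMorph2 pi_cf_mul.

Lemma cf_addA : associative cf_add.
Proof. by move=> x y z; rewrite -[x]reprK -[y]reprK -[z]reprK !piE addrA. Qed.
Lemma cf_addC : commutative cf_add.
Proof. by move=> x y; rewrite -[x]reprK -[y]reprK !piE addrC. Qed.
Lemma cf_add0 : left_id cf_zero cf_add.
Proof. by move=> x; rewrite -[x]reprK !piE add0r. Qed.
Lemma cf_addN : left_inverse cf_zero cf_opp cf_add.
Proof. by move=> x; rewrite -[x]reprK !piE addNr. Qed.

HB.instance Definition _ :=
  GRing.isZmodule.Build cf_quot cf_addA cf_addC cf_add0 cf_addN.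

Lemma cf_mulA : associative cf_mul.
Proof. by move=> x y z; rewrite -[x]reprK -[y]reprK -[z]reprK !piE mulrA. Qed.
Lemma cf_mul1l : left_id cf_one cf_mul.
Proof. by move=> x; rewrite -[x]reprK !piE mul1r. Qed.
Lemma cf_mul1r : right_id cf_one cf_mul.
Proof. by move=> x; rewrite -[x]reprK !piE mulr1. Qed.
Lemma cf_mulDl : left_distributive cf_mul +%R.
Proof.
move=> x y z; rewrite -[x]reprK -[y]reprK -[z]reprK.
by rewrite -[LHS]/(cf_mul (cf_add _ _) _) -[RHS]/(cf_add _ _) !piE mulrDl.
Qed.
Lemma cf_mulDr : right_distributive cf_mul +%R.
Proof.
move=> x y z; rewrite -[x]reprK -[y]reprK -[z]reprK.
by rewrite -[LHS]/(cf_mul _ (cf_add _ _)) -[RHS]/(cf_add _ _) !piE mulrDr.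
Qed.

Lemma closed_ideal_const0 : closed_ideal [set f : series | f [::] = 0].
Proof.
split=> //= [f g f0 g0|h f f0|h f f0|f If].
- by rewrite nc_addE nc_oppE f0 g0 subrr.
- by rewrite nc_constM f0 mulr0.
- by rewrite nc_constM f0 mul0r.
by have [g g0 eqg] := If 0%N; rewrite -eqg.
Qed.

(** The series with constant term 0 form a closed ideal that contains every relator and omits 1. *)
Lemma cf_one_neq0 : cf_one != 0.
Proof.
apply/eqP; rewrite -[0]/cf_zero !piE => /cf_quotE /(_ [set f | f [::] = 0]%classic).
rewrite subr0 /= nc_const1 => one0; have /eqP := oner_neq0 K; apply.
apply: one0; split; first exact: closed_ideal_const0.
move=> f [i [j [k [l [_ ->]]]]] /=.
by rewrite /cf_relator nc_addE nc_oppE !nc_constM !mul0r subr0.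
Qed.

HB.instance Definition _ := GRing.Zmodule_isNzRing.Build cf_quot
  cf_mulA cf_mul1l cf_mul1r cf_mulDl cf_mulDr cf_one_neq0.

Definition cf_pi (f : series) : cf_quot := \pi_cf_quot f.

Lemma cf_pi_is_zmod_morphism : zmod_morphism cf_pi.
Proof. by move=> f g; rewrite /cf_pi -[RHS]/(cf_add _ (cf_opp _)) !piE. Qed.
HB.instance Definition _ :=
  GRing.isZmodMorphism.Build series cf_quot cf_pi cf_pi_is_zmod_morphism.
Lemma cf_pi_is_monoid_morphism : monoid_morphism cf_pi.
Proof.
split=> [|f g]; rewrite /cf_pi; last by rewrite -[RHS]/(cf_mul _ _) !piE.
by rewrite -[RHS]/cf_one !piE.
Qed.
HB.instance Definition _ :=
  GRing.isMonoidMorphism.Build series cf_quot cf_pi cf_pi_is_monoid_morphism.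

Lemma cf_piE (f g : series) : cf_eq f g <-> cf_pi f = cf_pi g.
Proof. exact: cf_quotE. Qed.

Lemma cf_pi_comm (x y : step) :
  x.1 != y.1 -> GRing.comm (cf_pi (ncvar K x)) (cf_pi (ncvar K y)).
Proof.
case: x y => [i k] [j l] /= neq_ij; rewrite /GRing.comm -!rmorphM; apply/cf_piE.
move=> I [_ relI]; apply: relI.
by exists i, j, k, l.
Qed.

End CartierFoataQuotient.

(** * Words up to row equivalence *)

Section RowEquivalence.
Variable m : nat.
Local Notation step := ('I_m * 'I_m)%type.
Implicit Types (v w t : seq step) (x y : step).

Definition steps_from (i : 'I_m) w := [seq x <- w | x.1 == i].

(** Equality in the partially commutative monoid where exactly the steps from distinct heights
    commute, tested on the projections to the rows. *)
Definition same_rows v w := [forall i, steps_from i v == steps_from i w].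

Lemma same_rowsP v w :
  reflect (forall i, steps_from i v = steps_from i w) (same_rows v w).
Proof. exact: 'forall_eqP. Qed.

Lemma same_rows_refl w : same_rows w w. Proof. exact/same_rowsP. Qed.

Lemma same_rows_sym v w : same_rows v w = same_rows w v.
Proof. by apply/same_rowsP/same_rowsP => e i; rewrite e. Qed.

Lemma same_rows_trans w v t : same_rows v w -> same_rows w t -> same_rows v t.
Proof. by move=> /same_rowsP vw /same_rowsP wt; apply/same_rowsP => i; rewrite vw. Qed.

Lemma same_rows_perm v w : same_rows v w -> perm_eq v w.
Proof.
move=> /same_rowsP e; apply/seq.permP => a.
have cnt (s : seq step) : count a s = (\sum_i count a (steps_from i s))%N.
  rewrite -sum1_count (partition_big fst xpredT) //=; apply: eq_bigr => i _.
  by rewrite count_filter -sum1_count.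
by rewrite !cnt; apply: eq_bigr => i _; rewrite e.
Qed.

Lemma steps_from_cat i v w :
  steps_from i (v ++ w) = steps_from i v ++ steps_from i w.
Proof. exact: filter_cat. Qed.

Lemma same_rows_catl t v w : same_rows (t ++ v) (t ++ w) = same_rows v w.
Proof.
apply: eq_forallb => i; rewrite !steps_from_cat.
by rewrite eqseq_cat // eqxx.
Qed.

Lemma same_rows_catr t v w : same_rows v w -> same_rows (v ++ t) (w ++ t).
Proof. by move=> /same_rowsP e; apply/same_rowsP => i; rewrite !steps_from_cat e. Qed.

Lemma steps_from_nil i w : i \notin unzip1 w -> steps_from i w = [::].
Proof.
move=> iw; apply/eqP; rewrite -[_ == _]negbK -has_filter; apply: contra iw.
by case/hasP => x xw /eqP <-; apply: map_f.
Qed.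

Lemma same_rows_catC v w :
  {in unzip1 v, forall i, i \notin unzip1 w} -> same_rows (v ++ w) (w ++ v).
Proof.
move=> dvw; apply/same_rowsP => i; rewrite !steps_from_cat.
have [iv|iv] := boolP (i \in unzip1 v).
  by rewrite (steps_from_nil (dvw i iv)) cats0.
by rewrite (steps_from_nil iv) cats0.
Qed.


(** The head of [x :: v] is also the first step from its height in [w], so it commutes past
    everything that precedes it there. *)
Lemma same_rows_head x v w : same_rows (x :: v) w ->
  exists a b, [/\ w = a ++ x :: b, x.1 \notin unzip1 a & same_rows v (a ++ b)].
Proof.
move=> xvw; have /same_rowsP /(_ x.1) := xvw; rewrite /= eqxx => ex.
have has_x : has (fun y => y.1 == x.1) w by rewrite has_filter -[filter _ _]ex.
case: (split_find has_x) xvw ex => y a b /eqP y1 nay xvw.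
have xa : x.1 \notin unzip1 a.
  by apply: contra nay => /mapP[z za ez]; apply/hasP; exists z; rewrite // ez.
rewrite cat_rcons steps_from_cat (steps_from_nil xa) /= y1 eqxx => -[exy _].
exists a, b; rewrite -exy in xvw *; rewrite cat_rcons in xvw *; split=> //.
rewrite -(same_rows_catl [:: x]); apply: same_rows_trans xvw _.
have : same_rows (a ++ [:: x]) ([:: x] ++ a).
  by apply: same_rows_catC => i ia; rewrite inE; apply: contraNneq xa => <-.
by move=> /(same_rows_catr b); rewrite -catA same_rows_sym same_rows_sym.
Qed.

End RowEquivalence.

(** * Sums of coefficients over classes of row-equivalent words *)

Section ClassCoefficient.
Variables (K : fieldType) (m : nat).
Local Notation step := ('I_m * 'I_m)%type.
Local Notation series := (ncseries K step).
Implicit Types (F G : series) (v w t : seq step) (x : step).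

(** Row-equivalent words have equal length, so tuples of the size of [w] cover the whole class and
    the sum is finite. *)
Definition class_coef F w : K :=
  \sum_(t : (size w).-tuple step | same_rows t w) F t.

Lemma class_coef_same_rows F v w : same_rows v w -> class_coef F v = class_coef F w.
Proof.
move=> vw; rewrite /class_coef (perm_size (same_rows_perm vw)).
apply: eq_bigl => t; apply/idP/idP => tv; first exact: same_rows_trans tv vw.
by rewrite same_rows_sym in vw; apply: same_rows_trans tv vw.
Qed.

Lemma class_coefD F G w : class_coef (F + G) w = class_coef F w + class_coef G w.
Proof. by rewrite -big_split. Qed.

Lemma class_coefZ (a : K) F w : class_coef (a *: F) w = a * class_coef F w.
Proof. by rewrite /class_coef mulr_sumr. Qed.

Lemma class_coef_sum (I : Type) (r : seq I) (P : pred I) (F : I -> series) w :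
  class_coef (\sum_(i <- r | P i) F i) w = \sum_(i <- r | P i) class_coef (F i) w.
Proof.
rewrite /class_coef exchange_big /=; apply: eq_bigr => t _.
by rewrite nc_sumE.
Qed.

Lemma class_coef_one w : class_coef 1 w = (w == [::])%:R.
Proof.
rewrite /class_coef; case: w => [|x w] /=.
  rewrite (bigD1 [tuple]) ?same_rows_refl //= big1 ?addr0 // => t /andP[_ /negP[]].
  by rewrite tuple0.
apply: big1 => t _; rewrite nc_oneE; case: eqP => // t0.
by have := size_tuple t; rewrite t0.
Qed.

Lemma ncvar_mulE x F y w : (ncvar K x * F) (y :: w) = (y == x)%:R * F w.
Proof.
rewrite nc_mul_consE mul0r add0r.
have -> : nc_deriv y (ncvar K x) = (y == x)%:R *: 1.
  apply/funext => v; rewrite /nc_deriv /ncvar nc_scaleE nc_oneE eqseq_cons.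
  by case: eqP; rewrite ?mul1r ?mul0r.
by rewrite -scalerAl mul1r nc_scaleE.
Qed.

Lemma class_coef_ncvarM x F w :
  class_coef (ncvar K x * F) w =
    \sum_(t : (size w).-1.-tuple step | same_rows (x :: t) w) F t.
Proof.
case: w => [|y w]; rewrite /class_coef.
  rewrite !big1 //= => [t /same_rows_perm/perm_size //|t _].
  by rewrite tuple0 /= nc_constM mul0r.
rewrite [RHS]big_mkcond (bigID (fun t : (size w).+1.-tuple step => thead t == x)) /=.
rewrite [X in _ + X]big1 ?addr0 => [|t /andP[_ /negPf tx]]; last first.
  by rewrite (tuple_eta t) /= ncvar_mulE tx mul0r.
rewrite (reindex_onto (fun t : (size w).-tuple step => [tuple of x :: t])
   (fun t : (size w).+1.-tuple step => [tuple of behead t])) /=; last first.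
  by move=> t /andP[_ /eqP <-]; rewrite -tuple_eta.
rewrite [LHS]big_mkcond; apply: eq_bigr => t _ /=.
rewrite theadE eqxx andbT ncvar_mulE eqxx mul1r.
by rewrite (_ : _ == t) ?andbT //; apply/eqP/val_inj.
Qed.

(** Left cancellation: prefixing [t] to two words neither creates nor destroys row equivalence. *)
Lemma class_coef_word_cat t F w :
  class_coef ((\prod_(x <- t) ncvar K x) * F) (t ++ w) = class_coef F w.
Proof.
elim: t F => [|x t IH] F; first by rewrite big_nil mul1r.
rewrite big_cons -mulrA /= class_coef_ncvarM /= -[RHS]IH.
by apply: eq_bigl => v; rewrite (same_rows_catl [:: x]).
Qed.

(** A left factor contributes only to the classes that it divides on the left. *)
Lemma class_coef_word_neq0 t F w :
  class_coef ((\prod_(x <- t) ncvar K x) * F) w != 0 ->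
  exists v, same_rows (t ++ v) w.
Proof.
elim: t F w => [|x t IH] F w; first by exists w; apply: same_rows_refl.
rewrite big_cons -mulrA class_coef_ncvarM => nz.
have [s xsw|none] := pickP (fun s : (size w).-1.-tuple step => same_rows (x :: s) w); last first.
  by case/eqP: nz; apply: big_pred0 => s; apply: none.
have eqc : class_coef ((\prod_(x <- t) ncvar K x) * F) s != 0.
  apply: contraNneq nz => e0; apply/eqP; rewrite -[RHS]e0 /class_coef size_tuple.
  apply: eq_bigl => v; rewrite -[same_rows v s](same_rows_catl [:: x]) /=.
  apply/idP/idP => e; last exact: same_rows_trans e xsw.
  by rewrite same_rows_sym in xsw; apply: same_rows_trans e xsw.
have [v tvs] := IH _ _ eqc; exists v; apply: same_rows_trans xsw.
by rewrite (same_rows_catl [:: x]).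
Qed.

Lemma cf_pi_word v w : same_rows v w ->
  cf_pi (\prod_(x <- v) ncvar K x) = cf_pi (\prod_(x <- w) ncvar K x).
Proof.
elim: v w => [|x v IH] w vw.
  by have /perm_size/esym/size0nil -> := same_rows_perm vw.
have [a [b [-> xa vab]]] := same_rows_head vw.
rewrite big_cons rmorphM /= (IH _ vab) !big_cat /= big_cons !rmorphM /=.
rewrite !mulrA; congr (_ * _).
rewrite (big_morph _ (rmorphM (@cf_pi K m)) (rmorph1 _)) big_seq.
apply: commr_prod => y ya; apply: cf_pi_comm; apply: contra xa => /eqP ->.
exact: map_f.
Qed.

(* It suffices to look at the truncations of F, whose words may be replaced by
   chosen representatives of their classes. *)
Lemma cf_ideal_class_coef F : (forall w, class_coef F w = 0) -> cf_ideal F.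
Proof.
move=> F0; apply: (closed_ideal_closed (closed_ideal_cf K m)) => N.
exists (\sum_(k < N.+1) \sum_(t : k.-tuple step) F t *: \prod_(x <- t) ncvar K x).
  rewrite -[X in cf_ideal X]subr0; apply/cf_piE; rewrite rmorph0 rmorph_sum big1 // => k _.
  pose rep (t : k.-tuple step) := choose (fun u : k.-tuple step => same_rows u t) t.
  have rep_eq (t : k.-tuple step) : same_rows (rep t) t.
    exact: (@chooseP _ (fun u : k.-tuple step => same_rows u t) t (same_rows_refl t)).
  rewrite (partition_big rep xpredT) //= rmorph_sum big1 //= => u _.
  transitivity (\sum_(t : k.-tuple step | rep t == u)
      cf_pi (F t *: 1) * cf_pi (\prod_(x <- u) ncvar K x)).
    rewrite rmorph_sum; apply: eq_bigr => t /eqP <-.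
    by rewrite (cf_pi_word (rep_eq t)) -rmorphM -scalerAl mul1r.
  rewrite -mulr_suml -rmorph_sum -scaler_suml /=.
  have rep_class (t v : k.-tuple step) : same_rows t v -> rep t = rep v.
    move=> tv; rewrite /rep (@eq_choose _ _ (fun w : k.-tuple step => same_rows w v)).
      by apply: choose_id => //; apply: same_rows_refl.
    move=> w; apply/idP/idP => e; first exact: same_rows_trans e tv.
    by rewrite same_rows_sym in tv; apply: same_rows_trans e tv.
  have [ru|/eqP neq_ru] := eqVneq (rep u) u; last first.
    rewrite big_pred0 ?scale0r ?rmorph0 ?mul0r // => t; apply/eqP => e.
    by apply: neq_ru; rewrite -[RHS]e; apply: rep_class; rewrite -e; apply: rep_eq.
  rewrite (_ : \sum_(i | _) _ = 0) ?scale0r ?rmorph0 ?mul0r //.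
  rewrite -[RHS](F0 u) /class_coef size_tuple; apply: eq_bigl => t.
  apply/eqP/idP => [<-|tu]; first by rewrite same_rows_sym; apply: rep_eq.
  by rewrite (rep_class _ _ tu).
move=> w lew; rewrite nc_sumE (bigD1 (Ordinal (lew : (size w < N.+1)%N))) //=.
rewrite [X in _ + X]big1 ?addr0 => [|k neq_k]; last first.
  rewrite nc_sumE big1 // => t _; rewrite nc_scaleE nc_prodE.
  case: eqP => [e|]; last by rewrite mulr0.
  by case/eqP: neq_k; apply: val_inj; rewrite /= e size_tuple.
rewrite nc_sumE (bigD1 (in_tuple w)) //= [X in _ + X]big1 ?addr0 => [|t neq_t].
  by rewrite nc_scaleE nc_prodE eqxx mulr1.
rewrite nc_scaleE nc_prodE; case: eqP => [e|]; last by rewrite mulr0.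
by case/eqP: neq_t; apply: val_inj.
Qed.

Lemma cf_eq_class_coef F G :
  (forall w, class_coef F w = class_coef G w) -> cf_eq F G.
Proof.
move=> eqFG; apply: cf_ideal_class_coef => w.
by rewrite -[- G]scaleN1r class_coefD class_coefZ eqFG mulN1r subrr.
Qed.

End ClassCoefficient.

(** * Sylvester's identity *)

Lemma map_cdet (S T : nzRingType) (f : {rmorphism S -> T}) (N : nat) (B : 'M[S]_N) :
  f (cdet B) = cdet (map_mx f B).
Proof.
rewrite rmorph_sum; apply: eq_bigr => s _.
rewrite rmorphM rmorphXn rmorphN rmorph1 rmorph_prod; congr (_ * _).
by apply: eq_bigr => j _; rewrite mxE.
Qed.

Lemma cdet_det (S : comNzRingType) (N : nat) (B : 'M[S]_N) : cdet B = \det B.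
Proof.
rewrite -det_tr; apply: eq_bigr => s _; rewrite sign_inversionsR; congr (_ * _).
by apply: eq_bigr => j _; rewrite mxE.
Qed.

Lemma cdet_mx11 (S : nzRingType) (B : 'M[S]_1) : cdet B = B 0 0.
Proof.
rewrite cdet_levi (bigD1 [ffun=> 0]) //= [X in _ + X]big1 ?addr0 => [|s /negP[]].
  rewrite big_ord1 ffunE /levi det_mx11 mxE ffunE eqxx; exact: mulr1z.
by apply/eqP/ffunP => j; rewrite ffunE ord1.
Qed.

Section ConstantTerm.
Variables (K : fieldType) (X : finType).

Definition nc_const (f : ncseries K X) : K := f [::].

Lemma nc_const_is_zmod_morphism : zmod_morphism nc_const.
Proof. by []. Qed.
HB.instance Definition _ :=
  GRing.isZmodMorphism.Build (ncseries K X) K nc_const nc_const_is_zmod_morphism.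
Lemma nc_const_is_monoid_morphism : monoid_morphism nc_const.
Proof. by split=> // f g; rewrite /nc_const nc_constM. Qed.
HB.instance Definition _ :=
  GRing.isMonoidMorphism.Build (ncseries K X) K nc_const nc_const_is_monoid_morphism.

End ConstantTerm.

Section SylvesterIdentity.
Variables (K : fieldType) (n p : nat).
Local Notation m := (n + p)%N.
Local Notation step := ('I_m * 'I_m)%type.
Local Notation series := (ncseries K step).
Local Notation A := (gen_mx K m).
Local Notation Q := (cf_quot K m).
Let pi : {rmorphism series -> Q} := @cf_pi K m.

(** Row and column selections are arbitrary in order to cover both [I - A] and the bordered
    matrices, where the last row and column are those of one entry of the lower right block; [d] is
    the scalar part of the entries. *)
Lemma gen_rows_commute (a b : nat) (r : 'I_a -> 'I_m) (c : 'I_b -> 'I_m)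
    (d : 'I_a -> 'I_b -> nat) :
  injective r -> rows_commute (\matrix_(i, j) ((d i j)%:R - pi (A (r i) (c j)))).
Proof.
move=> r_inj i k j l neq_ik; rewrite !mxE; apply: commrB; first exact: commr_nat.
apply/commr_sym/commrB; first exact: commr_nat.
by apply: cf_pi_comm; rewrite /= inj_eq // eq_sym.
Qed.

(** Indicator of the walks from [i] to [j] through heights below [n]; their sum is the entry of the
    inverse of [I - A_0], which serves as the right inverse in [cdet_Schur]. *)
Fixpoint walk_coef (i j : 'I_n) (w : seq step) : K :=
  if w is x :: w' then
    \sum_k (x == (lshift p i, lshift p k))%:R * walk_coef k j w'
  else (i == j)%:R.

Definition walk_mx : 'M[series]_n := \matrix_(i, j) walk_coef i j.

Lemma walk_mxE : (1%:M - ulsubmx A) *m walk_mx = 1%:M.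
Proof.
apply/matrixP => i j; rewrite mulmxBl mul1mx !mxE; apply/funext => w.
rewrite nc_addE nc_oppE nc_sumE.
case: w => [|x w] /=.
  rewrite big1 ?subr0 => [|k _]; last by rewrite !mxE nc_constM mul0r.
  by case: eqP.
have -> : ((i == j)%:R : series) (x :: w) = 0 by case: eqP.
apply/eqP; rewrite subr_eq0; apply/eqP; apply: eq_bigr => k _.
by rewrite !mxE ncvar_mulE.
Qed.

Lemma cdet_small_const : cdet (1%:M - ulsubmx A) [::] = 1.
Proof.
rewrite -[LHS]/(nc_const _) (map_cdet (@nc_const K _)) cdet_det -[RHS](det1 K n); congr (\det _).
by apply/matrixP => i j; rewrite !mxE rmorphB /= rmorph_nat [nc_const _]/= subr0.
Qed.

Lemma cdet_small_unit : cdet (1%:M - ulsubmx A) \is a GRing.unit.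
Proof. by rewrite -[_ \is a _]/(_ != 0) cdet_small_const oner_eq0. Qed.

Lemma cdet_sylvester_const : cdet (1%:M - sylvester_mx A) [::] = 1.
Proof.
rewrite -[LHS]/(nc_const _) (map_cdet (@nc_const K _)) cdet_det -[RHS](det1 K p); congr (\det _).
apply/matrixP => i j; rewrite !mxE rmorphB /= rmorph_nat rmorphN rmorphM /=.
rewrite (map_cdet (@nc_const K _)) cdet_det map_block_mx.
have -> : map_mx (@nc_const K _) (- col j (ursubmx A)) = 0.
  by apply/matrixP => k l; rewrite !mxE rmorphN /= [nc_const _]/= oppr0.
rewrite det_lblock det_mx11 !mxE eqxx mulr1n rmorphN /= [nc_const (ncvar _ _)]/= oppr0.
by rewrite !mulr0 oppr0 subr0.
Qed.

(** The Schur complement is taken twice: in [I - A], where it is [p] by [p], and in each bordered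
    matrix, where it is 1 by 1 and gives, up to the identity matrix, one entry of the former. The
    factor [D0^-1] in [sylvester_mx] removes the determinant of the common block. *)
Theorem cf_pi_cdet_sylvester :
  pi (cdet (1%:M - sylvester_mx A)) =
  pi ((cdet (1%:M - ulsubmx A))^-1 * cdet (1%:M - A)).
Proof.
set D0 := cdet (1%:M - ulsubmx A).
pose Z := map_mx pi walk_mx.
pose M : 'M[Q]_(n + p) := map_mx pi (1%:M - A).
have ME i j : M i j = (i == j)%:R - pi (A i j).
  by rewrite !mxE rmorphB /= rmorph_nat.
have M0 : ulsubmx M = map_mx pi (1%:M - ulsubmx A).
  by apply/matrixP => i j; rewrite /M !mxE.
have MZ : ulsubmx M *m Z = 1%:M by rewrite M0 -map_mxM walk_mxE map_mx1.
have cM : rows_commute M.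
  have := @gen_rows_commute m m id id (fun i j => i == j) (fun _ _ e => e).
  by move=> c i k j l ik; have := c i k j l ik; rewrite [X in GRing.comm X]mxE [X in GRing.comm _ X]mxE !ME.
have detM := cdet_Schur cM MZ.
have D0pi : cdet (ulsubmx M) = pi D0 by rewrite M0 map_cdet.
have D0V : pi D0^-1 * pi D0 = 1 by rewrite -rmorphM mulVr ?rmorph1 ?cdet_small_unit.
have detM' : pi (cdet (1%:M - A)) = cdet M by rewrite (map_cdet pi).
rewrite rmorphM detM' detM D0pi mulrA D0V mul1r (map_cdet pi); congr cdet.
apply/matrixP => i j.
pose B : 'M[Q]_(n + 1) :=
  map_mx pi (block_mx (1%:M - ulsubmx A) (- col j (ursubmx A))
                      (- row i (dlsubmx A)) (- (drsubmx A i j)%:M : 'M_1)).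
pose r (x : 'I_(n + 1)) : 'I_m :=
  match split x with inl k => lshift p k | inr _ => rshift n i end.
pose c (x : 'I_(n + 1)) : 'I_m :=
  match split x with inl k => lshift p k | inr _ => rshift n j end.
have r_inj : injective r.
  move=> x y; rewrite /r; case: (split_ordP x) => k ->; case: (split_ordP y) => l ->.
  - by move=> /lshift_inj ->.
  - by move=> /eqP; rewrite eq_lrshift.
  - by move=> /eqP; rewrite eq_rlshift.
  by rewrite !ord1.
have cB : rows_commute B.
  have := @gen_rows_commute _ _ r c (fun x y => if split x is inl k then
       if split y is inl l then (k == l : nat) else 0%N else 0%N) r_inj.
  rewrite (_ : \matrix_(_, _) _ = B) //; apply/matrixP => x y; rewrite !mxE /r /c.
  case: (splitP x) => k ek; rewrite !mxE; case: (splitP y) => l el; rewrite !mxE.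
  - by rewrite rmorphB /= rmorph_nat.
  - by rewrite sub0r rmorphN.
  - by rewrite sub0r rmorphN.
  by rewrite sub0r !ord1 eqxx mulr1n rmorphN.
have B0 : ulsubmx B = ulsubmx M by rewrite /B map_block_mx block_mxKul M0.
have BZ : ulsubmx B *m Z = 1%:M by rewrite B0.
have := cdet_Schur cB BZ; rewrite B0 D0pi.
set x := cdet (drsubmx B - _) => detB.
have xE : x = pi (- drsubmx A i j) - (dlsubmx M *m (Z *m ursubmx M)) i j.
  rewrite /x cdet_mx11 [LHS]mxE [in X in _ + X]mxE; congr (_ + _).
    by rewrite /B map_block_mx block_mxKdr !mxE eqxx mulr1n.
  rewrite (_ : dlsubmx B = row i (dlsubmx M)); last first.
    rewrite /B map_block_mx block_mxKdl; apply/matrixP => a b.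
    by rewrite ord1 [LHS]mxE [in RHS]mxE [RHS]mxE [RHS]mxE ME !mxE eq_rlshift sub0r rmorphN.
  rewrite (_ : ursubmx B = col j (ursubmx M)); last first.
    rewrite /B map_block_mx block_mxKur; apply/matrixP => a b.
    by rewrite ord1 [LHS]mxE [in RHS]mxE [RHS]mxE [RHS]mxE ME !mxE eq_lrshift sub0r rmorphN.
  by rewrite colE rowE !mulmxA -colE -!mulmxA -rowE [in LHS]mxE [in LHS]mxE mxE.
have entry : (1%:M - sylvester_mx A) i j = (i == j)%:R + D0^-1 *
    cdet (block_mx (1%:M - ulsubmx A) (- col j (ursubmx A))
                   (- row i (dlsubmx A)) (- (drsubmx A i j)%:M : 'M_1)).
  by rewrite !mxE opprK.
rewrite [LHS]mxE entry rmorphD rmorphM /= rmorph_nat (map_cdet pi) -/B detB.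
rewrite mulrA D0V mul1r xE addrA.
rewrite [in RHS]mxE [in X in _ = _ + X]mxE; congr (_ + _).
by rewrite !mxE rmorphB rmorphN /= rmorph_nat eq_rshift.
Qed.

End SylvesterIdentity.

(** * Cycles and the expansion of the determinant *)

Lemma cdet1 (S : nzRingType) (N : nat) : cdet (1%:M : 'M[S]_N) = 1.
Proof.
have := map_cdet (intr : {rmorphism int -> S}) (1%:M : 'M_N).
by rewrite cdet_det det1 map_mx1 rmorph1 => <-.
Qed.

Section DeterminantExpansion.
Variables (K : fieldType) (m : nat).
Local Notation step := ('I_m * 'I_m)%type.
Local Notation series := (ncseries K step).

(** Restricting the columns lets one expansion serve [det(I - A)], with all columns, and
    [det(I - A_0)], with the columns below [n]. *)
Definition cols_mx (R : {set 'I_m}) : 'M[series]_m :=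
  \matrix_(i, j) (if j \in R then ncvar K (i, j) else 0).

Definition perm_word (J : {set 'I_m}) (s : 'S_m) : seq step :=
  [seq (s j, j) | j <- enum J].

(** [J] collects the columns where the entry of the matrix rather than that of the identity is
    chosen; elsewhere the permutation must fix the column. *)
Lemma cdet_cols_mx (R : {set 'I_m}) :
  cdet (1%:M - cols_mx R) =
  \sum_(Js : {set 'I_m} * 'S_m | (Js.1 \subset R) && perm_on Js.1 Js.2)
     (-1) ^+ (Js.2 + #|Js.1|) *: \prod_(x <- perm_word Js.1 Js.2) ncvar K x.
Proof.
have sign_scale k (x : series) : (-1) ^+ k * x = (-1) ^+ k *: x.
  by elim: k => [|k IH]; rewrite ?mul1r ?scale1r // !exprS -mulrA IH -scalerA scaleN1r mulN1r.
transitivity (\sum_(s : 'S_m) \sum_(J : {set 'I_m} | (J \subset R) && perm_on J s)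
     (-1) ^+ (s + #|J|) *: \prod_(x <- perm_word J s) ncvar K x : series).
  apply: eq_bigr => s _; rewrite sign_inversionsR.
  rewrite (eq_bigr (fun j => - cols_mx R (s j) j + (s j == j)%:R)) => [|j _]; last first.
    by rewrite !mxE addrC.
  rewrite bigA_distr /= mulr_sumr [RHS]big_mkcond; apply: eq_bigr => J _.
  case: ifPn => [/andP[/subsetP JR /subsetP sJ]|].
    rewrite (eq_bigr (fun j => if j \in J then - ncvar K (s j, j) else 1)) => [|j _].
      rewrite -big_mkcond /= prodrN mulrA -exprD sign_scale.
      by rewrite /perm_word big_map -big_filter [index_enum _]unlock.
    case: ifPn => [jJ|]; first by rewrite mxE JR.
    by move=> /(contraNN (sJ j)); rewrite negbK => /eqP ->; rewrite eqxx.
  rewrite negb_and => /orP[/subsetPn[j jJ jR]|/subsetPn[j sj jJ]].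
    by rewrite (prod_ord_split j) jJ mxE (negbTE jR) oppr0 mulr0 mul0r mulr0.
  by rewrite (prod_ord_split j) (negbTE jJ) (negbTE sj) mulr0 mul0r mulr0.
rewrite pair_big_dep /= (reindex (fun Js : {set 'I_m} * 'S_m => (Js.2, Js.1))) //.
by exists (fun sJ => (sJ.2, sJ.1)) => -[].
Qed.

End DeterminantExpansion.

(** * Cycles as words of steps *)

Section Cycles.
Variable m : nat.
Local Notation step := ('I_m * 'I_m)%type.
Implicit Types (c w : seq step).

Definition is_cycle c :=
  [&& c != [::], uniq (unzip1 c) &
      c == [seq (x, next (unzip1 c) x) | x <- unzip1 c]].

Lemma cycle_neq0 c : is_cycle c -> c != [::].
Proof. by case/and3P. Qed.

Lemma cycle_uniq c : is_cycle c -> uniq (unzip1 c).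
Proof. by case/and3P. Qed.

Lemma cycle_stepE c x y : is_cycle c ->
  ((x, y) \in c) = (x \in unzip1 c) && (y == next (unzip1 c) x).
Proof.
case/and3P=> _ uc /eqP ec; rewrite {1}ec; apply/mapP/andP => [[z zc [-> ->]]//|[xc /eqP->]].
by exists x.
Qed.

Lemma cycle_unzip2 c : is_cycle c -> perm_eq (unzip1 c) (unzip2 c).
Proof.
case/and3P=> _ uc /eqP ec; rewrite [in unzip2 c]ec /unzip2 -map_comp /=.
have inj_next : injective (next (unzip1 c)) by apply: can_inj (prev_next uc).
apply: uniq_perm => // [|x]; first by rewrite map_inj_uniq.
apply/idP/mapP => [xc|[y yc ->]]; last by rewrite /= mem_next.
by exists (prev (unzip1 c) x); rewrite ?mem_prev //= next_prev.
Qed.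

(** Induction around the cycle: each of its heights is an iterate of [next] at any other one. *)
Lemma cycle_closed c (P : pred 'I_m) : is_cycle c ->
  (forall x y, (x, y) \in c -> P x -> P y) ->
  forall x y, x \in unzip1 c -> y \in unzip1 c -> P x -> P y.
Proof.
move=> cc closedP x y xc yc Px; have uc := cycle_uniq cc.
have := fconnect_cycle (cycle_next uc) xc y; rewrite yc => /iter_findex <-.
set q := findex _ _ _.
suff : (iter q (next (unzip1 c)) x \in unzip1 c) && P (iter q (next (unzip1 c)) x).
  by case/andP.
elim: q => [|q /andP[itc Pit]] /=; first by rewrite xc.
rewrite mem_next itc /=; apply: closedP Pit.
by rewrite cycle_stepE // itc eqxx.
Qed.

Lemma mem_unzip1 w x : reflect (exists y, (x, y) \in w) (x \in unzip1 w).
Proof.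
apply: (iffP mapP) => [[[a b] abw /= ->]|[y xyw]]; first by exists b.
by exists (x, y).
Qed.

Lemma mem_heights w x : (x \in heights w) = (x \in unzip1 w).
Proof. by rewrite inE. Qed.

Lemma uniq_same_rows v w : uniq (unzip1 v) -> perm_eq v w -> same_rows v w.
Proof.
move=> uv vw; apply/same_rowsP => i; apply: perm_small_eq; last exact: perm_filter.
rewrite size_filter -(seq.permP vw) -(count_map _ (pred1 i)).
by rewrite count_uniq_mem // leq_b1.
Qed.

Lemma uniq_step_inj w x y y' :
  uniq (unzip1 w) -> (x, y) \in w -> (x, y') \in w -> y = y'.
Proof.
elim: w => [//|z w IH] /= /andP[zw uw]; rewrite !inE.
move=> /predU1P[e|xy] /predU1P[e'|xy']; first by case: (etrans e (esym e')).
- by rewrite -e in zw; case/negP: zw; apply/mem_unzip1; exists y'.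
- by rewrite -e' in zw; case/negP: zw; apply/mem_unzip1; exists y.
exact: IH.
Qed.

Lemma steps_from_uniq w x y :
  uniq (unzip1 w) -> (x, y) \in w -> steps_from x w = [:: (x, y)].
Proof.
move=> uw xyw; apply: perm_small_eq => //; apply: uniq_perm => //.
  exact/filter_uniq/(map_uniq uw).
move=> [a b]; rewrite mem_filter !inE /=; apply/andP/eqP => [[/eqP-> abw]|[-> ->]] //.
by rewrite (uniq_step_inj uw abw xyw).
Qed.

End Cycles.

(** * Products of cycles *)

Section CycleWords.
Variables (m k : nat).
Local Notation step := ('I_m * 'I_m)%type.
Variable u : 'I_k -> seq step.
Hypothesis cyc_u : forall i, is_cycle (u i).
Implicit Types (V T : {set 'I_k}) (e : seq 'I_k).

Definition cycle_word V := flatten [seq u i | i <- enum V].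

(** The minimal pieces of the heap: the cycles that commute to the front of [cycle_word u V]. *)
Definition minimal_cycles V := [set i in V |
  [forall j in V, (j < i)%N ==> [disjoint heights (u j) & heights (u i)]]].

Lemma disjoint_heights i j x : [disjoint heights (u i) & heights (u j)] ->
  x \in unzip1 (u i) -> x \notin unzip1 (u j).
Proof.
by rewrite -!mem_heights => dij xi; rewrite (disjointFr dij).
Qed.

Lemma minimal_cyclesP V i j : i \in minimal_cycles V -> j \in V -> (j < i)%N ->
  [disjoint heights (u j) & heights (u i)].
Proof. by rewrite inE => /andP[_ /forall_inP mi] /mi /implyP; apply. Qed.

Lemma minimal_cycles_disjoint V i j :
  i \in minimal_cycles V -> j \in minimal_cycles V -> i != j ->
  [disjoint heights (u i) & heights (u j)].
Proof.
move=> iV jV; rewrite -val_eqE neq_ltn => /orP[] lt.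
  by apply: (minimal_cyclesP jV) lt; case/setIdP: iV.
by rewrite disjoint_sym; apply: (minimal_cyclesP iV) lt; case/setIdP: jV.
Qed.

Lemma mem_flatten_cycles e x :
  reflect (exists2 i, i \in e & x \in u i) (x \in flatten [seq u i | i <- e]).
Proof. exact: flatten_mapP. Qed.

Lemma unzip1_flatten_cycles e x :
  reflect (exists2 i, i \in e & x \in unzip1 (u i))
          (x \in unzip1 (flatten [seq u i | i <- e])).
Proof.
apply: (iffP idP) => [/mem_unzip1[y /mem_flatten_cycles[i ie xyi]]|].
  by exists i => //; apply/mem_unzip1; exists y.
move=> [i ie /mem_unzip1[y xyi]]; apply/mem_unzip1; exists y.
by apply/mem_flatten_cycles; exists i.
Qed.

Lemma sorted_enum_ord V : sorted (fun i j : 'I_k => (i < j)%N) (enum V).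
Proof.
rewrite /enum_mem; apply: sorted_filter; first by move=> j i l; apply: ltn_trans.
by have := iota_ltn_sorted 0 k; rewrite -val_enum_ord sorted_map enumT.
Qed.

Lemma enum_filter V T : T \subset V -> [seq i <- enum V | i \in T] = enum T.
Proof.
move=> /subsetP TV; rewrite /enum_mem -filter_predI; apply: eq_filter => i /=.
by rewrite andb_idr // => /TV.
Qed.

(** A minimal cycle shares no height with the cycles of [V] before it, so it moves past them to the
    front. *)
Lemma cycle_word_split V T : T \subset minimal_cycles V ->
  same_rows (cycle_word V) (cycle_word T ++ cycle_word (V :\: T)).
Proof.
move=> TM; have TV : T \subset V.
  by apply: subset_trans TM _; apply/subsetP => i; case/setIdP.
rewrite /cycle_word -(enum_filter TV) -(enum_filter (subsetDl V T)).
rewrite [[seq i <- enum V | i \in V :\: T]](_ : _ = [seq i <- enum V | i \notin T]); last first.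
  by apply: eq_in_filter => i; rewrite mem_enum inE => ->; rewrite andbT.
have disj i j : i \in enum V -> j \in enum V -> i \in T -> (j < i)%N ->
    [disjoint heights (u j) & heights (u i)].
  by rewrite !mem_enum => _ jV iT; apply: minimal_cyclesP jV; apply: (subsetP TM).
elim: (enum V) (sorted_enum_ord V) disj => [|j e IH] /= srt disj.
  exact: same_rows_refl.
have ltje : all (fun i : 'I_k => (j < i)%N) e.
  by apply: order_path_min srt => a b c; apply: ltn_trans.
have /IH {}IH := path_sorted srt.
have {}IH := IH (fun a b ae be => disj a b (mem_behead (s := j :: e) ae) (mem_behead (s := j :: e) be)).
have [jT|jT] /= := boolP (j \in T); first by rewrite -catA same_rows_catl.
apply: same_rows_trans (_ : same_rows _ (u j ++ (flatten [seq u i | i <- e & i \in T] ++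
   flatten [seq u i | i <- e & i \notin T]))) _; first by rewrite same_rows_catl.
rewrite !catA; apply: same_rows_catr; apply: same_rows_catC => x xj.
apply/negP => /unzip1_flatten_cycles[j']; rewrite mem_filter => /andP[jT' je'].
apply/negP; apply: disjoint_heights xj; apply: disj => //; rewrite ?inE ?eqxx ?je' ?orbT //.
exact: (allP ltje).
Qed.

Lemma cycle_word_uniq V T : T \subset minimal_cycles V -> uniq (unzip1 (cycle_word T)).
Proof.
move=> TM; have : {subset enum T <= T} by move=> i; rewrite mem_enum.
rewrite /cycle_word; elim: (enum T) (enum_uniq T) => [//|i e IH] /= /andP[ie ue] eT.
rewrite /unzip1 map_cat cat_uniq; apply/and3P; split.
- exact: cycle_uniq.
- apply/hasPn => x /unzip1_flatten_cycles[j je xj].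
  apply: disjoint_heights xj; apply: (minimal_cycles_disjoint (V := V)).
  + by apply: (subsetP TM); apply: eT; rewrite inE je orbT.
  + by apply: (subsetP TM); apply: eT; rewrite inE eqxx.
  by apply: contraNneq ie => <-.
by apply: IH => // j je; apply: eT; rewrite inE je orbT.
Qed.

Lemma cycle_word_unzip2 V : perm_eq (unzip1 (cycle_word V)) (unzip2 (cycle_word V)).
Proof.
rewrite /cycle_word; elim: (enum V) => [//|i e IH] /=.
by rewrite /unzip1 /unzip2 !map_cat perm_cat // cycle_unzip2.
Qed.

Lemma steps_from_first e x y r :
  steps_from x (flatten [seq u i | i <- e]) = y :: r ->
  exists i, [/\ i \in e, y \in u i & index i e = find (fun i => x \in unzip1 (u i)) e].
Proof.
elim: e => [//|j e IH] /=; rewrite steps_from_cat.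
have [/mem_unzip1[z xz]|xj] := boolP (x \in unzip1 (u j)).
  rewrite (steps_from_uniq (cycle_uniq (cyc_u j)) xz) => -[<- _].
  by exists j; rewrite inE eqxx.
rewrite (steps_from_nil xj) /= => sxy; have [i [ie yi <-]] := IH sxy.
exists i; split; rewrite ?inE ?ie ?orbT //; case: eqP => // ji; case/negP: xj.
have : y \in steps_from x (flatten [seq u i | i <- e]) by rewrite sxy inE eqxx.
by rewrite mem_filter ji => /andP[/eqP <- _]; apply: map_f.
Qed.

End CycleWords.

(** * Terms of the determinant as left factors of a product of cycles *)

Section MinimalCycles.
Variables (m k : nat).
Local Notation step := ('I_m * 'I_m)%type.
Variable u : 'I_k -> seq step.
Hypothesis cyc_u : forall i, is_cycle (u i).
Implicit Types (V T : {set 'I_k}) (J : {set 'I_m}) (s : 'S_m).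

Definition cycles_support T := \bigcup_(i in T) heights (u i).

Lemma mem_perm_word J s x y : ((x, y) \in perm_word J s) = (y \in J) && (x == s y).
Proof.
apply/mapP/andP => [[z]|[yJ /eqP->]]; first by rewrite mem_enum => zJ [-> ->].
by exists y; rewrite ?mem_enum.
Qed.

Lemma perm_word_uniq J s : uniq (unzip1 (perm_word J s)).
Proof.
rewrite /unzip1 -map_comp map_inj_uniq ?enum_uniq //.
exact: perm_inj.
Qed.

Lemma mem_cycles_support T x :
  (x \in cycles_support T) = (x \in unzip1 (cycle_word u T)).
Proof.
apply/bigcupP/unzip1_flatten_cycles => -[j jT xj]; exists j => //; move: jT xj;
  by rewrite ?mem_enum ?mem_heights.
Qed.

Lemma perm_wordV J s x : perm_on J s -> (s^-1%g x \in J) = (x \in J).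
Proof. by move=> sJ; rewrite -(perm_closed _ sJ) permKV. Qed.

(** The step of the left factor from [x] is the first step from [x] in the product, so it lies in
    the first cycle through [x], at position [pos x]. That cycle also contains the next height, so
    [pos] cannot increase along the steps; it is therefore constant on orbits, each orbit is a whole
    cycle [u i], and no earlier cycle meets it. *)
Lemma perm_word_cycles V J s v : perm_on J s ->
  same_rows (perm_word J s ++ v) (cycle_word u V) ->
  let T := [set i in minimal_cycles u V | heights (u i) \subset J] in
  J = cycles_support T /\ perm_eq (perm_word J s) (cycle_word u T).
Proof.
move=> sJ rows T; set e := enum V.
pose pos x := find (fun i => x \in unzip1 (u i)) e.
pose nx x := s^-1%g x.
have stepJ x : x \in J -> (x, nx x) \in perm_word J s.
  by move=> xJ; rewrite mem_perm_word perm_wordV // xJ permKV eqxx.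
have first x : x \in J -> exists i, [/\ i \in V, (x, nx x) \in u i & index i e = pos x].
  move=> xJ; have /same_rowsP /(_ x) := rows.
  rewrite steps_from_cat (steps_from_uniq (perm_word_uniq J s) (stepJ x xJ)) /=.
  by move=> /esym/(steps_from_first cyc_u) [j []]; rewrite mem_enum; exists j.
have pos_le x i : i \in V -> x \in unzip1 (u i) -> (pos x <= index i e)%N.
  move=> iV xi; rewrite leqNgt; apply/negP => /(before_find i).
  by rewrite nth_index ?mem_enum // xi.
have nx_rows x i : x \in unzip1 (u i) -> (x, nx x) \in u i -> nx x \in unzip1 (u i).
  by move=> xi; rewrite cycle_stepE // => /andP[_ /eqP->]; rewrite mem_next.
have row_of x y i : (x, y) \in u i -> x \in unzip1 (u i).
  by move=> xy; apply/mem_unzip1; exists y.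
have pos_lt i j : i \in V -> j \in V -> (j < i)%N -> (index j e < index i e)%N.
  move=> iV jV ltji; rewrite ltnNge leq_eqVlt; apply/negP => /orP[/eqP|lt_idx].
    move=> /(@index_inj _ i e i j) ij; move: ltji.
    by rewrite ij ?mem_enum // ltnn.
  have lt_tr : transitive (fun i j : 'I_k => (i < j)%N) by move=> a b c; apply: ltn_trans.
  have := sorted_ltn_index lt_tr (sorted_enum_ord V) _ _ _ _ lt_idx.
  by rewrite !mem_enum iV jV => /(_ isT isT); rewrite ltnNge ltnW.
have nx_pos x : x \in J -> pos (nx x) = pos x.
  have le_pos y : y \in J -> (pos (nx y) <= pos y ?= iff (pos (nx y) == pos y))%N.
    move=> yJ; apply/leqifP; case: eqP => // /eqP neq.
    have [j [jV stepj posj]] := first _ yJ.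
    rewrite ltn_neqAle neq -posj pos_le //.
    exact: nx_rows (row_of _ _ _ stepj) stepj.
  (* [s] permutes [J], so both sides have the same sum over [J], and all inequalities are
     equalities. *)
  have := leqif_sum (fun y (yJ : y \in J) => le_pos y yJ).
  rewrite (reindex_inj (@perm_inj _ s)) /=.
  rewrite (eq_bigl (mem J)) => [|y]; last exact: perm_closed.
  rewrite (eq_bigr pos) => [|y _]; last by rewrite /nx permK.
  by case=> _; rewrite eqxx => /esym/forall_inP/(_ x)/[apply] ?; apply/eqP.
have whole x i : x \in J -> i \in V -> (x, nx x) \in u i -> index i e = pos x ->
    forall y, y \in unzip1 (u i) -> y \in J /\ pos y = pos x.
  move=> xJ iV stepx posx y yi.
  suff : (y \in J) && (pos y == pos x) by case/andP => -> /eqP.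
  pose P z := (z \in J) && (pos z == pos x).
  apply: (cycle_closed (P := P) (cyc_u i) _ (row_of _ _ _ stepx) yi); last by rewrite /P xJ /=.
  move=> a b ab /andP[aJ /eqP posa].
  have [j [jV stepa posj]] := first a aJ.
  have eij : j = i.
    apply: (@index_inj _ j e); rewrite ?mem_enum //.
    by rewrite posj posa.
  rewrite eij in stepa.
  rewrite (uniq_step_inj (cycle_uniq (cyc_u i)) ab stepa) /P perm_wordV // aJ nx_pos //.
  exact/eqP.
have first_min x i : x \in J -> i \in V -> (x, nx x) \in u i -> index i e = pos x ->
    i \in T.
  move=> xJ iV stepx posx; have all_i := whole x i xJ iV stepx posx.
  rewrite inE; apply/andP; split; last first.
    by apply/subsetP => y; rewrite mem_heights => /all_i[].
  rewrite inE iV; apply/forall_inP => j jV; apply/implyP => ltji.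
  apply/pred0P => y /=; rewrite !mem_heights; apply/negP => /andP[yj yi].
  have [_ posy] := all_i y yi; have := pos_le y j jV yj.
  rewrite posy -posx leqNgt => /negP[].
  exact: pos_lt.
(* Conversely, a minimal cycle within [J] is the first cycle through each of its heights, so its
   steps are those of the permutation. *)
have in_min i a b : i \in T -> (a, b) \in u i -> b = nx a /\ a \in J.
  rewrite inE => /andP[iM /subsetP iJ] ab.
  have ai := row_of _ _ _ ab.
  have aJ : a \in J by apply: iJ; rewrite mem_heights.
  split=> //; have [j [jV stepa posj]] := first a aJ.
  have iV : i \in V by case/setIdP: iM.
  have [eij|neq_ij] := eqVneq i j.
    by rewrite -eij in stepa; apply: uniq_step_inj ab stepa; apply: cycle_uniq.
  have := pos_le a i iV ai; rewrite -posj leq_eqVlt => /orP[/eqP e_ij|].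
    by case/eqP: neq_ij; apply/esym/(@index_inj _ i e); rewrite ?mem_enum.
  have := neq_ij; rewrite -val_eqE neq_ltn => /orP[ltij|ltji].
    by rewrite ltnNge ltnW // pos_lt.
  have := disjoint_heights (minimal_cyclesP iM jV ltji) (row_of _ _ _ stepa).
  by rewrite ai.
split.
  apply/setP => x; apply/idP/bigcupP => [xJ|[ i ]].
    have [i [iV stepx posx]] := first x xJ; exists i; first exact: first_min posx.
    by rewrite mem_heights (row_of _ _ _ stepx).
  by rewrite inE => /andP[_ /subsetP]; apply.
apply: uniq_perm; first exact: map_uniq (perm_word_uniq J s).
  apply: (@map_uniq _ _ fst); apply: (cycle_word_uniq cyc_u (V := V)).
  by apply/subsetP => i; case/setIdP.
move=> [x y]; rewrite mem_perm_word; apply/andP/mem_flatten_cycles => [[yJ /eqP exy]|[ i ]].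
  have xJ : x \in J by rewrite exy perm_closed.
  have [i [iV stepx posx]] := first x xJ; exists i.
    by rewrite mem_enum; apply: first_min posx.
  by move: stepx; rewrite /nx exy permK.
rewrite mem_enum => iT /(in_min _ _ _ iT)[-> xJ].
by rewrite /nx permKV perm_wordV.
Qed.

Lemma perm_word_inj J s s' : perm_on J s -> perm_on J s' ->
  perm_eq (perm_word J s) (perm_word J s') -> s = s'.
Proof.
move=> sJ s'J /perm_mem eqw; apply/permP => x.
have [xJ|xJ] := boolP (x \in J); last by rewrite !(out_perm _ xJ).
by have := eqw (s x, x); rewrite !mem_perm_word xJ eqxx => /esym/eqP.
Qed.

Lemma perm_word_exists w : uniq (unzip1 w) -> perm_eq (unzip1 w) (unzip2 w) ->
  exists s : 'S_m, let J := [set x in unzip1 w] in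
    perm_on J s /\ perm_eq (perm_word J s) w.
Proof.
move=> uw bal; have u2 : uniq (unzip2 w) by rewrite -(perm_uniq bal).
(* As in [perm_word], the end of a step is sent to its start; the default [(x, x)] fixes the heights
   outside [w]. *)
pose f x := (nth (x, x) w (index x (unzip2 w))).1.
have f_in x : x \in unzip2 w -> (f x, x) \in w.
  move=> xw; have ltx : (index x (unzip2 w) < size w)%N.
    by rewrite -(size_map snd) index_mem.
  rewrite /f; set z := nth _ _ _.
  have z2 : z.2 = x by rewrite -(nth_map _ x) // nth_index.
  have <- : z = (z.1, x) by rewrite [LHS]surjective_pairing z2.
  exact: mem_nth.
have f_out x : x \notin unzip2 w -> f x = x.
  by move=> xw; rewrite /f nth_default // memNindex // size_map.
have f_rows x : (f x \in unzip1 w) = (x \in unzip1 w).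
  have [xw|xw] := boolP (x \in unzip2 w).
    by rewrite (perm_mem bal x) xw; apply/mem_unzip1; exists x; apply: f_in.
  by rewrite f_out.
have f_inj : injective f.
  move=> x y exy; have xy : (x \in unzip2 w) = (y \in unzip2 w).
    by rewrite -!(perm_mem bal) -f_rows exy f_rows.
  have [xw|xw] := boolP (x \in unzip2 w); last by rewrite -(f_out x xw) exy f_out // -xy.
  have := f_in _ xw; rewrite exy => yxw.
  have {}xy : y \in unzip2 w by rewrite -xy.
  exact: uniq_step_inj uw yxw (f_in _ xy).
exists (perm f_inj) => J; split.
  by apply/subsetP => x; rewrite !inE permE (perm_mem bal); apply: contraR => /f_out->.
apply: uniq_perm => [||[x y]].
- exact: map_uniq (perm_word_uniq J _).
- exact: map_uniq uw.
rewrite mem_perm_word inE permE (perm_mem bal); apply/andP/idP => [[yw /eqP->]|xyw].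
  exact: f_in.
have yw : y \in unzip2 w by apply/mapP; exists (x, y).
split=> //; apply/eqP.
have ltq : (index (x, y) w < size w)%N by rewrite index_mem.
have iy : index y (unzip2 w) = index (x, y) w.
  have {1}-> : y = nth y (unzip2 w) (index (x, y) w).
    by rewrite (nth_map (x, y)) // nth_index.
  by rewrite index_uniq ?size_map.
by rewrite /f iy (set_nth_default (x, y)) // nth_index.
Qed.

(** The orbits of [s] are the height sets of the cycles in [T] and the single points outside [J], so
    [s] has the parity of [#|J| - #|T|]. *)
Lemma perm_word_sign (S : nzRingType) V T s (J := cycles_support T) :
  T \subset minimal_cycles u V -> perm_on J s ->
  perm_eq (perm_word J s) (cycle_word u T) ->
  (-1) ^+ (s + #|J|) = (-1) ^+ #|T| :> S.
Proof.
move=> TM sJ eqw.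
have s_step i a b : i \in T -> (a, b) \in u i -> s b = a.
  move=> iT ab; have : (a, b) \in perm_word J s.
    by rewrite (perm_mem eqw); apply/mem_flatten_cycles; exists i; rewrite ?mem_enum.
  by rewrite mem_perm_word => /andP[_ /eqP->].
have orbit_cycle i x : i \in T -> x \in heights (u i) -> porbit s x = heights (u i).
  move=> iT; rewrite mem_heights => xi; apply/setP => y; rewrite mem_heights.
  apply/porbitP/idP => [[q ->]|yi].
    elim: q => [|q IH]; first by rewrite expg0 perm1.
    rewrite expgSr permM; have := IH.
    rewrite (perm_mem (cycle_unzip2 (cyc_u i))) => /mapP[[a b] ab /= ->].
    by rewrite (s_step i a b iT ab); apply/mem_unzip1; exists b.
  apply/porbitP; apply: (cycle_closed (P := mem (porbit s x)) (cyc_u i) _ xi yi).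
    move=> a b ab; rewrite /= -!eq_porbit_mem => /eqP <-.
    by rewrite -(s_step i a b iT ab) -[s b]/((s ^+ 1)%g b) porbit_perm.
  exact: porbit_id.
have orbit_out x : x \notin J -> porbit s x = [set x].
  move=> xJ; apply/setP => y; rewrite inE; apply/porbitP/eqP => [[q ->]|->].
    by elim: q => [|q IH]; rewrite ?expg0 ?perm1 // expgSr permM IH (out_perm sJ).
  by exists 0%N; rewrite expg0 perm1.
have ne i : exists x, x \in heights (u i).
  have := cycle_neq0 (cyc_u i); case: (u i) => // a c _; exists a.1.
  by rewrite mem_heights inE eqxx.
have orbits : porbits s = [set heights (u i) | i in T] :|: [set [set x] | x in ~: J].
  apply/setP => B; apply/imsetP/setUP => [[x _ ->]|[/imsetP[i iT ->]|/imsetP[x]]].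
  - have [/bigcupP[i iT xi]|xJ] := boolP (x \in J).
      by left; rewrite (orbit_cycle i x iT xi); apply: imset_f.
    by right; rewrite (orbit_out x xJ); apply: imset_f; rewrite inE.
  - by have [x xi] := ne i; exists x => //; rewrite (orbit_cycle i x).
  by rewrite inE => xJ ->; exists x => //; rewrite orbit_out.
have cardT : #|[set heights (u i) | i in T]| = #|T|.
  rewrite card_in_imset // => i j iT jT eqH; apply/eqP/contraT => neq_ij.
  have := minimal_cycles_disjoint (subsetP TM i iT) (subsetP TM j jT) neq_ij.
  by have [x xi] := ne i => /disjointFr /(_ xi); rewrite -eqH xi.
have cardJ : #|[set [set x] | x in ~: J]| = #|~: J| by rewrite card_imset //; apply: set1_inj.
have disj : [set heights (u i) | i in T] :&: [set [set x] | x in ~: J] = set0.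
  apply/setP => B; rewrite !inE; apply/negP => /andP[/imsetP[i iT ->] /imsetP[x]].
  rewrite inE => xJ eqH; case/negP: xJ; apply/bigcupP; exists i => //.
  by rewrite eqH inE.
have : #|porbits s| = (#|T| + #|~: J|)%N.
  by rewrite orbits cardsU disj cards0 subn0 cardT cardJ.
move=> card_orbits; rewrite -signr_odd -[RHS]signr_odd oddD oddb.
rewrite /odd_perm card_orbits -(cardsC J) !oddD.
by case: (odd _); case: (odd _); case: (odd _).
Qed.

(** A term of the determinant that divides the product on the left comes from exactly one set [T] of
    minimal cycles, and cancelling it leaves the product of the remaining cycles. *)
Theorem class_coef_cdetM (K : fieldType) (R : {set 'I_m})
    (F : ncseries K ('I_m * 'I_m)%type) V :
  class_coef (cdet (1%:M - cols_mx K R) * F) (cycle_word u V) =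
  \sum_(T : {set 'I_k} | (T \subset minimal_cycles u V) && (cycles_support T \subset R))
    (-1) ^+ #|T| * class_coef F (cycle_word u (V :\: T)).
Proof.
rewrite cdet_cols_mx mulr_suml class_coef_sum.
pose P (Js : {set 'I_m} * 'S_m) := (Js.1 \subset R) && perm_on Js.1 Js.2.
pose tau (J : {set 'I_m}) := [set i in minimal_cycles u V | heights (u i) \subset J].
pose good (Js : {set 'I_m} * 'S_m) := (Js.1 == cycles_support (tau Js.1)) &&
  perm_eq (perm_word Js.1 Js.2) (cycle_word u (tau Js.1)).
rewrite (bigID good) /= [X in _ + X]big1 ?addr0; last first.
  move=> [J s] /= /andP[/andP[JR sJ] bad]; rewrite -scalerAl class_coefZ.
  have [->|nz] := eqVneq (class_coef (\prod_(x <- perm_word J s) ncvar K x * F) (cycle_word u V)) 0.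
    by rewrite mulr0.
  have [v rows] := class_coef_word_neq0 nz.
  have [eJ eqw] := perm_word_cycles sJ rows.
  by case/negP: bad; rewrite /good /= -eJ eqxx.
rewrite (partition_big (fun Js => tau Js.1) (fun T =>
  (T \subset minimal_cycles u V) && (cycles_support T \subset R))) /=; last first.
  move=> [J s] /= /andP[/andP[JR _] /andP[/eqP <- _]]; rewrite JR andbT.
  by apply/subsetP => i; case/setIdP.
apply: eq_bigr => T /andP[TM TR].
have uT := cycle_word_uniq cyc_u TM.
have [s] := perm_word_exists uT (cycle_word_unzip2 cyc_u T).
have -> : [set x in unzip1 (cycle_word u T)] = cycles_support T.
  by apply/setP => x; rewrite inE mem_cycles_support.
move=> [sJ eqw]; have tauT : tau (cycles_support T) = T.
  apply/setP => i; rewrite inE; apply/andP/idP => [[iM /subsetP iT]|iT]; last first.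
    by split; [apply: (subsetP TM)|apply: bigcup_sup].
  have := cycle_neq0 (cyc_u i); case eu : (u i) => [//|a c] _.
  have ai : a.1 \in heights (u i) by rewrite eu mem_heights inE eqxx.
  have /bigcupP[j jT aj] := iT _ ai.
  have [->//|neq_ij] := eqVneq i j.
  have := minimal_cycles_disjoint iM (subsetP TM j jT) neq_ij.
  by move=> /disjointFr /(_ ai); rewrite aj.
rewrite (big_pred1 (cycles_support T, s)) => [|[J s'] /=]; last first.
  apply/andP/eqP => [[/andP[/andP[_ s'J] /andP[/eqP eJ eqw']] /eqP eT]|[-> ->]]; last first.
    by rewrite /good /= tauT TR sJ !eqxx.
  rewrite /= in eJ eT eqw' s'J; rewrite eT in eJ eqw'; subst J; congr (_, _).
  by apply: (perm_word_inj s'J sJ); apply: perm_trans eqw' _; rewrite perm_sym.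
rewrite -scalerAl class_coefZ /= (perm_word_sign K TM sJ eqw); congr (_ * _).
rewrite -[RHS](class_coef_word_cat (perm_word (cycles_support T) s)).
apply: class_coef_same_rows; apply: (same_rows_trans (cycle_word_split TM)).
apply: same_rows_catr; rewrite same_rows_sym.
by apply: uniq_same_rows eqw; apply: perm_word_uniq.
Qed.

End MinimalCycles.

(** * The level recurrence *)

Section Levels.
Variables (k N : nat) (conc : rel 'I_k) (big : {set 'I_k}).
Implicit Types (V T : {set 'I_k}) (f : {ffun 'I_k -> 'I_N.+1}) (a : nat).

(* A function of levels encodes a factorization into N heaps all of whose
   maximal cycles are big: a cycle of level l > 0 lies in the l-th heap, one of
   level 0 is absent. *)
Definition levels_ok f :=
  [forall i : 'I_k, forall j : 'I_k,
     [&& (i < j)%N, conc i j, f i != ord0 & f j != ord0] ==> (f i <= f j)%N] &&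
  [forall i, (i \notin big) && (f i != ord0) ==>
     [exists j : 'I_k, [&& (i < j)%N, conc i j & f j == f i]]].

(** The levels in use are [a + 1, ..., N], so this counts for the exponent [N - a]; raising [a]
    lowers the exponent within a fixed codomain. *)
Definition levels V a : {set {ffun 'I_k -> 'I_N.+1}} :=
  [set f | levels_ok f && [forall i, if i \in V then (a < f i)%N else f i == ord0]].

Definition minimal_in V : {set 'I_k} := [set i : 'I_k in V |
  [forall j : 'I_k in V, (j < i)%N ==> ~~ conc j i]].

Lemma levels_okP f :
  reflect ((forall i j : 'I_k, (i < j)%N -> conc i j -> f i != ord0 -> f j != ord0 ->
              (f i <= f j)%N) /\
           (forall i, i \notin big -> f i != ord0 ->
              exists j : 'I_k, [/\ (i < j)%N, conc i j & f j = f i]))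
          (levels_ok f).
Proof.
apply: (iffP andP) => -[ok1 ok2]; split.
- move=> i j ltij cij fi fj; have /forallP/(_ i)/forallP/(_ j)/implyP := ok1.
  by apply; rewrite ltij cij fi.
- move=> i ib fi; have /forallP/(_ i)/implyP := ok2.
  by rewrite ib fi => /(_ isT)/existsP[j /and3P[ltij cij /eqP]]; exists j.
- by apply/forallP => i; apply/forallP => j; apply/implyP => /and4P[]; apply: ok1.
apply/forallP => i; apply/implyP => /andP[ib fi].
have [j [ltij cij e]] := ok2 i ib fi.
by apply/existsP; exists j; rewrite ltij cij e eqxx.
Qed.

Lemma levels_top V : levels V N = if V == set0 then [set [ffun=> ord0]] else set0.
Proof.
apply/setP => f; rewrite inE; case: eqP => [->|/eqP/set0Pn[i iV]].
  rewrite inE; apply/andP/eqP => [[_ /forallP f0]|->].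
    by apply/ffunP => i; have := f0 i; rewrite inE ffunE => /eqP.
  split; last by apply/forallP => i; rewrite inE ffunE.
  by apply/levels_okP; split=> [i j _ _|i _]; rewrite !ffunE.
rewrite inE; apply/negP => /andP[_ /forallP/(_ i)]; rewrite iV.
by rewrite ltnNge -ltnS ltn_ord.
Qed.

Section Toggle.
Variables (V : {set 'I_k}) (a : nat).
Hypothesis ltaN : (a < N)%N.
Local Notation M := (minimal_in V).
Let a1 : 'I_N.+1 := inord a.+1.
Let a1E : a1 = a.+1 :> nat. Proof. by rewrite inordK. Qed.

Definition absent f := [set i in V | f i == ord0].

(** A pair of a set [T] of minimal elements and a level function on [V :\: T] is encoded by the
    level function alone, with [T] recovered as [absent f]. *)
Definition partial_levels (b : nat) := [set f |
  [&& levels_ok f, absent f \subset M &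
      [forall i, if i \in V then (f i == ord0) || (b < f i)%N else f i == ord0]]].

Lemma sum_levels (P : pred {set 'I_k}) (b : nat) :
  \sum_(T : {set 'I_k} | (T \subset M) && P T) (-1) ^+ #|T| * (#|levels (V :\: T) b|)%:R
  = \sum_(f in partial_levels b | P (absent f)) (-1) ^+ #|absent f| :> int.
Proof.
rewrite (partition_big absent (fun T => (T \subset M) && P T)) /=; last first.
  by move=> f /andP[]; rewrite inE => /and3P[_ -> _] ->.
apply: eq_bigr => T /andP[TM PT].
rewrite (eq_bigr (fun=> (-1) ^+ #|T|)) => [|f /andP[_ /eqP->]//].
rewrite sumr_const -[RHS]mulr_natr; congr (_ * _%:R); apply: eq_card => f.
rewrite [RHS]unfold_in /= !inE; apply/andP/idP.
  move=> [ok /forallP fV].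
  have absT : absent f = T.
    apply/setP => i; rewrite inE; have := fV i; rewrite inE.
    case: (boolP (i \in T)) => /= iT; last by case: (i \in V) => //=; case: eqP => [->|].
    by move=> ->; have /subsetP/(_ i iT) := TM; rewrite inE => /andP[->].
  rewrite ok absT TM PT eqxx !andbT /=; apply/forallP => i; have := fV i.
  by rewrite inE; case: (i \in V); case: (i \in T) => //= ->; rewrite ?orbT.
move=> /andP[/andP[/and3P[ok _ /forallP fV] _] /eqP <-]; rewrite ok; split=> //.
by apply/forallP => i; have := fV i; rewrite !inE; case: (i \in V) => //=; case: eqP.
Qed.

(** Minimal cycles that can be put at level [a + 1] or made absent without breaking [levels_ok]:
    nothing earlier in [V] meets them, [a + 1] is the lowest level in use, and at that level they
    are big or have a later meeting cycle. *)
Definition togglable f : {set 'I_k} := [set x : 'I_k in M | ((f x == ord0) || (f x == a1)) &&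
  ((x \in big) || [exists y : 'I_k, [&& y \in V, (x < y)%N, conc x y & f y == a1]])].

Definition toggle f :=
  if [pick x in togglable f] is Some x then
    [ffun i => if i == x then (if f x == ord0 then a1 else ord0) else f i]
  else f.

Lemma minimal_inP i j : i \in M -> j \in V -> (j < i)%N -> ~~ conc j i.
Proof. by rewrite inE => /andP[_ /forall_inP mi] /mi /implyP; apply. Qed.

Let a1_neq0 : a1 != ord0. Proof. by rewrite -val_eqE /= a1E. Qed.

(** Being togglable depends on the cycle's own level and on later cycles that meet it; the updated
    cycle is minimal and meets no earlier one. So [toggle] picks the same cycle again, which makes
    it an involution. *)
Lemma togglable_update f x v : x \in togglable f -> (v == ord0) || (v == a1) ->
  togglable [ffun i => if i == x then v else f i] = togglable f.
Proof.
rewrite inE => /andP[xM /andP[fx _]] vx; apply/setP => z; rewrite inE [RHS]inE.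
apply: andb_id2l => zM; rewrite ffunE; congr (_ && (_ || _)).
  by have [->|//] := eqVneq z x; rewrite vx fx.
apply: eq_existsb => y; rewrite ffunE; have [->|//] := eqVneq y x.
case: (ltnP z x) => [ltzx|]; last by rewrite andbF.
have zV : z \in V by case/setIdP: zM.
by rewrite (negbTE (minimal_inP xM zV ltzx)) !andbF.
Qed.

Lemma togglable_toggle f : togglable (toggle f) = togglable f.
Proof.
rewrite /toggle; case: pickP => [x xt|//]; apply: togglable_update => //.
by case: (f x == ord0); rewrite eqxx ?orbT.
Qed.

Lemma toggleK : involutive toggle.
Proof.
move=> f; have tt := togglable_toggle f.
rewrite {1}/toggle (eq_pick (Q := mem (togglable f))) => [|x]; last by rewrite /= tt.
rewrite {2 3}/toggle /toggle; case: pickP => [x xt|//].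
apply/ffunP => i; rewrite !ffunE eqxx; case: eqP => // ->.
move: xt; rewrite /= inE => /andP[_ /andP[fx _]].
have [e0|n0] := eqVneq (f x) ord0; first by rewrite (negbTE a1_neq0) e0.
by rewrite eqxx; move: fx; rewrite (negbTE n0) /= => /eqP->.
Qed.

Lemma toggle_partial_levels f :
  f \in partial_levels a -> toggle f \in partial_levels a.
Proof.
rewrite /toggle; case: pickP => [x|//]; rewrite /= inE => /andP[xM /andP[fx tx]].
rewrite !inE => /and3P[/levels_okP[ok1 ok2] /subsetP absM /forallP fV].
set g := [ffun i => _].
have xV : x \in V by case/setIdP: xM.
have gx : (g x == ord0) || (g x == a1).
  by rewrite ffunE eqxx; case: (f x == ord0); rewrite eqxx ?orbT.
have gE i : i != x -> g i = f i by move=> /negPf neq; rewrite ffunE neq.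
have inV i : f i != ord0 -> i \in V.
  by have := fV i; case: (i \in V) => // /eqP->.
have ginV i : g i != ord0 -> i \in V.
  by have [->|neq] := eqVneq i x; rewrite // gE //; apply: inV.
have above i : g i != ord0 -> (a1 <= g i)%N.
  have [->|neq] := eqVneq i x; first by case/orP: gx => /eqP-> //; rewrite eqxx.
  move=> gi; have := fV i; rewrite ginV // -(gE i neq) (negbTE gi) /=.
  by rewrite a1E.
have nothing_below (i : 'I_k) : (i < x)%N -> conc i x -> g i == ord0.
  move=> ltix cix; rewrite -[_ == _]negbK; apply/negP => /ginV iV.
  by have := minimal_inP xM iV ltix; rewrite cix.
apply/and3P; split.
- apply/levels_okP; split=> [i j ltij cij gi gj|i ib gi].
    have [ej|nj] := eqVneq j x.
      by move: gi; rewrite (eqP (nothing_below i _ _)) -?ej.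
    have [ei|ni] := eqVneq i x.
      rewrite ei in gi *; move: gx; rewrite (negbTE gi) => /eqP->.
      exact: above.
    by move: gi gj; rewrite !gE //; apply: ok1.
  have [ei|ni] := eqVneq i x.
    rewrite ei in ib gi *; move: gx; rewrite (negbTE gi) => /eqP->.
    move: tx; rewrite (negbTE ib) => /existsP[y /and4P[yV ltxy cxy /eqP fy]].
    by exists y; rewrite gE // -val_eqE /= gtn_eqF.
  rewrite gE // in gi *; have [j [ltij cij fj]] := ok2 i ib gi.
  exists j; split=> //; rewrite gE //; apply/eqP => ej.
  by have := nothing_below i; rewrite -ej gE // (negbTE gi) => /(_ ltij cij).
- apply/subsetP => i; rewrite inE; have [->//|ni] := eqVneq i x.
  by rewrite gE // => iabs; apply: absM; rewrite inE.
apply/forallP => i; have [->|ni] := eqVneq i x.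
  by rewrite xV; case/orP: gx => /eqP->; rewrite ?eqxx // a1E ltnSn orbT.
by rewrite gE.
Qed.

Lemma toggle_sign f : togglable f != set0 ->
  (-1) ^+ #|absent (toggle f)| = - (-1) ^+ #|absent f| :> int.
Proof.
rewrite /toggle => /set0Pn[z zt]; case: pickP => [x|/(_ z)]; last by rewrite /= zt.
rewrite /= inE => /andP[xM _]; have xV : x \in V by case/setIdP: xM.
set g := [ffun i => _].
have same : absent g :\ x = absent f :\ x.
  by apply/setP => i; rewrite !inE ffunE; case: eqP.
rewrite (cardsD1 x (absent g)) (cardsD1 x (absent f)) same !inE xV ffunE eqxx /=.
have [_|_] := eqVneq (f x) ord0; first by rewrite (negbTE a1_neq0) exprS mulN1r opprK.
by rewrite eqxx exprS mulN1r.
Qed.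

(** The fixed points are the terms on the right of the recurrence. If nothing is togglable, no big
    cycle is absent, and no cycle has level [a + 1]: the first such cycle would either be minimal,
    hence togglable, or meet an earlier one, itself at level [a + 1] or absent and togglable because
    of it. *)
Lemma togglable_eq0 f : f \in partial_levels a ->
  (togglable f == set0) =
  (f \in partial_levels a.+1) && (absent f \subset ~: big).
Proof.
rewrite !inE => /and3P[ok absM /forallP fV]; rewrite ok absM /=.
have [ok1 ok2] := levels_okP f ok.
apply/eqP/andP => [tog0|[/forallP f1 /subsetP absS]]; last first.
  apply/setP => x; rewrite in_set0 inE; apply/negP => /andP[xM /andP[fx tx]].
  have xV : x \in V by case/setIdP: xM.
  have not1 y : y \in V -> f y != a1.
    move=> yV; have := f1 y; rewrite yV; case/orP => [/eqP->|lt].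
      by rewrite eq_sym.
    by rewrite -val_eqE /= a1E gtn_eqF.
  move: fx; rewrite (negbTE (not1 x xV)) orbF => fx.
  have := absS x; rewrite inE xV fx inE => /(_ isT) xb.
  move: tx; rewrite (negbTE xb) => /existsP[y /and4P[yV _ _]].
  by rewrite (negbTE (not1 y yV)).
have absS : absent f \subset ~: big.
  apply/subsetP => x xabs; rewrite inE; apply/negP => xb.
  have xM := subsetP absM x xabs; move: xabs; rewrite inE => /andP[xV fx].
  by have : x \in togglable f; [rewrite inE xM fx xb | rewrite tog0 inE].
split=> //; apply/forallP => i; have := fV i; case: ifP => // iV.
case/orP => [->//|lt_a]; apply/orP; right.
rewrite ltn_neqAle lt_a andbT; apply/eqP => e1.
have {}e1 : f i = a1 by apply: val_inj; rewrite /= a1E.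
suff : forall i, i \in V -> f i != a1 by move=> /(_ i iV); rewrite e1 eqxx.
move=> {lt_a iV e1}j; have [q] := ubnP (val j); elim: q j => // q IH j ltjq jV.
apply/eqP => fj.
have [jM|] := boolP (j \in M).
  suff : j \in togglable f by rewrite tog0 inE.
  rewrite inE jM fj eqxx orbT /=; have [//|jb] := boolP (j \in big).
  have [y [ltjy cjy fy]] := ok2 j jb (etrans (congr1 (fun v => v != ord0) fj) a1_neq0).
  apply/existsP; exists y; rewrite ltjy cjy fy fj eqxx /= andbT.
  by have := fV y; rewrite fy fj; case: (y \in V) => //; rewrite (negbTE a1_neq0).
rewrite inE jV /= => /forall_inPn[x xV]; rewrite negb_imply negbK => /andP[ltxj cxj].
have fx1 := IH x (leq_trans ltxj ltjq) xV.
have [fx0|fx0] := eqVneq (f x) ord0.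
  have xM : x \in M by apply: (subsetP absM); rewrite inE xV fx0 eqxx.
  suff : x \in togglable f by rewrite tog0 inE.
  rewrite inE xM fx0 eqxx /=; apply/orP; right; apply/existsP; exists j.
  by rewrite jV ltxj cxj fj eqxx.
have := ok1 x j ltxj cxj fx0; rewrite fj => /(_ a1_neq0); rewrite a1E leq_eqVlt.
have := fV x; rewrite xV (negbTE fx0) /= => lt_a.
rewrite [(_ < _)%N]ltnNge lt_a orbF => /eqP e; case/eqP: fx1.
by apply: val_inj; rewrite /= a1E.
Qed.

Theorem levels_recurrence :
  \sum_(T : {set 'I_k} | T \subset M) (-1) ^+ #|T| * (#|levels (V :\: T) a|)%:R =
  \sum_(T : {set 'I_k} | (T \subset M) && (T \subset ~: big))
     (-1) ^+ #|T| * (#|levels (V :\: T) a.+1|)%:R :> int.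
Proof.
have := sum_levels xpredT a; under eq_bigl do rewrite andbT.
move=> ->; rewrite sum_levels; under eq_bigl do rewrite andbT.
rewrite (bigID (fun f => togglable f == set0)) /= [X in _ + X](_ : _ = 0) ?addr0.
  apply: eq_bigl => f; have [fa|fa] := boolP (f \in partial_levels a).
    by rewrite togglable_eq0.
  symmetry; apply/negP => /andP[f1 _]; case/negP: fa; move: f1; rewrite !inE.
  move=> /and3P[-> -> /forallP fV]; apply/forallP => i; have := fV i.
  by case: (i \in V) => //= /orP[->//|/ltnW->]; rewrite orbT.
set S := \sum_(f in _ | _) _; suff : S = - S.
  move=> e; have : S *+ 2 == 0 by rewrite mulr2n {1}e addNr.
  by rewrite mulrn_eq0 => /eqP.
rewrite {1}/S (reindex_inj (inv_inj toggleK)) /= -sumrN; apply: eq_big => f.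
  rewrite togglable_toggle; congr (_ && _); apply/idP/idP; last exact: toggle_partial_levels.
  by rewrite -{2}(toggleK f); apply: toggle_partial_levels.
by rewrite togglable_toggle => /andP[_]; apply: toggle_sign.
Qed.

End Toggle.
End Levels.

(** * Coefficients of the powers from the level recurrence *)

Section PowersOfQuotient.
Variables (K : fieldType) (m n : nat).
Local Notation step := ('I_m * 'I_m)%type.
Local Notation series := (ncseries K step).
Local Notation small := [set h : 'I_m | (h < n)%N].
Local Notation det_all := (cdet (1%:M - cols_mx K [set: 'I_m])).
Local Notation det_small := (cdet (1%:M - cols_mx K small)).
Variable F : nat -> series.
Hypothesis F0 : F 0%N = 1.
Hypothesis FS : forall r, det_all * F r.+1 = det_small * F r.

Definition balanced (w : seq step) := perm_eq (unzip1 w) (unzip2 w).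

Lemma balanced_cat v w : balanced v -> balanced (v ++ w) = balanced w.
Proof.
move=> bv; rewrite /balanced /unzip1 /unzip2 !map_cat.
by rewrite (permPl (perm_cat bv (perm_refl (map fst w)))) perm_cat2l.
Qed.

Lemma balanced_same_rows v w : same_rows v w -> balanced v = balanced w.
Proof.
move=> /same_rows_perm vw; rewrite /balanced.
by rewrite (permPl (perm_map fst vw)) (permPr (perm_map snd vw)).
Qed.

Lemma balanced_perm_word (J : {set 'I_m}) (s : 'S_m) : perm_on J s -> balanced (perm_word J s).
Proof.
move=> sJ; rewrite /balanced; apply: uniq_perm; first exact: perm_word_uniq.
  by rewrite /unzip2 -map_comp map_id enum_uniq.
move=> x; rewrite /unzip1 /unzip2 -!map_comp map_id mem_enum.
apply/mapP/idP => [[y]|xJ]; first by rewrite mem_enum /= => yJ ->; rewrite perm_closed.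
exists (s^-1%g x); last by rewrite /= permKV.
by rewrite mem_enum perm_wordV.
Qed.

(** The words of the determinant are balanced, so cancelling a nonempty one leaves a shorter
    unbalanced word; only the term 1 of the determinant survives. *)
Lemma class_coef_cdetM_unbalanced (R : {set 'I_m}) (G : series) w : ~~ balanced w ->
  (forall v, ~~ balanced v -> (size v < size w)%N -> class_coef G v = 0) ->
  class_coef (cdet (1%:M - cols_mx K R) * G) w = class_coef G w.
Proof.
move=> nbw G0; rewrite cdet_cols_mx mulr_suml class_coef_sum.
rewrite (bigD1 (set0, 1%g)) /=; last by rewrite sub0set perm_on1.
rewrite [X in _ + X]big1 ?addr0.
  by rewrite cards0 odd_perm1 expr0 scale1r /perm_word enum_set0 big_nil mul1r.
move=> [J s] /= /andP[/andP[_ sJ] neq]; rewrite -scalerAl class_coefZ.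
have [->|nz] := eqVneq (class_coef (\prod_(x <- perm_word J s) ncvar K x * G) w) 0.
  by rewrite mulr0.
have [v rows] := class_coef_word_neq0 nz.
rewrite -(class_coef_same_rows _ rows) class_coef_word_cat G0 ?mulr0 //.
  by rewrite -(balanced_cat v (balanced_perm_word sJ)) (balanced_same_rows rows).
have /perm_size := same_rows_perm rows; rewrite size_cat size_map -cardE => <-.
have [J0|] := eqVneq J set0; last by rewrite -card_gt0 => J0; rewrite -{1}[size v]add0n ltn_add2r.
case/eqP: neq; congr (_, _) => //; apply/permP => x; rewrite perm1.
by rewrite (out_perm sJ) // J0 inE.
Qed.

Lemma class_coef_unbalanced r w : ~~ balanced w -> class_coef (F r) w = 0.
Proof.
elim: r w => [|r IHr] w.
  by rewrite F0 class_coef_one; case: w.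
have [q] := ubnP (size w); elim: q w => // q IHq w ltwq nbw.
rewrite -(class_coef_cdetM_unbalanced setT nbw) => [|v nbv ltv].
  by rewrite FS class_coef_cdetM_unbalanced ?IHr // => v nbv _; apply: IHr.
by apply: IHq => //; apply: (leq_trans ltv).
Qed.

Section CycleWord.
Variables (k : nat) (u : 'I_k -> seq step).
Hypothesis cyc_u : forall i, is_cycle (u i).

Definition meet_cycles : rel 'I_k :=
  fun i j => ~~ [disjoint heights (u i) & heights (u j)].
Definition big_set := [set i : 'I_k | [exists h in heights (u i), (n <= h)%N]].

Lemma minimal_cyclesE V : minimal_cycles u V = minimal_in meet_cycles V.
Proof.
apply/setP => i; rewrite !inE; congr (_ && _); apply: eq_forallb => j.
by rewrite /meet_cycles negbK.
Qed.

Lemma cycles_support_small (T : {set 'I_k}) :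
  (cycles_support u T \subset small) = (T \subset ~: big_set).
Proof.
apply/bigcupsP/subsetP => [h i iT|h i iT].
  rewrite !inE; apply/exists_inPn => x xi.
  by have := subsetP (h i iT) x xi; rewrite inE -ltnNge.
apply/subsetP => x xi; have := h i iT; rewrite !inE => /exists_inPn/(_ x xi).
by rewrite -ltnNge.
Qed.

(** Induction on [r], then on [#|V|]: both sides obey one relation, whose term [T = set0] on the
    left is the unknown, while the other terms have fewer cycles or a smaller exponent. *)
Theorem class_coef_levels (N r : nat) (V : {set 'I_k}) : (r <= N)%N ->
  class_coef (F r) (cycle_word u V) =
  (#|levels N meet_cycles big_set V (N - r)|)%:R.
Proof.
elim: r V => [|r IHr] V ler.
  rewrite F0 class_coef_one subn0 levels_top; case: (set_0Vmem V) => [->|[i iV]].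
    by rewrite eqxx cards1 /cycle_word enum_set0.
  have /negPf -> : V != set0 by apply/set0Pn; exists i.
  rewrite cards0; case: eqP => // e; have := cycle_neq0 (cyc_u i).
  case eu : (u i) => [//|x c] _; suff : x \in cycle_word u V by rewrite e.
  by apply/mem_flatten_cycles; exists i; rewrite ?mem_enum // eu inE eqxx.
have [q] := ubnP #|V|; elim: q V => // q IHq V ltVq.
have ltN : (N - r.+1 < N)%N by lia.
have eN : (N - r.+1).+1 = (N - r)%N by lia.
have := levels_recurrence meet_cycles big_set V ltN; rewrite eN.
move=> /(congr1 (intr : int -> K)); rewrite !rmorph_sum /=.
have term (T : {set 'I_k}) a :
    ((-1) ^+ #|T| * (#|levels N meet_cycles big_set (V :\: T) a|)%:R)%:~R =
    (-1) ^+ #|T| * (#|levels N meet_cycles big_set (V :\: T) a|)%:R :> K.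
  by rewrite rmorphM rmorphXn rmorphN rmorph1 /= rmorph_nat.
rewrite !(eq_bigr _ (fun T _ => term T _)).
have := congr1 (fun G => class_coef G (cycle_word u V)) (FS r).
rewrite !class_coef_cdetM // minimal_cyclesE.
rewrite [X in X = _ -> _](eq_bigl (fun T : {set 'I_k} =>
  T \subset minimal_in meet_cycles V)) => [|T]; last by rewrite finset.subsetT andbT.
rewrite [X in _ = X -> _](eq_bigl (fun T : {set 'I_k} =>
    (T \subset minimal_in meet_cycles V) && (T \subset ~: big_set))) => [|T]; last first.
  by rewrite cycles_support_small.
rewrite [X in _ = X -> _](eq_bigr (fun T : {set 'I_k} => (-1) ^+ #|T| *
    (#|levels N meet_cycles big_set (V :\: T) (N - r)|)%:R)) => [|T _]; last first.
  by rewrite IHr // ltnW.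
move=> <- /esym.
rewrite (bigD1 set0) ?sub0set //= [X in _ = X -> _](bigD1 set0) ?sub0set //=.
rewrite setD0 cards0 expr0 !mul1r => e.
have tails : \sum_(T : {set 'I_k} | (T \subset minimal_in meet_cycles V) && (T != set0))
      (-1) ^+ #|T| * class_coef (F r.+1) (cycle_word u (V :\: T)) =
    \sum_(T : {set 'I_k} | (T \subset minimal_in meet_cycles V) && (T != set0))
      (-1) ^+ #|T| * (#|levels N meet_cycles big_set (V :\: T) (N - r.+1)|)%:R.
  apply: eq_bigr => T /andP[/subsetP TM /set0Pn[i iT]]; rewrite IHq //.
  apply: leq_trans (ltVq : (#|V| <= q)%N); apply: proper_card; apply/properP.
  split; first exact: subsetDl.
  by exists i; [case/setIdP: (TM i iT) | rewrite inE iT].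
by move: e; rewrite tails; apply: addIr.
Qed.

End CycleWord.
End PowersOfQuotient.

(** * Levels and admissible permutations *)

Section SortingPermutation.
Variables (k : nat) (key : 'I_k -> nat).
Hypothesis key_inj : injective key.

Let rank (x : 'I_k) : nat := #|[set y | (key y < key x)%N]|.

Let rank_lt x y : (key x < key y)%N -> (rank x < rank y)%N.
Proof.
move=> ltxy; apply: proper_card; apply/properP; split.
  by apply/subsetP => z; rewrite !inE => ltzx; apply: ltn_trans ltxy.
by exists x; rewrite !inE ?ltnn.
Qed.

Let rank_bound x : (rank x < k)%N.
Proof.
rewrite -[X in (_ < X)%N]card_ord -cardsT; apply: proper_card; apply/properP.
by split; [apply: finset.subsetT | exists x; rewrite !inE ?ltnn].
Qed.

Let rank_sorted (pi : 'S_k) :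
  (forall p q : 'I_k, (p < q)%N -> (key (pi p) < key (pi q))%N) ->
  forall p, rank (pi p) = p.
Proof.
move=> srt p; rewrite /rank.
have -> : [set y | (key y < key (pi p))%N] = [set pi q | q in [set q : 'I_k | (q < p)%N]].
  apply/setP => y; rewrite inE; apply/idP/imsetP => [lty|[q]]; last first.
    by rewrite inE => ltqp ->; apply: srt.
  exists (pi^-1%g y); last by rewrite permKV.
  rewrite inE ltnNge leq_eqVlt; apply/negP => /orP[/eqP/val_inj e|ltp].
    by move: lty; rewrite e permKV ltnn.
  by have := srt _ _ ltp; rewrite permKV ltnNge ltnW.
rewrite card_imset; last exact: perm_inj.
have := cardsE [pred q : 'I_k | (q < p)%N] => ->.
rewrite -sum1_card (eq_bigl (fun q : 'I_k => (q < p)%N)) //.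
rewrite -(big_ord_widen k (fun _ => 1%N)) ?sum1_card ?card_ord //.
exact: ltnW.
Qed.

Lemma sorting_perm_exists :
  exists pi : 'S_k, forall p q : 'I_k, (p < q)%N -> (key (pi p) < key (pi q))%N.
Proof.
pose f x := Ordinal (rank_bound x).
have f_inj : injective f.
  move=> x y /(congr1 val) /= e; apply: key_inj; apply/eqP.
  rewrite -[_ == _]negbK neq_ltn negb_or; apply/andP; split; apply/negP => /rank_lt.
    by rewrite e ltnn.
  by rewrite e ltnn.
exists (perm f_inj)^-1%g => p q ltpq; rewrite ltnNge; apply/negP.
have fE r : rank ((perm f_inj)^-1%g r) = r.
  by have := permKV (perm f_inj) r; rewrite permE => /(congr1 val).
rewrite leq_eqVlt => /orP[/eqP/key_inj/perm_inj e|/rank_lt].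
  by rewrite e ltnn in ltpq.
by rewrite !fE ltnNge ltnW.
Qed.

Lemma sorting_perm_unique (pi pi' : 'S_k) :
  (forall p q : 'I_k, (p < q)%N -> (key (pi p) < key (pi q))%N) ->
  (forall p q : 'I_k, (p < q)%N -> (key (pi' p) < key (pi' q))%N) -> pi = pi'.
Proof.
move=> srt srt'; apply/permP => p; apply: key_inj; apply/eqP.
rewrite -[_ == _]negbK neq_ltn negb_or; apply/andP; split; apply/negP => /rank_lt;
by rewrite !rank_sorted // ltnn.
Qed.

End SortingPermutation.

(** * The admissible permutation attached to a level function *)

Section CompatibleLevels.
Variables (m n : nat) (us : seq (seq ('I_m * 'I_m))) (N : nat).
Local Notation k := (size us).
Local Notation u := (fun i : 'I_k => nth [::] us i).
Local Notation big := (big_cycles n us).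
Local Notation meet := (meet_cycles u).
Hypothesis cyc_u : forall i : 'I_k, is_cycle (u i).
Implicit Types (pi : 'S_k) (f : {ffun 'I_k -> 'I_N.+1}) (p q j x y z : 'I_k).

Lemma meet_sym x y : meet x y = meet y x.
Proof. by rewrite /meet_cycles disjoint_sym. Qed.

(** The analogue of compatibility for P-partitions; the last clause forces the level to increase
    strictly at each descent of the big subword. *)
Definition compatible pi f :=
  [&& [forall p : 'I_k, forall q : 'I_k, (p <= q)%N ==> (f (pi p) <= f (pi q))%N],
      [forall p : 'I_k, forall q : 'I_k, first_big_from n pi p q ==> (f (pi p) == f (pi q))] &
      [forall p : 'I_k, forall q : 'I_k,
         [&& (p < q)%N, pi p \in big, pi q \in big & f (pi p) == f (pi q)] ==>
         (pi p < pi q)%N]].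

Lemma compatibleP pi f : reflect
  [/\ forall p q, (p <= q)%N -> (f (pi p) <= f (pi q))%N,
      forall p q, first_big_from n pi p q -> f (pi p) = f (pi q) &
      forall p q, (p < q)%N -> pi p \in big -> pi q \in big -> f (pi p) = f (pi q) ->
        (pi p < pi q)%N]
  (compatible pi f).
Proof.
apply: (iffP and3P) => -[c1 c2 c3]; split.
- by move=> p q; have /forallP/(_ p)/forallP/(_ q)/implyP := c1.
- by move=> p q fb; have /forallP/(_ p)/forallP/(_ q)/implyP/(_ fb)/eqP := c2.
- move=> p q ltpq pb qb e; have /forallP/(_ p)/forallP/(_ q)/implyP := c3.
  by apply; rewrite ltpq pb qb e eqxx.
- by apply/forallP => p; apply/forallP => q; apply/implyP; apply: c1.
- by apply/forallP => p; apply/forallP => q; apply/implyP => /c2->.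
apply/forallP => p; apply/forallP => q; apply/implyP => /and4P[ltpq pb qb /eqP].
exact: c3.
Qed.

Lemma first_big_fromP pi p (j : 'I_k) : reflect
  [/\ (p <= j)%N, pi j \in big & forall q, (p <= q)%N -> pi q \in big -> (j <= q)%N]
  (first_big_from n pi p j).
Proof.
apply: (iffP and3P) => -[lepj jb minj]; split=> //.
  move=> q lepq qb; have /forallP/(_ q)/implyP := minj.
  by apply; rewrite lepq.
by apply/forallP => q; apply/implyP => /andP[]; apply: minj.
Qed.

Lemma admissibleP pi : reflect
  [/\ forall p q, (p < q)%N -> meet (pi p) (pi q) -> (pi p < pi q)%N,
      forall p, exists j : 'I_k, first_big_from n pi p j,
      forall p (j : 'I_k), first_big_from n pi p j -> (p < j)%N ->
        exists q : 'I_k, [/\ (p < q)%N, (q <= j)%N & meet (pi p) (pi q)] &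
      forall p q, q = p.+1 :> nat -> pi p \notin big -> (pi p < pi q)%N]
  (admissible n pi).
Proof.
apply: (iffP and4P) => -[a1 a2 a3 a4]; split.
- move=> p q ltpq mpq; rewrite ltn_neqAle val_eqE (inj_eq perm_inj) -val_eqE ltn_eqF //=.
  rewrite leqNgt; apply: contra mpq => ltqp.
  by have /forallP/(_ p)/forallP/(_ q)/implyP := a1; apply; rewrite ltpq.
- move=> p; have /forallP/(_ p)/existsP[j0 j0P] := a2.
  have [j /andP[lepj jb] minj] := @arg_minnP _ j0
    (fun j : 'I_k => (p <= j)%N && (pi j \in big)) (fun j : 'I_k => j : nat) j0P.
  exists j; apply/first_big_fromP; split=> // q lepq qb.
  by apply: minj; rewrite lepq.
- move=> p j fb ltpj; have /forallP/(_ p)/forallP/(_ j)/implyP := a3.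
  by rewrite fb ltpj => /(_ isT)/existsP[q /andP[/andP[ltpq leqj] mpq]]; exists q.
- move=> p q qE pb; have ltpq : (p < q)%N by rewrite qE.
  rewrite ltn_neqAle val_eqE (inj_eq perm_inj) -val_eqE ltn_eqF //=.
  rewrite leqNgt; apply: contra pb => ltqp.
  by have /forallP/(_ p)/forallP/(_ q)/implyP := a4; apply; rewrite qE eqxx.
- apply/forallP => p; apply/forallP => q; apply/implyP => /andP[ltpq ltqp].
  rewrite -[disjoint_cycles _ _]negbK; apply/negP => mpq.
  by have := a1 p q ltpq mpq; rewrite ltnNge ltnW.
- apply/forallP => p; have [j /first_big_fromP[lepj jb _]] := a2 p.
  by apply/existsP; exists j; rewrite lepj.
- apply/forallP => p; apply/forallP => j; apply/implyP => /andP[fb ltpj].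
  have [q [ltpq leqj mpq]] := a3 p j fb ltpj.
  by apply/existsP; exists q; rewrite ltpq leqj.
apply/forallP => p; apply/forallP => q; apply/implyP => /andP[/eqP qE ltqp].
apply: contraTT ltqp => pb; rewrite -leqNgt ltnW //; exact: a4.
Qed.

Section Key.
Variable f : {ffun 'I_k -> 'I_N.+1}.
Hypothesis okf : levels_ok meet big f.
Hypothesis f_gt0 : forall x, f x != ord0.

Let e : rel 'I_k := [rel x y : 'I_k | [&& (x < y)%N, meet x y & f x == f y]].

Let eI x y : (x < y)%N -> meet x y -> f x = f y -> e x y.
Proof. by move=> ltxy mxy fxy; apply/and3P; split=> //; apply/eqP. Qed.

Let connect_ind (P : rel 'I_k) x y : connect e x y ->
  (forall z, P z z) -> (forall a b c, e a b -> connect e b c -> P b c -> P a c) -> P x y.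
Proof.
move=> /connectP[s es ->] P0 PS; elim: s x es => [|z s IH] x //= /andP[exz es].
by apply: (PS x z) => //; [apply/connectP; exists s | apply: IH].
Qed.

Let connect_le x y : connect e x y -> (x <= y)%N && (f x == f y).
Proof.
move=> /(connect_ind (P := fun x y => (x <= y)%N && (f x == f y))); apply=> [z|a b c].
  by rewrite leqnn eqxx.
by move=> /and3P[ltab _ /eqP-> ] _ /andP[lebc ->]; rewrite (leq_trans (ltnW ltab)).
Qed.

(** The later cycles granted by [levels_ok] have increasing labels, so following them must stop, and
    it can stop only at a big cycle. *)
Let reach_big x : exists y, (y \in big) && connect e x y.
Proof.
have [okf1 okf2] := levels_okP _ _ _ okf.
have [q] := ubnP (k - x); elim: q x => // q IH x ltxq.
have [xb|xb] := boolP (x \in big); first by exists x; rewrite xb connect0.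
have [y [ltxy mxy fy]] := okf2 x xb (f_gt0 x).
have [|z /andP[zb yz]] := IH y; first by have := ltn_ord y; lia.
exists z; rewrite zb; apply: connect_trans yz; apply: connect1.
exact: eI.
Qed.

(** The big letter that will end the block of [x] in the permutation. *)
Let B x : 'I_k := [arg min_(y < xchoose (reach_big x) | (y \in big) && connect e x y) (y : nat)].

Let B_spec x : [/\ B x \in big, connect e x (B x) &
  forall y, y \in big -> connect e x y -> (B x <= y)%N].
Proof.
rewrite /B; case: arg_minnP; first exact: (xchooseP (reach_big x)).
by move=> y /andP[yb xy] miny; split=> // z zb xz; apply: miny; rewrite zb.
Qed.

Let f_B x : f (B x) = f x.
Proof. by have [_ /connect_le/andP[_ /eqP]] := B_spec x. Qed.

Let le_B x : (x <= B x)%N.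
Proof. by have [_ /connect_le/andP[]] := B_spec x. Qed.

Let B_mono x y : connect e x y -> (B x <= B y)%N.
Proof.
move=> xy; have [_ _ minx] := B_spec x; have [yb yBy _] := B_spec y.
by apply: minx => //; apply: connect_trans yBy.
Qed.

Let B_big x : x \in big -> B x = x.
Proof.
move=> xb; apply/val_inj/eqP; rewrite eqn_leq le_B andbT.
by have [_ _] := B_spec x; apply; rewrite ?connect0.
Qed.

Let B_idem x : B (B x) = B x.
Proof. by apply: B_big; have [] := B_spec x. Qed.

Let B_step x : x \notin big -> exists z, [/\ (x < z)%N, meet x z, f z = f x & connect e z (B x)].
Proof.
move=> xb; have [Bb + _] := B_spec x.
case/connectP=> -[|z s] /= es lasts; first by rewrite lasts (negbTE xb) in Bb.
move: es => /andP[/and3P[ltxz mxz /eqP fz] es]; exists z; split=> //.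
by apply/connectP; exists s.
Qed.

(** Lexicographic order on [(f x, B x, x)] in base [k]. *)
Let key x : nat := (f x * k + B x) * k + x.

Let keyE x y : (key x < key y)%N =
  (f x < f y)%N || ((f x == f y) && ((B x < B y)%N || ((B x == B y) && (x < y)%N))).
Proof.
have lex (a b c d : nat) : (c < k)%N -> (d < k)%N ->
    (a * k + c < b * k + d)%N = (a < b)%N || ((a == b) && (c < d)%N).
  move=> ltc ltd; have [ltab|ltba|->] := ltngtP a b => /=; last by rewrite ltn_add2l.
    have : (a.+1 * k <= b * k)%N by rewrite leq_mul2r ltab orbT.
    by rewrite mulSn; lia.
  have : (b.+1 * k <= a * k)%N by rewrite leq_mul2r ltba orbT.
  by rewrite mulSn; lia.
rewrite /key lex ?ltn_ord // lex ?ltn_ord // -!val_eqE /=.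
set P := (_ * k + _)%N; set Q := (_ * k + _)%N.
have -> : (P == Q) = (f x == f y :> nat) && (B x == B y :> nat).
  rewrite -[LHS]negbK neq_ltn negb_or !lex ?ltn_ord //.
  by case: ltngtP => //= _; case: ltngtP.
by case: ltngtP => //= _; case: ltngtP.
Qed.

Let key_inj : injective key.
Proof.
move=> x y exy; have : ~~ (key x < key y)%N by rewrite exy ltnn.
have : ~~ (key y < key x)%N by rewrite exy ltnn.
rewrite !keyE -!val_eqE /=; case: ltngtP => //= _; case: ltngtP => //= _.
by case: ltngtP => // /val_inj.
Qed.

(** In key order the cycles with given level and [B] form a block that ends with their big cycle,
    since [x <= B x]; conditions (2) to (4) are read inside a block. For (1), if a cycle meets a
    later one, its level is at most the later one's, and for equal levels its [B] is too. *)
Let sorted_admissible pi :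
  (forall p q, (p < q)%N -> (key (pi p) < key (pi q))%N) ->
  admissible n pi && compatible pi f.
Proof.
have [okf1 okf2] := levels_okP _ _ _ okf.
move=> srt; pose pos x := (pi^-1%g x).
have posK x : pi (pos x) = x by rewrite permKV.
have ltE p q : (p < q)%N = (key (pi p) < key (pi q))%N.
  apply/idP/idP; [exact: srt|rewrite ltnNge [in X in _ -> X]ltnNge].
  by apply: contra; rewrite leq_eqVlt => /orP[/eqP/val_inj->//|/srt/ltnW].
have leE p q : (p <= q)%N = (key (pi p) <= key (pi q))%N by rewrite leqNgt ltE -leqNgt.
have le_key_f x y : (key x <= key y)%N -> (f x <= f y)%N.
  by apply: contra_leq => lt; rewrite keyE lt.
have le_key_B x y : (key x <= key y)%N -> f x = f y -> (B x <= B y)%N.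
  by move=> + fxy; apply: contra_leq => lt; rewrite keyE fxy eqxx lt orbT.
have le_key_lab x y : (key x <= key y)%N -> f x = f y -> B x = B y -> (x <= y)%N.
  by move=> + fxy Bxy; apply: contra_leq => lt; rewrite keyE fxy Bxy !eqxx lt !orbT.
have key_B x : (key x <= key (B x))%N.
  rewrite leqNgt keyE f_B B_idem !eqxx !ltnn /= -leqNgt; exact: le_B.
have between x y : (key x <= key y)%N -> (key y <= key (B x))%N ->
    f y = f x /\ B y = B x.
  move=> xy yb; have fxy : f y = f x.
    apply/val_inj/eqP; rewrite eqn_leq [X in _ && X]le_key_f // andbT -(f_B x); exact: le_key_f.
  split=> //; apply/val_inj/eqP; rewrite eqn_leq [X in _ && X]le_key_B // andbT.
  by rewrite -(B_idem x); apply: le_key_B; rewrite ?f_B.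
have firstB p j : first_big_from n pi p j -> pi j = B (pi p).
  move=> /first_big_fromP[lepj jb minj]; have [Bb _ _] := B_spec (pi p).
  have lepB : (p <= pos (B (pi p)))%N by rewrite leE posK.
  have lejB : (j <= pos (B (pi p)))%N by apply: minj; rewrite ?posK.
  rewrite leE in lepj; rewrite leE posK in lejB.
  by have [_] := between _ _ lepj lejB; rewrite B_big.
have gap p : pi p \notin big -> (p < pos (B (pi p)))%N.
  move=> pb; rewrite ltn_neqAle leE posK key_B andbT; apply: contraNneq pb => /val_inj ep.
  have [Bb _ _] := B_spec (pi p).
  by rewrite [in pi p]ep posK.
apply/andP; split.
  apply/admissibleP; split.
  - move=> p q ltpq mpq; rewrite ltnNge leq_eqVlt; apply/negP.
    move=> /orP[/eqP/val_inj/perm_inj eqp|ltqp]; first by rewrite eqp ltnn in ltpq.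
    have lef : (f (pi q) <= f (pi p))%N by apply: okf1; rewrite // meet_sym.
    move: ltpq; rewrite ltE ltnNge => /negP[]; apply: ltnW; rewrite keyE.
    move: lef; rewrite leq_eqVlt => /orP[/eqP/val_inj efqp|->//].
    have leB : (B (pi q) <= B (pi p))%N.
      by apply/B_mono/connect1/eI; rewrite // meet_sym.
    rewrite efqp eqxx /=; move: leB.
    by rewrite leq_eqVlt => /orP[/eqP/val_inj->|->]; rewrite ?eqxx ?ltqp ?orbT.
  - move=> p; have [Bb _ _] := B_spec (pi p).
    have PB : (p <= pos (B (pi p)))%N && (pi (pos (B (pi p))) \in big).
      by rewrite posK Bb leE posK key_B.
    have [j /andP[lepj jb] minj] := @arg_minnP _ (pos (B (pi p)))
      (fun j : 'I_k => (p <= j)%N && (pi j \in big)) (fun j : 'I_k => j : nat) PB.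
    exists j; apply/first_big_fromP; split=> // q lepq qb.
    by apply: minj; rewrite lepq.
  - move=> p j fb ltpj; have /first_big_fromP[lepj jb minj] := fb.
    have pb : pi p \notin big.
      by apply/negP => /(minj p (leqnn p)); rewrite leqNgt ltpj.
    have [z [ltz mz fz zB]] := B_step pb; exists (pos z).
    have Bz : B z = B (pi p).
      apply/val_inj/eqP; rewrite eqn_leq; apply/andP; split.
        by rewrite -(B_idem (pi p)); apply: B_mono.
      by apply/B_mono/connect1/eI.
    rewrite posK ltE posK keyE fz Bz !eqxx !ltnn ltz leE posK (firstB p j fb).
    by rewrite leqNgt keyE f_B B_idem fz Bz !eqxx !ltnn /= -leqNgt; have /andP[] := connect_le zB.
  move=> p q qE pb.
  have leqB : (q <= pos (B (pi p)))%N by rewrite qE; apply: gap.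
  have lepq : (p <= q)%N by rewrite qE.
  rewrite leE in lepq; rewrite leE posK in leqB.
  have [fq Bq] := between _ _ lepq leqB.
  have := le_key_lab _ _ lepq (esym fq) (esym Bq).
  rewrite leq_eqVlt => /orP[/eqP/val_inj/perm_inj epq|//].
  by move: qE; rewrite epq => /eqP; rewrite eqn_leq ltnn andbF.
apply/compatibleP; split.
- by move=> p q; rewrite leE; apply: le_key_f.
- by move=> p j /firstB ->; rewrite f_B.
move=> p q ltpq pb qb efpq; have := ltpq; rewrite ltE keyE efpq eqxx ltnn !B_big //=.
by case/orP => // /andP[].
Qed.

(** Condition (3) joins every position by a chain of [e] to the big letter that ends its block, and
    condition (1) makes such chains run forward; with the last clause of [compatible] that letter
    must be [B]. Condition (4) makes the labels increase inside a block. *)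
Let admissible_sorted pi : admissible n pi -> compatible pi f ->
  forall p q, (p < q)%N -> (key (pi p) < key (pi q))%N.
Proof.
move=> /admissibleP[a1 a2 a3 a4] /compatibleP[c1 c2 c3].
have step_pos p q : e (pi p) (pi q) -> (p < q)%N.
  move=> /and3P[ltpq mpq _]; rewrite ltnNge leq_eqVlt; apply/negP => /orP[/eqP/val_inj e_qp|ltqp].
    by rewrite e_qp ltnn in ltpq.
  by have := a1 q p ltqp; rewrite meet_sym => /(_ mpq); rewrite ltnNge ltnW.
have connect_pos p q : connect e (pi p) (pi q) -> (p <= q)%N.
  have gen x y : connect e x y -> ((pi^-1%g x : 'I_k) <= (pi^-1%g y : 'I_k))%N.
    move=> /(connect_ind (P := fun x y => ((pi^-1%g x : 'I_k) <= (pi^-1%g y : 'I_k))%N)).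
    apply=> // a b c ab _; apply: leq_trans; apply: ltnW; apply: step_pos.
    by rewrite !permKV.
  by move=> /gen; rewrite !permK.
have first_same p q j : first_big_from n pi p j -> (p <= q)%N -> (q <= j)%N ->
    first_big_from n pi q j.
  move=> /first_big_fromP[_ jb minj] lepq leqj; apply/first_big_fromP; split=> // r leqr.
  by apply: minj; apply: leq_trans leqr.
have first_connect p j : first_big_from n pi p j -> connect e (pi p) (pi j).
  have [r] := ubnP (j - p); elim: r p => // r IH p ltr fb.
  have /first_big_fromP[lepj jb _] := fb.
  move: (lepj); rewrite leq_eqVlt => /orP[/eqP/val_inj->|ltpj]; first exact: connect0.
  have [q [ltpq leqj mpq]] := a3 p j fb ltpj.
  have fbq := first_same p q j fb (ltnW ltpq) leqj.
  have qj := IH q _ fbq; apply: connect_trans (qj _); last by lia.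
  by apply/connect1/eI; rewrite ?(a1 p q) // (c2 p j) // (c2 q j).
have first_B p j : first_big_from n pi p j -> B (pi p) = pi j.
  move=> fb; have [Bb pB minB] := B_spec (pi p); have /first_big_fromP[lepj jb minj] := fb.
  apply/val_inj/eqP; rewrite eqn_leq minB ?first_connect //=.
  pose q := (pi^-1%g (B (pi p))); have eq' : pi q = B (pi p) by rewrite permKV.
  have lejq : (j <= q)%N by apply: minj; rewrite ?eq' // connect_pos ?eq'.
  rewrite -eq'; move: lejq; rewrite leq_eqVlt => /orP[/eqP/val_inj->//|ltjq].
  by apply/ltnW/c3; rewrite ?eq' // f_B (c2 p j).
have chain p q j : first_big_from n pi p j -> (p < q)%N -> (q <= j)%N -> (pi p < pi q)%N.
  move=> fb; have /first_big_fromP[_ _ minj] := fb.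
  have [r] := ubnP q; elim: r q => // r IH q ltqr ltpq leqj.
  have lt_q' : (q.-1 < k)%N by have := ltn_ord q; lia.
  pose q' := Ordinal lt_q'.
  have qE : q = q'.+1 :> nat by rewrite /= prednK //; lia.
  have nb : pi q' \notin big.
    by apply/negP => /(minj q'); rewrite /=; lia.
  have [ltpq'|lepq'] := ltnP p q'.
    by apply: ltn_trans (a4 q' q qE nb); apply: IH; rewrite //=; lia.
  have -> : p = q' by apply/val_inj; rewrite /=; lia.
  exact: a4.
move=> p q ltpq; rewrite keyE.
have := c1 p q (ltnW ltpq); rewrite leq_eqVlt => /orP[/eqP/val_inj efpq|->//].
rewrite efpq eqxx ltnn /=.
have [jp fbp] := a2 p; have [jq fbq] := a2 q.
rewrite (first_B p jp) // (first_B q jq) //.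
have /first_big_fromP[lepj jpb minp] := fbp; have /first_big_fromP[leqj jqb minq] := fbq.
have : (jp <= jq)%N by apply: minp => //; apply: leq_trans leqj; apply: ltnW.
rewrite leq_eqVlt => /orP[/eqP/val_inj ej|ltj].
  by rewrite ej ltnn eqxx /= (chain p q jp) // ej.
by rewrite c3 // -(c2 p jp) // -(c2 q jq).
Qed.

Lemma admissible_compatible_unique :
  exists pi, forall pi', (admissible n pi' && compatible pi' f) = (pi' == pi).
Proof.
have [pi srt] := sorting_perm_exists key_inj.
exists pi => pi'; apply/andP/eqP => [[adm comp]|->].
  by apply: (sorting_perm_unique key_inj) srt; apply: admissible_sorted.
by apply/andP; apply: sorted_admissible.
Qed.

End Key.
End CompatibleLevels.

Section DescentCount.
Variable xs : seq nat.

Definition descents_before (r : nat) : nat :=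
  count (fun s => nth 0 xs s.+1 < nth 0 xs s)%N (iota 0 r).

Lemma descents_beforeS r : descents_before r.+1 =
  (descents_before r + (nth 0 xs r.+1 < nth 0 xs r))%N.
Proof. by rewrite /descents_before -[X in iota 0 X]addn1 iotaD count_cat /= addn0. Qed.

Lemma descents_before_le r : (descents_before r <= r)%N.
Proof. by rewrite -[X in (_ <= X)%N](size_iota 0); apply: count_size. Qed.

Lemma descents_before_diff r s : (r <= s)%N ->
  (descents_before r <= descents_before s)%N /\
  (descents_before s <= descents_before r + (s - r))%N.
Proof.
move=> ler; rewrite -(subnK ler); elim: (s - r)%N => [|d [IH1 IH2]].
  by rewrite add0n subnn addn0.
by rewrite addSn descents_beforeS; case: (_ < _)%N; lia.
Qed.

End DescentCount.

Lemma card_bij_sets (T T' : finType) (A : {set T}) (B : {set T'})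
    (g : T -> T') (h : T' -> T) :
  (forall x, x \in A -> g x \in B /\ h (g x) = x) ->
  (forall y, y \in B -> h y \in A /\ g (h y) = y) -> #|A| = #|B|.
Proof.
move=> gA hB; rewrite -(card_in_imset (f := g) (D := A)).
  apply: eq_card => y; apply/imsetP/idP => [[x /gA[gx _] ->]//|/hB[hy e]].
  by exists (h y).
by move=> x y /gA[_ ex] /gA[_ ey] exy; rewrite -ex exy ey.
Qed.

(** * Counting the level functions compatible with an admissible permutation *)

Section CountCompatible.
Variables (m n : nat) (us : seq (seq ('I_m * 'I_m))) (N' : nat).
Local Notation k := (size us).
Local Notation N := N'.+1.
Local Notation u := (fun i : 'I_k => nth [::] us i).
Local Notation big := (big_cycles n us).
Local Notation meet := (meet_cycles u).
Variable pi : 'S_k.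
Hypothesis adm : admissible n pi.
Implicit Types (f : {ffun 'I_k -> 'I_N.+1}) (p q x y z : 'I_k).

Let bigs := [seq p <- enum 'I_k | pi p \in big].
Let xs := [seq val x | x <- [seq pi i | i : 'I_k] & x \in big].
Let d := descents_before xs.

Let size_bigs : size bigs = #|big|.
Proof.
rewrite size_filter -(card_imset (mem big) (@perm_inj _ pi^-1%g)).
rewrite cardE -size_filter; apply: perm_size; apply: uniq_perm.
- exact/filter_uniq/enum_uniq.
- exact: enum_uniq.
move=> p; rewrite mem_filter !mem_enum andbT; apply/idP/imsetP => [pb|[x xb ->]].
  by exists (pi p); rewrite ?permK.
by rewrite permKV.
Qed.

Let xsE : xs = [seq val (pi p) | p <- bigs].
Proof. by rewrite /xs /image_mem filter_map -map_comp. Qed.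

(** The number of the block of [p]: each earlier big position closes one block. *)
Let seg p := count (fun q : 'I_k => (q < p)%N) bigs.

Let bigs_sorted : sorted (fun p q : 'I_k => (p < q)%N) bigs.
Proof.
apply: sorted_filter; first by move=> a b c; apply: ltn_trans.
by have := iota_ltn_sorted 0 k; rewrite -val_enum_ord sorted_map.
Qed.

Let mem_bigs p : (p \in bigs) = (pi p \in big).
Proof. by rewrite mem_filter mem_enum andbT. Qed.

Let seg_le p q : (p <= q)%N -> (seg p <= seg q)%N.
Proof. by move=> lepq; apply: sub_count => r /= ltrp; apply: leq_trans lepq. Qed.

Let seg_big p : pi p \in big -> seg p = index p bigs.
Proof.
rewrite -mem_bigs /seg; elim: bigs bigs_sorted => [//|a s IH] srt /=.
have lta : all (fun b : 'I_k => (a < b)%N) s.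
  by apply: order_path_min srt => x y z; apply: ltn_trans.
rewrite inE => /predU1P[->|ps]; last first.
  have ltap := allP lta p ps; rewrite ltap IH ?(path_sorted srt) //.
  by rewrite -val_eqE ltn_eqF.
rewrite ltnn eqxx; apply/eqP; rewrite add0n -leqn0 leqNgt -has_count; apply/hasPn => b bs.
by rewrite -leqNgt ltnW // (allP lta).
Qed.

Let seg_first p j : first_big_from n pi p j -> seg p = seg j.
Proof.
move=> /first_big_fromP[lepj jb minj]; apply: eq_in_count => q.
rewrite mem_bigs => qb /=; apply/idP/idP => [ltqp|ltqj]; first exact: leq_trans lepj.
by rewrite ltnNge; apply/negP => lepq; have := minj q lepq qb; rewrite leqNgt ltqj.
Qed.

Let seg_bound p : (seg p < #|big|)%N.
Proof.
have /admissibleP[_ a2 _ _] := adm; have [j fb] := a2 p.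
have /first_big_fromP[_ jb _] := fb.
by rewrite (seg_first fb) seg_big // -size_bigs index_mem mem_bigs.
Qed.

Let nth_xs p : pi p \in big -> nth 0%N xs (seg p) = pi p.
Proof.
move=> pb; rewrite seg_big // xsE (nth_map p) ?index_mem ?mem_bigs //.
by rewrite nth_index ?mem_bigs.
Qed.

Let seg_lt p q : (p < q)%N -> pi p \in big -> (seg p < seg q)%N.
Proof.
move=> ltpq pb; have up : uniq bigs by apply/filter_uniq/enum_uniq.
have : (count (predU (fun r : 'I_k => (r < p)%N) (pred1 p)) bigs <= seg q)%N.
  by apply: sub_count => r /= /orP[ltrp|/eqP->//]; apply: ltn_trans ltpq.
apply: leq_trans.
have e0 : count (predI (fun r : 'I_k => (r < p)%N) (pred1 p)) bigs = 0%N.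
  rewrite (@eq_count _ _ pred0) ?count_pred0 // => r /=.
  by have [->|_] := eqVneq r p; rewrite ?ltnn ?andbF.
rewrite -[X in (_ < X)%N]addn0 -[in X in (_ < X)%N]e0.
by rewrite count_predUI (count_uniq_mem _ up) mem_bigs pb addn1.
Qed.

Let l := #|big|.

Let size_xs : size xs = l. Proof. by rewrite xsE size_map size_bigs. Qed.

Let position_of_seg r : (r < l)%N -> exists p, pi p \in big /\ seg p = r.
Proof.
move=> ltr; have ltr' : (r < size bigs)%N by rewrite size_bigs.
case eb : bigs => [|p0 s]; first by rewrite eb in ltr'.
exists (nth p0 bigs r); have rb : nth p0 bigs r \in bigs by apply: mem_nth.
by rewrite -mem_bigs rb seg_big -?mem_bigs // index_uniq //; apply/filter_uniq/enum_uniq.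
Qed.

Section NonEmpty.
Variable p0 : 'I_k.

Let l_gt0 : (0 < l)%N. Proof. exact: leq_ltn_trans (seg_bound p0). Qed.

(** The largest value that the last entry of [to_tuple] can take, reached when the last block has
    level [N]. *)
Let M := (N' + l.-1 - d l.-1)%N.

(** The levels of the blocks increase weakly, and strictly at descents. Adding the block number and
    subtracting the descents so far makes the sequence strictly increasing throughout; the 1
    subtracted makes it start from 0. *)
Let to_tuple f : l.-tuple 'I_M.+1 :=
  [tuple inord (f (pi (nth p0 bigs r)) - 1 + r - d r)%N | r < l].

Let of_tuple (h : l.-tuple 'I_M.+1) : {ffun 'I_k -> 'I_N.+1} :=
  [ffun x => let r := seg (pi^-1%g x) in
             inord ((nth ord0 h r + 1 + d r - r)%N)].

Let sorted_gap (h : l.-tuple 'I_M.+1) r s : sorted ltn (map val h) ->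
  (r <= s)%N -> (s < l)%N -> (nth ord0 h r + (s - r) <= nth ord0 h s)%N.
Proof.
move=> srt; elim: s => [|s IH] ler lts; first by move: ler; rewrite leqn0 => /eqP->; rewrite addn0.
move: ler; rewrite leq_eqVlt => /orP[/eqP->|ler]; first by rewrite subnn addn0.
have := IH ler (ltnW lts).
have := sorted_ltn_nth ltn_trans 0%N srt s s.+1.
rewrite !inE size_map size_tuple !(nth_map ord0) ?size_tuple ?(ltnW lts) //.
move=> /(_ isT lts (ltnSn s)) /=; lia.
Qed.

Let to_tupleE f (fc : compatible n pi f) (fl : f \in levels N meet big setT 0) r :
  (r < l)%N -> [/\ (0 < f (pi (nth p0 bigs r)))%N & nth ord0 (to_tuple f) r =
    (f (pi (nth p0 bigs r)) - 1 + r - d r)%N :> nat].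
Proof.
move=> ltr; have f_gt0 : (0 < f (pi (nth p0 bigs r)))%N.
  by move: fl; rewrite inE => /andP[_ /forallP/(_ (pi (nth p0 bigs r)))]; rewrite inE.
split=> //; rewrite (nth_map (Ordinal ltr)) ?size_enum_ord // nth_enum_ord // inordK //.
have ler : (r <= l.-1)%N by rewrite -ltnS prednK.
have [] := descents_before_diff xs ler; have := ltn_ord (f (pi (nth p0 bigs r))).
have := descents_before_le xs r; have := descents_before_le xs l.-1.
rewrite /M -/d; lia.
Qed.

Let desc_nth p q : pi p \in big -> pi q \in big -> seg q = (seg p).+1 ->
  d (seg q) = (d (seg p) + (pi q < pi p))%N.
Proof. by move=> pb qb e; rewrite e /d descents_beforeS -e !nth_xs. Qed.

Let to_tuple_sorted f : f \in levels N meet big setT 0 -> compatible n pi f ->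
  sorted ltn (map val (to_tuple f)).
Proof.
move=> fl fc; apply/(sortedP 0%N) => r; rewrite size_map size_tuple => ltr.
rewrite !(nth_map ord0) ?size_tuple ?(ltnW ltr) //=.
have [f1 ->] := to_tupleE fc fl (ltnW ltr); have [f2 ->] := to_tupleE fc fl ltr.
have [p [pb ep]] := position_of_seg (ltnW ltr).
have [q [qb eq']] := position_of_seg ltr.
have nthE p' r' : pi p' \in big -> seg p' = r' -> nth p0 bigs r' = p'.
  by move=> pb' <-; rewrite seg_big // nth_index // mem_bigs.
rewrite (nthE p) // (nthE q) // in f1 f2 *.
have := desc_nth pb qb; rewrite ep eq' => /(_ erefl) ->.
have /compatibleP[c1 _ c3] := fc.
have ltpq : (p < q)%N.
  by rewrite ltnNge; apply/negP => /seg_le; rewrite ep eq' ltnn.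
have := c1 p q (ltnW ltpq); have := descents_before_le xs r; rewrite -/d.
case: (ltnP (pi q) (pi p)) => [ltqp|_]; last by lia.
have : f (pi p) != f (pi q) :> nat.
  by apply/eqP => /val_inj /(c3 p q ltpq pb qb); rewrite ltnNge ltnW.
lia.
Qed.

Let to_tupleK f : f \in levels N meet big setT 0 -> compatible n pi f ->
  of_tuple (to_tuple f) = f.
Proof.
move=> fl fc; apply/ffunP => x; rewrite ffunE; set p := (pi^-1%g x).
have -> : x = pi p by rewrite permKV.
have /admissibleP[_ a2 _ _] := adm; have [j fb] := a2 p.
have /first_big_fromP[_ jb _] := fb; have /compatibleP[_ c2 _] := fc.
rewrite (c2 p j fb) /= (seg_first fb).
have [f1 e] := to_tupleE fc fl (seg_bound j); apply: val_inj.
have ej : nth p0 bigs (seg j) = j by rewrite seg_big // nth_index // mem_bigs.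
rewrite ej in f1 e; rewrite e /= inordK; have := descents_before_le xs (seg j); rewrite -/d.
  lia.
by have := ltn_ord (f (pi j)); lia.
Qed.

Section OfTuple.
Variable h : l.-tuple 'I_M.+1.
Hypothesis h_sorted : sorted ltn (map val h).

Let v r := (nth ord0 h r + 1 + d r - r)%N.

Let h_ge r : (r < l)%N -> (r <= nth ord0 h r)%N.
Proof. by move=> ltr; have := sorted_gap h_sorted (leq0n r) ltr; lia. Qed.

Let v_bound r : (r < l)%N -> (0 < v r)%N && (v r < N.+1)%N.
Proof.
move=> ltr; have := h_ge ltr; have ltl : (l.-1 < l)%N by lia.
have ler : (r <= l.-1)%N by lia.
have := sorted_gap h_sorted ler ltl; have := ltn_ord (nth ord0 h l.-1).
have [d1 d2] := descents_before_diff xs ler; move: d1 d2.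
have := descents_before_le xs l.-1.
rewrite /v /M -/d; lia.
Qed.

Let v_mono r s : (r <= s)%N -> (s < l)%N -> (v r + (d s - d r) <= v s)%N.
Proof.
move=> ler lts; have := sorted_gap h_sorted ler lts.
have := h_ge lts; have := h_ge (leq_ltn_trans ler lts).
have [d1 d2] := descents_before_diff xs ler; move: d1 d2.
rewrite /v -/d; lia.
Qed.

Let of_tupleE x : of_tuple h x = v (seg (pi^-1%g x)) :> nat.
Proof.
by rewrite ffunE inordK //; have /andP[] := v_bound (seg_bound (pi^-1%g x)).
Qed.

Let of_tuple_pi p : of_tuple h (pi p) = v (seg p) :> nat.
Proof. by rewrite of_tupleE permK. Qed.

(** Equal descent counts exclude any descent between the two big positions, so the labels increase
    through the big letters in between. *)
Let no_descent p q : (p < q)%N -> pi p \in big -> pi q \in big ->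
  d (seg p) = d (seg q) -> (pi p < pi q)%N.
Proof.
move=> ltpq pb qb; have := seg_lt ltpq pb.
have [r] := ubnP (seg q); elim: r q {ltpq} qb => // r IH q qb ltr ltpq ed.
have lt_prev : ((seg q).-1 < l)%N by have := seg_bound q; rewrite -/l; lia.
have [q' [qb' eq']] := position_of_seg lt_prev.
have eS : seg q = (seg q').+1 by rewrite eq' prednK //; lia.
have dE := desc_nth qb' qb eS.
have le_pq' : (seg p <= seg q')%N by lia.
have [d1 _] := descents_before_diff xs le_pq'; rewrite -/d in d1.
have nd : (pi q < pi q')%N = false by move: dE; rewrite -ed; case: (_ < _)%N => //=; lia.
have neq : (pi q' < pi q)%N.
  move/negbT: nd; rewrite -leqNgt leq_eqVlt => /orP[/eqP/val_inj/perm_inj e|//].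
  by move: eS; rewrite e; lia.
move: le_pq'; rewrite leq_eqVlt => /orP[/eqP e|lt_pq'].
  suff -> : p = q' by [].
  have : index p bigs = index q' bigs by rewrite -!seg_big.
  by apply: (@index_inj _ p); rewrite mem_bigs.
by apply: ltn_trans neq; apply: IH => //; move: dE; rewrite ?nd; lia.
Qed.

Lemma of_tuple_levels : of_tuple h \in levels N meet big setT 0.
Proof.
have /admissibleP[a1 a2 a3 a4] := adm.
rewrite inE; apply/andP; split; last first.
  apply/forallP => x; rewrite inE of_tupleE.
  by have /andP[] := v_bound (seg_bound (pi^-1%g x)).
apply/levels_okP; split=> [x y|x].
  rewrite -[x](permKV pi) -[y](permKV pi); set p := (pi^-1%g x); set q := (pi^-1%g y).
  move=> ltij mij _ _; rewrite !of_tuple_pi.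
  have lepq : (p <= q)%N.
    rewrite leqNgt; apply/negP => /a1; rewrite meet_sym => /(_ mij).
    by rewrite ltnNge ltnW.
  apply: leq_trans (v_mono (seg_le lepq) (seg_bound q)); exact: leq_addr.
rewrite -[x](permKV pi); set p := (pi^-1%g x) => pb _.
have [j fb] := a2 p; have /first_big_fromP[lepj jb minj] := fb.
have ltpj : (p < j)%N.
  move: lepj; rewrite leq_eqVlt => /orP[/eqP/val_inj epj|//].
  by rewrite epj jb in pb.
have [q [ltpq leqj mpq]] := a3 p j fb ltpj.
exists (pi q); split=> //; first exact: a1.
apply: val_inj; rewrite /= !of_tuple_pi; congr v; apply/eqP.
by rewrite eqn_leq (seg_le (ltnW ltpq)) (seg_first fb) (seg_le leqj).
Qed.

Lemma of_tuple_compatible : compatible n pi (of_tuple h).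
Proof.
apply/compatibleP; split=> [p q lepq|p q fb|p q ltpq pb qb].
- rewrite !of_tuple_pi; apply: leq_trans (v_mono (seg_le lepq) (seg_bound q)).
  exact: leq_addr.
- by apply: val_inj; rewrite /= !of_tuple_pi (seg_first fb).
move=> /(congr1 val); rewrite /= !of_tuple_pi => ev; apply: no_descent => //.
have := v_mono (seg_le (ltnW ltpq)) (seg_bound q); rewrite ev.
have [d1 _] := descents_before_diff xs (seg_le (ltnW ltpq)).
by rewrite -/d in d1; lia.
Qed.

Lemma of_tupleK : to_tuple (of_tuple h) = h.
Proof.
apply: eq_from_tnth => r; rewrite tnth_mktuple (tnth_nth ord0).
have [p [pb ep]] := position_of_seg (ltn_ord r).
have -> : nth p0 bigs r = p by rewrite -ep seg_big // nth_index // mem_bigs.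
rewrite of_tuple_pi ep; have h_r := h_ge (ltn_ord r).
have := descents_before_le xs r; rewrite -/d => d_r.
have -> : (v r - 1 + r - d r)%N = nth ord0 h r by rewrite /v; lia.
exact: inord_val.
Qed.

End OfTuple.

Lemma count_nonempty :
  #|[set f in levels N meet big setT 0 | compatible n pi f]| = 'C(M.+1, l).
Proof.
rewrite -card_ltn_sorted_tuples; apply: (card_bij_sets (g := to_tuple) (h := of_tuple)).
  move=> f; rewrite !inE -/(levels N meet big setT 0) => /andP[fl fc].
  rewrite to_tuple_sorted ?to_tupleK //; by rewrite inE.
move=> h; rewrite !inE => hs; rewrite of_tupleK // of_tuple_compatible // andbT; split=> //.
by have := of_tuple_levels hs; rewrite inE.
Qed.

End NonEmpty.

Lemma card_compatible :
  #|[set f in levels N meet big setT 0 | compatible n pi f]| =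
  'C(N' + #|big| - descents_big n pi, #|big|).
Proof.
have -> : descents_big n pi = d l.-1 by rewrite -size_xs.
case: (pickP (fun _ : 'I_k => true)) => [p0 _|none].
  have l_gt0 : (0 < l)%N by apply: leq_ltn_trans (seg_bound p0).
  rewrite (count_nonempty p0); congr 'C(_, _).
  by rewrite -/l; have := descents_before_le xs l.-1; rewrite -/d; lia.
(* Without cycles there is a single level function, and the binomial coefficient is 1. *)
have no_index (x : 'I_k) : False by have := none x.
have l0 : #|big| = 0%N by apply: eq_card0 => x; case: (no_index x).
rewrite l0 bin0; have /eqP := cards1 [ffun _ : 'I_k => (ord0 : 'I_N.+1)].
rewrite (_ : [set [ffun=> ord0]] = [set f in levels N meet big setT 0 | compatible n pi f]).
  by move/eqP.
apply/setP => f; rewrite inE [RHS]inE; have -> : f = [ffun=> ord0].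
  by apply/ffunP => x; case: (no_index x).
rewrite eqxx; apply/esym/andP; split; last first.
  by apply/compatibleP; split=> x; case: (no_index x).
rewrite inE; apply/andP; split; first by apply/levels_okP; split=> x; case: (no_index x).
by apply/forallP => x; case: (no_index x).
Qed.

End CountCompatible.

Theorem card_levels (m n : nat) (us : seq (seq ('I_m * 'I_m))) (N' : nat)
    (meet := meet_cycles (fun i : 'I_(size us) => nth [::] us i)) :
  #|levels N'.+1 meet (big_cycles n us) setT 0| =
  (\sum_(pi : 'S_(size us) | admissible n pi)
     'C(N' + #|big_cycles n us| - descents_big n pi, #|big_cycles n us|))%N.
Proof.
transitivity (\sum_(pi : 'S_(size us) | admissible n pi)
  #|[set f in levels N'.+1 meet (big_cycles n us) setT 0 | compatible n pi f]|)%N; last first.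
  by apply: eq_bigr => pi adm; apply: card_compatible.
under eq_bigr do rewrite -sum1_card big_mkcond.
rewrite exchange_big /= -sum1_card big_mkcond; apply: eq_bigr => f _.
under eq_bigr do rewrite inE.
case: ifP => [fl|_]; last by rewrite big1.
have f_gt0 x : f x != ord0.
  move: fl; rewrite inE => /andP[_ /forallP/(_ x)].
  by rewrite inE -val_eqE /= lt0n.
have okf : levels_ok meet (big_cycles n us) f by move: fl; rewrite inE => /andP[].
have [pi pi_unique] := admissible_compatible_unique okf f_gt0.
by rewrite -big_mkcondr (big_pred1 pi).
Qed.

(** * The disjoint cycle decomposition *)

Section CycleDecomposition.
Variable m : nat.
Local Notation height := 'I_m.
Local Notation step := ('I_m * 'I_m)%type.
Implicit Types (alpha gamma w c : seq step) (mu : seq height).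

Definition closed_walk w := unzip2 w == rot 1 (unzip1 w).

Lemma map_next_zip (T : eqType) (p : seq T) : uniq p ->
  [seq (x, next p x) | x <- p] = zip p (rot 1 p).
Proof.
case: p => [//|x p] up; apply: (@eq_from_nth _ (x, x)) => [|q].
  by rewrite size_map size_zip size_rot minnn.
rewrite size_map => ltq; rewrite (nth_map x) // nth_zip ?size_rot //; congr (_, _).
rewrite next_nth mem_nth // index_uniq // rot1_cons nth_rcons.
move: ltq; rewrite ltnS leq_eqVlt => /orP[/eqP->|ltq].
  by rewrite ltnn eqxx nth_default.
by rewrite ltq; apply: set_nth_default.
Qed.

Lemma closed_walk_cycle c :
  c != [::] -> uniq (unzip1 c) -> closed_walk c -> is_cycle c.
Proof.
move=> cn uc /eqP e; apply/and3P; split=> //.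
by rewrite map_next_zip // -e zip_unzip.
Qed.

Lemma rot1_cut (T : eqType) (a1 a2 c b1 b2 : seq T) :
  size a2 = size a1 -> size b2 = size b1 ->
  a2 ++ rot 1 c ++ b2 = rot 1 (a1 ++ c ++ b1) -> a2 ++ b2 = rot 1 (a1 ++ b1).
Proof.
case: c => [//|x c]; rewrite rot1_cons; case: a1 => [|y a1].
  move=> /size0nil -> {a2}; case: b1 => [/size0nil->//|z b1].
  case: b2 => [//|z2 b2] _; rewrite !cat0s cat_cons rot1_cons cat_rcons rcons_cat => /eqP.
  by rewrite eqseq_cat // eqxx /= => /eqP[-> ->]; rewrite rot1_cons.
move=> size_a _; rewrite !cat_cons !rot1_cons => /eqP.
rewrite -[a1 ++ x :: _]cat_rcons rcons_cat eqseq_cat ?size_rcons // => /andP[/eqP->].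
rewrite cat_rcons rcons_cat eqseq_cat // eqxx /= => /eqP e.
by rewrite cat_rcons e rcons_cat.
Qed.

Lemma closed_walk_cut (a c b : seq step) :
  closed_walk c -> closed_walk (a ++ c ++ b) -> closed_walk (a ++ b).
Proof.
rewrite /closed_walk /unzip1 /unzip2 !map_cat => /eqP -> /eqP e; apply/eqP.
by apply: rot1_cut e; rewrite !size_map.
Qed.

Lemma walk_spec fuel (c : height) alpha : (size alpha <= fuel)%N ->
  let: (W, rest) := walk fuel c alpha in
  [/\ c :: unzip2 W = rcons (unzip1 W) (last c (unzip2 W)),
      same_rows (W ++ rest) alpha & last c (unzip2 W) \notin unzip1 rest].
Proof.
elim: fuel c alpha => [|fuel IH] c alpha /=.
  by rewrite leqn0 size_eq0 => /eqP ->; split=> //; apply: same_rows_refl.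
set q := find _ _ => le_size; case ed : (drop q alpha) => [|s alpha2].
  split=> //; first exact: same_rows_refl.
  have nq : ~~ has (fun s : step => s.1 == c) alpha.
    rewrite has_find -/q -leqNgt -subn_eq0 -size_drop.
    by rewrite ed.
  by rewrite /=; apply: contra nq => /mapP[s sa e]; apply/hasP; exists s; rewrite // e.
have hq : has (fun s : step => s.1 == c) alpha.
  by rewrite has_find -/q -subn_gt0 -size_drop ed.
have sE : nth s alpha q = s by rewrite -[q]addn0 -nth_drop ed.
have s1 : s.1 = c by have := nth_find s hq; rewrite -/q sE => /eqP.
have ea : alpha = take q alpha ++ s :: alpha2 by rewrite -ed cat_take_drop.
have size_rest : (size (take q alpha ++ alpha2) <= fuel)%N.
  move: le_size; have := congr1 size ea; rewrite !size_cat /=.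
  by move=> ->; rewrite addnS ltnS.
have := IH s.2 (take q alpha ++ alpha2) size_rest.
case: (walk fuel s.2 _) => W rest [eW rowsW lastW]; split=> //.
  by rewrite /= eW s1.
rewrite [X in same_rows _ X]ea.
have first_q : s.1 \notin unzip1 (take q alpha).
  have : ~~ has (fun s : step => s.1 == c) (take q alpha) by rewrite has_take ?ltnn // find_size.
  by apply: contra => /mapP[z zt ez]; apply/hasP; exists z; rewrite // -ez s1.
apply: (same_rows_trans (w := s :: take q alpha ++ alpha2)).
  by rewrite cat_cons (same_rows_catl [:: s]).
rewrite same_rows_sym -cat1s catA -cat_cons -[s :: take q alpha]cat1s.
apply: same_rows_catr; apply: same_rows_catC => z zt; rewrite inE.
by apply: contraNneq first_q => <-.
Qed.

(** Euler's argument: if the walk got stuck at [e] different from [c], it would have entered [e]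
    once more than it left it, while all steps out of [e] are used, against balance. *)
Lemma walk_closed (c : height) W rest : balanced (W ++ rest) ->
  c :: unzip2 W = rcons (unzip1 W) (last c (unzip2 W)) ->
  last c (unzip2 W) \notin unzip1 rest ->
  [/\ last c (unzip2 W) = c, closed_walk W & balanced rest].
Proof.
set e := last _ _ => bal eW eR.
have ec : e = c.
  apply/eqP/contraT => neq_ec.
  have balE : (count_mem e (unzip1 W) + count_mem e (unzip1 rest) =
      count_mem e (unzip2 W) + count_mem e (unzip2 rest))%N.
    by rewrite -!count_cat -!map_cat; apply: (seq.permP bal).
  have /(congr1 (count_mem e)) := eW; rewrite -cats1 count_cat /= eqxx.
  have -> : (c == e) = false by rewrite eq_sym; apply/negbTE.
  have restE : count_mem e (unzip1 rest) = 0%N by apply/count_memPn.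
  rewrite restE addn0 in balE.
  by rewrite balE add0n addn0 -addnA -[LHS]addn0 => /addnI; rewrite addn1.
have bW : closed_walk W.
  rewrite ec in eW; rewrite /closed_walk; case: W eW {bal e eR ec} => [//|[x y] W].
  move=> -[ecx e]; apply/eqP.
  by rewrite -[LHS]/(y :: unzip2 W) e -[unzip1 (_ :: _)]/(x :: unzip1 W) rot1_cons ecx.
split=> //; rewrite -(balanced_cat rest (v := W)) // /balanced (eqP bW) perm_sym.
by rewrite perm_rot.
Qed.

Lemma phi_spec alpha : balanced alpha ->
  exists2 ws, all closed_walk ws &
    phi alpha = flatten ws /\ same_rows (phi alpha) alpha.
Proof.
move=> bal.
pose body := fun '(W, rest) (h : height) =>
  let: (Wh, rest') := walk (size rest) h rest in (W ++ Wh, rest').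
rewrite -[phi alpha]/((foldl body ([::], alpha) (enum 'I_m)).1).
suff inv (hs : seq height) W rest :
    balanced rest -> same_rows (W ++ rest) alpha ->
    (exists2 ws, all closed_walk ws & W = flatten ws) ->
    let: (W', rest') := foldl body (W, rest) hs in
    [/\ same_rows (W' ++ rest') alpha, exists2 ws, all closed_walk ws & W' = flatten ws,
        {subset unzip1 rest' <= unzip1 rest} & {in hs, forall h, h \notin unzip1 rest'}].
  have := inv (enum 'I_m) [::] alpha bal (same_rows_refl _).
  case: foldl => W rest /(_ _)[|rows [ws cws eW] _ none]; first by exists [::].
  have rest0 : rest = [::].
    by case: rest none {rows} => // x r /(_ x.1); rewrite mem_enum => /(_ isT); rewrite inE eqxx.
  by exists ws => //; rewrite -eW; split=> //; rewrite rest0 cats0 in rows.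
elim: hs W rest => [|h hs IH] W rest bal_r rows wsW /=; first by split.
have := walk_spec h (leqnn (size rest)); case: walk => Wh rest' [eW rowsh lasth].
have balh : balanced (Wh ++ rest') by rewrite (balanced_same_rows rowsh).
have [eh cW bal_r'] := walk_closed balh eW lasth; rewrite eh in lasth.
have := IH (W ++ Wh) rest' bal_r'; case: foldl => W'' rest'' /(_ _ _)[||rows'' ws'' sub none].
- by rewrite -catA; apply: same_rows_trans rows; rewrite same_rows_catl.
- case: wsW => ws cws ->; exists (rcons ws Wh); first by rewrite all_rcons cW.
  by rewrite flatten_rcons.
split=> // [x /sub xr|h']; last first.
  by rewrite inE => /predU1P[->|/none//]; apply: contra lasth => /sub.
have /perm_mem <- := perm_map fst (same_rows_perm rowsh).
by rewrite map_cat mem_cat xr orbT.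
Qed.

Lemma flatten_closed_split ws x gamma :
  all closed_walk ws -> flatten ws = x :: gamma ->
  exists w ws', [/\ closed_walk (x :: w), all closed_walk ws' & gamma = w ++ flatten ws'].
Proof.
elim: ws => [//|[|y w] ws IH]; first exact: IH.
by move=> /andP[cw cws] [<- <-]; exists w, ws.
Qed.

Lemma find_iota (P : pred nat) L q : (q < L)%N -> P q ->
  let t := find P (iota 0 L) in [/\ (t <= q)%N, P t & forall j, (j < t)%N -> ~~ P j].
Proof.
move=> ltq Pq t; have hasP_ : has P (iota 0 L) by apply/hasP; exists q; rewrite ?mem_iota.
have ltt : (t < L)%N by move: hasP_; rewrite has_find size_iota.
have before j : (j < t)%N -> ~~ P j.
  by move=> ltj; have := before_find 0%N ltj; rewrite nth_iota ?(ltn_trans ltj) // => ->.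
split=> //; first by rewrite leqNgt; apply/negP => /before; rewrite Pq.
by have := nth_find 0%N hasP_; rewrite nth_iota.
Qed.

Lemma uniq_take_new (T : eqType) (x0 : T) (v : seq T) t : (t <= size v)%N ->
  (forall j, (j < t)%N -> nth x0 v j \notin take j v) -> uniq (take t v).
Proof.
elim: t => [|t IH] ltt new; first by rewrite take0.
rewrite (take_nth x0 ltt) rcons_uniq (new t (ltnSn t)) /=.
by apply: IH => [|j ltj]; [apply: ltnW | apply: new; apply: ltnW].
Qed.

(** The first repetition falls within the first nonempty closed walk, so cutting out the cycle
    leaves closed walks. The heights before it are distinct, so the cycle shares no starting height
    with the steps in front of it and commutes past them. *)
Lemma first_cycle_spec x gamma ws (v := x.1 :: unzip2 (x :: gamma)) :
  all closed_walk ws -> flatten ws = x :: gamma ->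
  let t := find (fun t => nth x.1 v t \in take t v) (iota 0 (size v)) in
  let s := index (nth x.1 v t) v in
  let c := take (t - s) (drop s (x :: gamma)) in
  let rest := take s (x :: gamma) ++ drop t (x :: gamma) in
  [/\ is_cycle c, same_rows (x :: gamma) (c ++ rest), (size rest <= size gamma)%N &
      exists2 ws', all closed_walk ws' & rest = flatten ws'].
Proof.
move=> cws ews t s c rest.
have [w [ws' [cw cws' eg]]] := flatten_closed_split cws ews.
set w1 := x :: w in cw; pose V := rcons (unzip1 w1) x.1.
have eV : x.1 :: unzip2 w1 = V.
  by move: cw => /eqP ->; rewrite [unzip1 _]/= rot1_cons.
have ev : v = V ++ unzip2 (flatten ws').
  by rewrite -eV /v eg -cat_cons /unzip2 map_cat.
have size_V : size V = (size w1).+1 by rewrite size_rcons size_map.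
(* The closed walk [w1] is back at its start after [size w1] steps, so a repetition occurs by
   then. *)
have [let_ Pt before] : [/\ (t <= size w1)%N, nth x.1 v t \in take t v &
    forall j, (j < t)%N -> nth x.1 v j \notin take j v].
  apply: find_iota.
    by rewrite ev size_cat size_V ltn_addr.
  by rewrite ev nth_cat size_V ltnSn nth_rcons size_map ltnn eqxx /= inE eqxx.
have t_gt0 : (0 < t)%N by case: (t) Pt.
have lts : (s < t)%N.
  by rewrite /s -[X in index _ X](cat_take_drop t) index_cat Pt; apply: leq_trans (_ : size (take t v) <= t)%N; rewrite ?index_mem // size_take_min geq_minl.
have vs : nth x.1 v s = nth x.1 v t by rewrite nth_index // (mem_take Pt).
have nthV j : (j <= size w1)%N -> nth x.1 v j = nth x.1 V j.
  by move=> lej; rewrite ev nth_cat size_V ltnS lej.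
have takeV j : (j <= size w1)%N -> take j v = take j (unzip1 w1).
  by move=> lej; rewrite ev takel_cat ?size_V 1?ltnW // /V -cats1 takel_cat // size_map.
have uniq_t : uniq (take t (unzip1 w1)).
  by rewrite -takeV //; apply: (@uniq_take_new _ x.1) => //; rewrite ev size_cat size_V; lia.
have ec : c = take (t - s) (drop s w1).
  rewrite /c eg -[x :: w ++ _]/(w1 ++ _) drop_cat ifT; last by apply: leq_trans let_.
  by rewrite takel_cat // size_drop leq_sub2r.
have e1 : take s (x :: gamma) = take s w1.
  by rewrite eg -[x :: w ++ _]/(w1 ++ _) takel_cat // ltnW // (leq_trans lts).
have e2 : drop t (x :: gamma) = drop t w1 ++ flatten ws'.
  rewrite eg -[x :: w ++ _]/(w1 ++ _) drop_cat; case: ltnP => // le_t.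
  have -> : t = size w1 by apply/eqP; rewrite eqn_leq let_.
  by rewrite subnn drop0 drop_size.
have w1E : w1 = take s w1 ++ c ++ drop t w1.
  rewrite ec -{1}(cat_take_drop s w1); congr (_ ++ _).
  by rewrite -{1}(cat_take_drop (t - s) (drop s w1)) drop_drop subnK // ltnW.
have size_c : size c = (t - s)%N.
  by rewrite ec size_takel // size_drop leq_sub2r.
have rows1 : unzip1 c = take (t - s) (drop s V).
  rewrite ec /unzip1 map_take map_drop /V -cats1 drop_cat size_map ifT; last exact: leq_trans let_.
  by rewrite takel_cat // size_drop size_map leq_sub2r.
have rows2 : unzip2 c = take (t - s) (drop s.+1 V).
  by rewrite ec /unzip2 map_take map_drop -eV.
have uniq_c : uniq (unzip1 c).
  rewrite ec /unzip1 map_take map_drop take_drop subnK; last exact: ltnW.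
  exact: drop_uniq uniq_t.
have closed_c : closed_walk c.
  rewrite /closed_walk rows1 rows2; rewrite (drop_nth x.1 (n := s)); last first.
    by rewrite size_V; lia.
  case ets : (t - s)%N => [|q]; first by move: lts; rewrite -subn_gt0 ets.
  rewrite -[take q.+1 (_ :: _)]/(nth x.1 V s :: take q (drop s.+1 V)).
  rewrite rot1_cons (take_nth x.1); last by rewrite size_drop size_V; lia.
  rewrite nth_drop addSnnS -ets subnKC; last exact: ltnW.
  by rewrite -(nthV t) // -vs nthV // ltnW // (leq_trans lts).
have eg' : x :: gamma = (take s w1 ++ c) ++ (drop t w1 ++ flatten ws').
  by rewrite eg -[x :: w ++ _]/(w1 ++ _) {1}w1E -!catA.
have eg_rest : rest = take s w1 ++ (drop t w1 ++ flatten ws') by rewrite /rest e1 e2.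
split.
- by apply: closed_walk_cycle; rewrite // -size_eq0 size_c subn_eq0 -ltnNge.
- rewrite eg' eg_rest [in X in same_rows _ X]catA; apply/same_rows_catr/same_rows_catC.
  move: uniq_t; rewrite -(cat_take_drop s (take t _)) cat_uniq => /and3P[_ /hasPn dis _].
  move=> h hs; apply/negP => hc.
  have hd : h \in drop s (take t (unzip1 w1)).
    by rewrite -(subnK (ltnW lts)) -take_drop; move: hc; rewrite ec /unzip1 map_take map_drop.
  have : h \notin take s (take t (unzip1 w1)) := dis h hd.
  by rewrite take_takel ?(ltnW lts) // -map_take -/(unzip1 _) hs.
- have := congr1 size eg'; rewrite eg_rest !size_cat size_c /= => e.
  by rewrite -ltnS e -addnA ltn_add2l -[X in (X < _)%N]add0n ltn_add2r subn_gt0.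
exists ((take s w1 ++ drop t w1) :: ws').
  rewrite /= cws' andbT; apply: closed_walk_cut closed_c _.
  by rewrite -w1E.
by rewrite eg_rest /= catA.
Qed.

Lemma cycle_decomp_rec_spec fuel gamma ws :
  (size gamma <= fuel)%N -> all closed_walk ws -> gamma = flatten ws ->
  let us := cycle_decomp_rec fuel gamma in
  [/\ all (@is_cycle m) us, same_rows gamma (flatten us) & (size us <= fuel)%N].
Proof.
elim: fuel gamma ws => [|fuel IH] [|x gamma] ws //= le_size cws ews;
  try by split=> //; apply: same_rows_refl.
have [cc rows le_rest [ws' cws' e']] := first_cycle_spec cws (esym ews).
have [cus rows' le_us] := IH _ _ (leq_trans le_rest le_size) cws' e'.
split; rewrite ?ltnS //; first by apply/andP.
by apply: same_rows_trans rows _; rewrite same_rows_catl.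
Qed.

Lemma balanced_oseq mu : balanced (oseq mu).
Proof.
rewrite /balanced /oseq unzip1_zip ?unzip2_zip ?size_sort //.
by rewrite perm_sort.
Qed.

(** The bound on the number of cycles later limits the degree of [e_coef] in [beta]. *)
Theorem cycle_decomp_spec mu :
  [/\ all (@is_cycle m) (cycle_decomp mu), same_rows (oseq mu) (flatten (cycle_decomp mu)) &
      (size (cycle_decomp mu) <= size mu)%N].
Proof.
have [ws cws [ephi rows]] := phi_spec (balanced_oseq mu).
have [cus rows' le_us] := cycle_decomp_rec_spec (leqnn _) cws ephi.
split=> //; first by rewrite same_rows_sym in rows; apply: same_rows_trans rows'.
have := perm_size (same_rows_perm rows).
by rewrite /oseq size_zip size_sort minnn => <-.
Qed.

End CycleDecomposition.

(** * Both sides as polynomials in beta *)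

Section GeneralizedBinomial.
Variable K : fieldType.
Hypothesis char0 : forall q : nat, (q%:R == 0 :> K) = (q == 0)%N.

Lemma gbinom0 (y : K) : gbinom y 0 = 1.
Proof. by rewrite /gbinom big_ord0 fact0 divr1. Qed.

Lemma gbinomS (y : K) r : gbinom (y + 1) r.+1 = gbinom y r.+1 + gbinom y r.
Proof.
rewrite /gbinom big_ord_recl big_ord_recr /= subr0.
have -> : \prod_(i < r) (y + 1 - (bump 0 i)%:R) = \prod_(i < r) (y - i%:R).
  by apply: eq_bigr => i _; rewrite /bump add1n -natr1 opprD addrACA subrr addr0.
have fact_neq0 q : q`!%:R != 0 :> K by rewrite char0 -lt0n fact_gt0.
rewrite factS natrM; field; rewrite fact_neq0 /=.
by rewrite nat1r char0.
Qed.

Lemma gbinom_nat (q r : nat) : gbinom (q%:R : K) r = 'C(q, r)%:R.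
Proof.
elim: q r => [|q IH] [|r]; rewrite ?gbinom0 ?bin0 //.
  by rewrite bin0n /gbinom big_ord_recl /= subr0 mul0r mul0r.
by rewrite -natr1 gbinomS !IH binS natrD.
Qed.

Definition gbinom_poly (c : K) (r : nat) : {poly K} :=
  (r`!%:R)^-1 *: \prod_(i < r) ('X - (i%:R - c)%:P).

Lemma gbinom_polyE (c x : K) r : (gbinom_poly c r).[x] = gbinom (x + c) r.
Proof.
rewrite hornerZ horner_prod mulrC; congr (_ * _); apply: eq_bigr => i _.
by rewrite hornerXsubC opprB addrA.
Qed.

Lemma size_gbinom_poly c r : (size (gbinom_poly c r) <= r.+1)%N.
Proof.
apply: leq_trans (size_scale_leq _ _) _.
rewrite -(big_mkord xpredT (fun i => 'X - (i%:R - c)%:P)) size_prod_XsubC.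
by rewrite size_iota subn0.
Qed.

End GeneralizedBinomial.

(** * The powers [inv_pow f beta] at integers and as polynomials in beta *)

Section InversePower.
Variables (K : fieldType) (X : finType).
Hypothesis char0 : forall q : nat, (q%:R == 0 :> K) = (q == 0)%N.
Variable f : ncseries K X.
Hypothesis f1 : f [::] = 1.
Local Notation Sigma := (1 - f).

Let Sigma0 : Sigma [::] = 0.
Proof. by rewrite nc_addE nc_oppE f1 subrr. Qed.

Lemma inv_powE (beta : K) L w : (size w <= L)%N ->
  inv_pow f beta w = (\sum_(r < L.+1) gbinom (beta + r%:R - 1) r *: Sigma ^+ r) w.
Proof.
move=> lewL; rewrite nc_sumE /inv_pow /nc_sum.
rewrite (fsbig_ord _ L.+1 (fun r => (gbinom (beta + r%:R - 1) r *: Sigma ^+ r) w)).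
apply/esym/fsbig_widen => // r /= [_ /negP]; rewrite -leqNgt => ltr.
by rewrite /= nc_scaleE nc_exp_small ?mulr0 //; apply: leq_ltn_trans ltr.
Qed.

(** With [f = 1 - Sigma], this is Pascal's rule on each power of [Sigma]; truncation at [L] leaves a
    multiple of [Sigma ^+ L.+1], which vanishes on words of length [L]. *)
Lemma inv_powS (x : K) : inv_pow f (x + 1) * f = inv_pow f x.
Proof.
apply/funext => w; rewrite nc_mulE.
pose L := size w; pose T y := \sum_(r < L.+1) gbinom (y + r%:R - 1) r *: Sigma ^+ r.
transitivity ((T (x + 1) * f) w).
  rewrite nc_mulE; apply: eq_bigr => q _; congr (_ * _); apply: inv_powE.
  by rewrite size_take_min geq_minr.
rewrite (inv_powE x (leqnn L)) -/(T x).
have -> : T (x + 1) * f = T x - gbinom (x + L%:R) L *: Sigma ^+ L.+1.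
  rewrite -[X in T (x + 1) * X](subKr 1) mulrBr mulr1 {2}/T mulr_suml.
  under eq_bigr do rewrite -scalerAl -exprSr.
  rewrite big_ord_recr /= opprD addrA; congr (_ - _); last by rewrite addrAC addrK.
  rewrite /T big_ord_recl [in RHS]big_ord_recl /= !gbinom0 -addrA; congr (_ + _).
  rewrite -sumrB; apply: eq_bigr => r _; rewrite -scalerBl; congr (_ *: _).
  rewrite /bump add1n -natr1 !addrA.
  have -> : x + 1 + r%:R + 1 - 1 = x + r%:R + 1 by ring.
  have -> : x + 1 + r%:R - 1 = x + r%:R by ring.
  have -> : x + r%:R + 1 - 1 = x + r%:R by ring.
  by rewrite gbinomS // addrK.
by rewrite nc_addE nc_oppE nc_scaleE nc_exp_small // mulr0 subr0.
Qed.

Lemma inv_pow0 : inv_pow f 0 = 1.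
Proof.
apply/funext => w; rewrite (inv_powE 0 (leqnn (size w))) nc_sumE big_ord_recl /=.
rewrite gbinom0 scale1r big1 ?addr0 // => r _; rewrite nc_scaleE.
rewrite (_ : gbinom _ _ = 0) ?mul0r // /bump add1n -natr1 add0r addrK gbinom_nat //.
by rewrite bin_small.
Qed.

Lemma inv_pow_nat (N : nat) : inv_pow f N%:R = f^-1 ^+ N.
Proof.
have uf : f \is a GRing.unit by rewrite -[_ \is a _]/(_ != 0) f1 oner_eq0.
elim: N => [|N IH]; first exact: inv_pow0.
by apply: (mulIr uf); rewrite -natr1 inv_powS IH exprSr mulrVK.
Qed.

Lemma inv_pow_poly w : exists2 P : {poly K}, (size P <= (size w).+1)%N &
  forall beta, inv_pow f beta w = P.[beta].
Proof.
exists (\sum_(r < (size w).+1) (Sigma ^+ r) w *: gbinom_poly (r%:R - 1) r).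
  apply: leq_trans (size_sum _ _ _) _; apply/bigmax_leqP => r _; apply: leq_trans (size_scale_leq _ _) _.
  by apply: leq_trans (size_gbinom_poly _ _) _.
move=> beta; rewrite (inv_powE beta (leqnn (size w))) nc_sumE horner_sum.
apply: eq_bigr => r _.
by rewrite nc_scaleE hornerZ gbinom_polyE mulrC addrA.
Qed.

End InversePower.

(** * Class coefficients of series of o-sequences *)

Section OSequenceSeries.
Variables (K : fieldType) (m n : nat).
Hypothesis char0 : forall q : nat, (q%:R == 0 :> K) = (q == 0)%N.
Local Notation step := ('I_m * 'I_m)%type.
Local Notation series := (ncseries K step).
Implicit Types (w t : seq step) (mu : seq 'I_m).

Definition oseq_series (F : seq 'I_m -> K) : series :=
  nc_sum (fun mu => F mu *: oseq_monomial K mu).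

Lemma unzip2_oseq mu : unzip2 (oseq mu) = mu.
Proof. by rewrite unzip2_zip // size_sort. Qed.

Lemma oseq_seriesE F w :
  oseq_series F w = if w == oseq (unzip2 w) then F (unzip2 w) else 0.
Proof.
rewrite /oseq_series /nc_sum.
rewrite -(@fsbig_widen _ _ _ _ [set unzip2 w]%classic [set: seq 'I_m]%classic) //; last first.
  move=> mu /= [_ /eqP neq]; rewrite nc_scaleE /oseq_monomial nc_prodE.
  case: eqP => [e|]; last by rewrite mulr0.
  by case/eqP: neq; rewrite e unzip2_oseq.
rewrite fsbig_set1 nc_scaleE /oseq_monomial nc_prodE.
by case: ifP; rewrite ?mulr1 ?mulr0.
Qed.

(** Ensures that a class contains at most one o-sequence, so its class coefficient has at most one
    term. *)
Lemma sorted_rows_unique v w :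
  sorted (fun x y : step => (x.1 <= y.1)%N) v -> sorted (fun x y : step => (x.1 <= y.1)%N) w ->
  same_rows v w -> v = w.
Proof.
have le_tr : transitive (fun x y : step => (x.1 <= y.1)%N).
  by move=> a b c; apply: leq_trans.
elim: v w => [|x v IH] w sv sw vw.
  by have /perm_size/esym/size0nil -> := same_rows_perm vw.
have [a [b [ew xa vab]]] := same_rows_head vw; rewrite ew in sw vw *.
case: a xa vab sw vw {ew} => [|y a] xa vab sw vw.
  by rewrite (IH b) //; [apply: path_sorted sv | apply: path_sorted sw].
have lexy : (x.1 <= y.1)%N.
  have : y \in x :: v by rewrite (perm_mem (same_rows_perm vw)) inE eqxx.
  by rewrite inE => /predU1P[->//|yv]; apply: (allP (order_path_min le_tr sv)).
have leyx : (y.1 <= x.1)%N.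
  by apply: (allP (order_path_min le_tr sw)); rewrite mem_cat inE eqxx orbT.
case/negP: xa; rewrite inE; apply/orP; left; apply/eqP/val_inj/eqP.
by rewrite eqn_leq lexy.
Qed.

Definition sort_rows w := sort (fun x y : step => (x.1 <= y.1)%N) w.

Lemma sort_rows_same w : same_rows (sort_rows w) w.
Proof.
apply/same_rowsP => h; rewrite /steps_from /sort_rows.
have le_tr : transitive (fun x y : step => (x.1 <= y.1)%N).
  by move=> a b c; apply: leq_trans.
have le_tot : total (fun x y : step => (x.1 <= y.1)%N) by move=> x y; apply: leq_total.
rewrite filter_sort //; apply: sorted_sort => //.
elim: w => [//|x w IH] /=; case: eqP => // xh /=.
rewrite path_min_sorted //; apply/allP => y; rewrite mem_filter => /andP[/eqP yh _].
by rewrite /= xh yh.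
Qed.

Lemma oseq_sorted mu : sorted (fun x y : step => (x.1 <= y.1)%N) (oseq mu).
Proof.
have size_eq : size (nondec_rearrangement mu) = size mu by rewrite size_sort.
have : sorted (fun i j : 'I_m => (i <= j)%N) (nondec_rearrangement mu).
  by apply: sort_sorted => x y; apply: leq_total.
have {1}-> : nondec_rearrangement mu = unzip1 (oseq mu) by rewrite unzip1_zip ?size_eq.
by rewrite sorted_map.
Qed.

(** Balance makes the sorted starting heights the non-decreasing rearrangement of the ending
    heights. *)
Lemma sort_rows_oseq w : balanced w -> sort_rows w = oseq (unzip2 (sort_rows w)).
Proof.
rewrite -(balanced_same_rows (sort_rows_same w)) => bal.
rewrite {1}[sort_rows w](esym (zip_unzip _)); congr zip.
have le_tr : transitive (fun x y : 'I_m => (x <= y)%N) by move=> a b c; apply: leq_trans.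
apply: (@sorted_eq _ (fun i j : 'I_m => (i <= j)%N)) => //.
- by move=> x y /anti_leq /val_inj.
- by rewrite sorted_map; apply: sort_sorted => x y; apply: leq_total.
- by apply: sort_sorted => x y; apply: leq_total.
by rewrite perm_sym perm_sort perm_sym.
Qed.

Lemma class_coef_oseq_series F w : class_coef (oseq_series F) w =
  if balanced w then F (unzip2 (sort_rows w)) else 0.
Proof.
rewrite /class_coef; case: ifP => [bal|nbal]; last first.
  apply: big1 => t tw; rewrite oseq_seriesE; case: eqP => // e.
  by rewrite -(balanced_same_rows tw) e balanced_oseq in nbal.
have size_w : size (sort_rows w) == size w by rewrite size_sort.
rewrite (bigD1 (Tuple size_w)) /= ?sort_rows_same // [X in _ + X]big1 ?addr0.
  by rewrite oseq_seriesE -sort_rows_oseq // eqxx.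
move=> t /andP[tw neq]; rewrite oseq_seriesE; case: eqP => // e.
case/eqP: neq; apply: val_inj => /=; apply: sorted_rows_unique.
- by rewrite e; apply: oseq_sorted.
- by apply: sort_sorted => x y; apply: leq_total.
by apply: same_rows_trans tw _; rewrite same_rows_sym sort_rows_same.
Qed.

Lemma size_big_labels (us : seq (seq step)) (pi : 'S_(size us)) :
  size [seq val x | x <- [seq pi i | i : 'I_(size us)] & x \in big_cycles n us] =
  #|big_cycles n us|.
Proof.
rewrite size_map -(card_uniqP _); last first.
  by apply: filter_uniq; rewrite map_inj_uniq ?enum_uniq //; apply: perm_inj.
apply: eq_card => x; rewrite mem_filter andb_idr // => _; apply/mapP.
by exists (pi^-1%g x); rewrite ?mem_enum ?permKV.
Qed.

(** For [beta = N + 1] the upper index is [N + l - d], a natural number because [d <= l], so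
    [gbinom] is an ordinary binomial coefficient. *)
Lemma e_coef_nat (N : nat) mu (us := cycle_decomp mu) :
  e_coef n (N.+1%:R : K) mu =
  (#|levels N.+1 (meet_cycles (fun i : 'I_(size us) => nth [::] us i))
       (big_cycles n us) setT 0|)%:R.
Proof.
rewrite card_levels natr_sum; apply: eq_bigr => pi adm; rewrite -/us.
set l := #|_|; set d := descents_big n pi.
have le_dl : (d <= N + l)%N.
  apply: leq_trans (count_size _ _) _; rewrite size_iota size_big_labels -/l.
  by apply: leq_trans (leq_pred _) _; apply: leq_addl.
rewrite -gbinom_nat // natrB // natrD -natr1; congr (gbinom _ _).
by ring.
Qed.

Lemma e_coef_poly mu : exists2 P : {poly K}, (size P <= (size mu).+1)%N &
  forall beta, e_coef n beta mu = P.[beta].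
Proof.
have [_ _ le_us] := cycle_decomp_spec mu; set us := cycle_decomp mu in le_us.
pose l := #|big_cycles n us|.
exists (\sum_(pi : 'S_(size us) | admissible n pi)
   gbinom_poly (l%:R - 1 - (descents_big n pi)%:R) l).
  apply: leq_trans (size_sum _ _ _) _; apply/bigmax_leqP => pi _; apply: leq_trans (size_gbinom_poly _ _) _.
  rewrite ltnS; apply: leq_trans le_us; rewrite -[X in (_ <= X)%N]card_ord.
  exact: max_card.
move=> beta; rewrite horner_sum; apply: eq_bigr => pi _.
by rewrite gbinom_polyE !addrA.
Qed.

End OSequenceSeries.

(** * Conclusion *)

Section MainTheorem.
Variables (K : fieldType) (n p : nat).
Hypothesis char0 : forall q : nat, (q%:R == 0 :> K) = (q == 0)%N.
Local Notation m := (n + p)%N.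
Local Notation step := ('I_m * 'I_m)%type.
Local Notation series := (ncseries K step).
Local Notation A := (gen_mx K m).
Local Notation E := (cdet (1%:M - sylvester_mx A)).
Local Notation small := [set h : 'I_m | (h < n)%N].

Lemma cdet_all_cols : cdet (1%:M - A) = cdet (1%:M - cols_mx K [set: 'I_m]).
Proof. by congr cdet; apply/matrixP => i j; rewrite !mxE inE. Qed.

Lemma cdet_small_cols : cdet (1%:M - ulsubmx A) = cdet (1%:M - cols_mx K small).
Proof.
transitivity (cdet (block_mx (1%:M - ulsubmx A) 0 (- dlsubmx A) 1%:M)).
  by rewrite cdet_lblock cdet1 mulr1.
have colsE i j : (1%:M - cols_mx K small) i j =
    (i == j)%:R - (if (j < n)%N then ncvar K (i, j) else 0) by rewrite !mxE inE.
congr cdet; apply/matrixP => i j; rewrite colsE.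
case: (split_ordP i) => i' ->; case: (split_ordP j) => j' ->.
- by rewrite block_mxEul !mxE.
- by rewrite block_mxEur !mxE eq_lrshift subr0.
- by rewrite block_mxEdl !mxE eq_rlshift sub0r.
by rewrite block_mxEdr !mxE eq_rshift subr0.
Qed.

Lemma cdet_all_unit : cdet (1%:M - A) \is a GRing.unit.
Proof.
rewrite -[_ \is a _]/(_ != 0) -[X in X != 0]/(nc_const _) (map_cdet (@nc_const K _)) cdet_det.
rewrite (_ : map_mx _ _ = 1%:M) ?det1 ?oner_eq0 //; apply/matrixP => i j.
by rewrite !mxE rmorphB /= rmorph_nat [nc_const (ncvar _ _)]/= subr0.
Qed.

(** Equal to [det(I - C)^-1] in the quotient only, but its powers satisfy the relation of
    [PowersOfQuotient] already as series. *)
Let G : series := (cdet (1%:M - A))^-1 * cdet (1%:M - ulsubmx A).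

Lemma cf_eq_inv_pow_nat N : cf_eq (inv_pow E N%:R) (G ^+ N).
Proof.
apply/cf_piE; rewrite (inv_pow_nat char0 (cdet_sylvester_const K n p)) !rmorphXn; congr (_ ^+ _).
have uE : E \is a GRing.unit.
  by rewrite -[_ \is a _]/(_ != 0) cdet_sylvester_const oner_eq0.
have piEG : cf_pi E * cf_pi G = 1.
  rewrite [cf_pi E]cf_pi_cdet_sylvester -[X in X * _ = _]/(cf_pi _) -rmorphM /G.
  by rewrite -mulrA (mulVKr cdet_all_unit) mulVr ?rmorph1 // cdet_small_unit.
rewrite -[LHS]mulr1 -piEG mulrA -[cf_pi E^-1 * cf_pi E]rmorphM mulVr // rmorph1.
by rewrite mul1r.
Qed.

Lemma class_coef_quotient_pow (N : nat) w :
  class_coef (G ^+ N.+1) w = class_coef (oseq_series (@e_coef m K n N.+1%:R)) w.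
Proof.
have GS r : cdet (1%:M - cols_mx K [set: 'I_m]) * G ^+ r.+1 =
    cdet (1%:M - cols_mx K small) * G ^+ r.
  by rewrite -cdet_all_cols -cdet_small_cols exprS mulrA /G mulVKr ?cdet_all_unit.
have G0 : G ^+ 0 = 1 by [].
rewrite class_coef_oseq_series; case: ifPn => [bal|unbal]; last first.
  exact: (class_coef_unbalanced (F := fun r => G ^+ r) G0 GS).
set mu := unzip2 (sort_rows w); have [cyc rows _] := cycle_decomp_spec mu.
pose us := cycle_decomp mu; pose u := fun i : 'I_(size us) => nth [::] us i.
have cyc_u i : is_cycle (u i) by apply: (allP cyc); apply: mem_nth.
rewrite e_coef_nat // -/us.
have -> : class_coef (G ^+ N.+1) w = class_coef (G ^+ N.+1) (cycle_word u setT).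
  apply/esym/class_coef_same_rows; rewrite same_rows_sym.
  apply: (same_rows_trans (w := sort_rows w)); first by rewrite same_rows_sym sort_rows_same.
  rewrite (sort_rows_oseq bal) (_ : cycle_word u setT = flatten us) //.
  rewrite /cycle_word enum_setT -enumT; congr flatten.
  by rewrite -[RHS](mkseq_nth [::]) /mkseq -val_enum_ord -map_comp.
have := class_coef_levels (F := fun r => G ^+ r) G0 GS cyc_u setT (leqnn N.+1).
by rewrite subnn.
Qed.

Theorem cf_eq_inv_pow_oseq_series (beta : K) :
  cf_eq (inv_pow E beta) (oseq_series (@e_coef m K n beta)).
Proof.
pose H b : series := inv_pow E b - oseq_series (@e_coef m K n b).
have H_nat N : cf_ideal (H N.+1%:R).
  have : cf_eq (inv_pow E N.+1%:R) (oseq_series (@e_coef m K n N.+1%:R)); last by [].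
  apply/cf_piE; have /cf_piE -> := cf_eq_inv_pow_nat N.+1; apply/cf_piE.
  by apply: cf_eq_class_coef => w; apply: class_coef_quotient_pow.
have H_poly w : exists2 P : {poly K}, (size P <= (size w).+1)%N & forall b, H b w = P.[b].
  have [P sP PE] := inv_pow_poly (cdet_sylvester_const K n p) w.
  have [Q sQ QE] := e_coef_poly K n (unzip2 w).
  exists (P - (if w == oseq (unzip2 w) then Q else 0)).
    apply: leq_trans (size_polyD _ _) _; rewrite geq_max sP size_polyN.
    by case: ifP; rewrite ?size_poly0 // size_map in sQ *.
  move=> b; rewrite hornerD hornerN -PE /H nc_addE nc_oppE oseq_seriesE.
  by case: ifP; rewrite ?QE ?horner0.
apply: (closed_ideal_closed (closed_ideal_cf K m)) => L.
(* The nodes 1, ..., L + 1 are positive integers, where [H] lies in the ideal, and they determine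
   polynomials of degree at most [L]. *)
pose x (j : nat) : K := j.+1%:R.
have x_inj : injective x.
  move=> i j /eqP; rewrite /x -subr_eq0; wlog le_ij : i j / (i <= j)%N.
    move=> IH; have [|/ltnW] := leqP i j; first exact: IH.
    by move=> le_ji e; apply/esym/(IH j i le_ji); rewrite -opprB oppr_eq0.
  by rewrite -opprB oppr_eq0 -natrB // char0 subSS subn_eq0 => le_ji; apply/eqP; rewrite eqn_leq le_ij.
pose c (j : 'I_L.+1) : K := (tnth (lagrange L.+1 x) j : {poly K}).[beta].
(* This finite combination lies in the ideal and agrees with [H beta] on all words of length at most
   [L]; closedness of the ideal then gives [H beta]. *)
exists (\sum_(j < L.+1) c j *: H (x j)).
  elim/big_ind: _ => [|f g If Ig|j _]; first exact: closed_ideal0 (closed_ideal_cf K m).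
    rewrite -[g]opprK; apply: (closed_idealB (closed_ideal_cf K m)) => //.
    rewrite -[- g]add0r; apply: (closed_idealB (closed_ideal_cf K m)) => //.
    exact: closed_ideal0 (closed_ideal_cf K m).
  rewrite -[H _]mul1r scalerAl; apply: (closed_idealMl (closed_ideal_cf K m)).
  exact: H_nat.
move=> w le_w; rewrite nc_sumE -[RHS]/(H beta w); have [P sP PE] := H_poly w.
rewrite PE [in RHS](lagrange_gen (n := L.+1) (x := x) _ x_inj (leq_trans sP _)) //.
rewrite horner_sum; apply: eq_bigr => j _.
by rewrite nc_scaleE PE hornerM hornerC mulrC.
Qed.

End MainTheorem.

(* m = n + p; the condition 1 <= n < m is 0 < n and 0 < p. *)
Theorem theorem11p1 (R : realType) (n p : nat) (n_gt0 : (0 < n)%N)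
    (p_gt0 : (0 < p)%N) (beta : R[i]) :
  let A := gen_mx R[i] (n + p) in
  let C := sylvester_mx A in
  cf_eq (inv_pow (cdet (1%:M - C)) beta)
        (nc_sum (fun mu : seq 'I_(n + p) =>
           e_coef n beta mu *: oseq_monomial R[i] mu)).
Proof.
by apply: cf_eq_inv_pow_oseq_series => q; rewrite pnatr_eq0.
Qed.
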